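(* Let $\mathcal X\subset\mathcal X'\times\mathcal X''$ be a subset of a product of two spaces of homogeneous type satisfying conditions (a) and (b) of the context, with a dyadic filtration on $\mathcal X$. Let $p,q,p',q'\in(1,\infty)$ (here $p',q'$ are arbitrary exponents, not conjugates), $K_0\ge1$, $w_1=w_1(x')\in A_{p'}(\mu_1)$, $w_2=w_2(x'')\in A_{q'}(\mu_2)$, $[w_1]_{A_{p'}}\le K_0$, $[w_2]_{A_{q'}}\le K_0$, $w=w(x)=w_1(x')w_2(x'')$, and $f\in L_{p,q}(w\,d\mu)$ (with $f\in L_{1,\mathrm{loc}}(\mathcal X,\mu)$, so that $f^{\#}_{\mathrm{dy}}$ is defined). Suppose that either $\mu(\mathcal X)=\infty$, or $\operatorname{supp}f\subset B_{r_0}(x_0)$ and $\mu(B_{r_0}(x_0))\le\varepsilon\mu(\mathcal X)$ for some $r_0\in(0,\infty)$ and $x_0\in\mathcal X$, where $\varepsilon>0$ is a constant depending on $K_1,K_2,p,q,p',q'$, and $K_0$. Then $$\|f\|_{L_{p,q}(w\,d\mu)}\le N\|f^{\#}_{\mathrm{dy}}\|_{L_{p,q}(w\,d\mu)},$$ where $N=N(K_1,K_2,p,q,p',q',K_0)>0$.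
   Context: Space of homogeneous type $(\mathcal X,\rho,\mu)$: $\rho$ is a quasi-metric, i.e. a nonnegative symmetric function with $\rho(x,y)=0$ iff $x=y$ and $\rho(x,y)\le K_1(\rho(x,z)+\rho(z,y))$; $B_r(x)=\{y:\rho(x,y)<r\}$; balls are assumed open; $\mu$ is a complete Borel measure on a $\sigma$-algebra containing all balls, with $0<\mu(B_{2r}(x))\le K_2\mu(B_r(x))<\infty$; the Lebesgue differentiation theorem is assumed to hold. $K_1,K_2$ denote the constants in these two inequalities for the spaces of homogeneous type involved. For $p\in(1,\infty)$, $A_p(\mu)$ is the set of nonnegative measurable $w$ with $$[w]_{A_p}=\sup_{x_0,\,r>0}\Big(\frac1{\mu(B_r(x_0))}\int_{B_r(x_0)}w\,d\mu\Big)\Big(\frac1{\mu(B_r(x_0))}\int_{B_r(x_0)}w^{-1/(p-1)}\,d\mu\Big)^{p-1}<\infty.$$ Product setting: $(\mathcal X',\rho_1,\mu_1)$ and $(\mathcal X'',\rho_2,\mu_2)$ are spaces of homogeneous type; points are $x=(x',x'')$; $\mu$ is the completion of the product measure on $\mathcal X'\times\mathcal X''$ (and also denotes its restriction to $\mathcal X$) and $\rho((x',x''),(y',y''))=\rho_1(x',y')+\rho_2(x'',y'')$. $\mathcal X\subset\mathcal X'\times\mathcal X''$ satisfies: (a) $(\mathcal X,\rho|_{\mathcal X\times\mathcal X},\mu|_{\mathcal X})$ is of homogeneous type; (b) for any $p\in(1,\infty)$, $w_1=w_1(x')\in A_p(\mu_1)$ and $w_2=w_2(x'')\in A_p(\mu_2)$,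 the function $w(x)=w_1(x')w_2(x'')$ is an $A_p$ weight on $(\mathcal X,\rho|_{\mathcal X\times\mathcal X},\mu|_{\mathcal X})$. Mixed norm: for $w=w_1(x')w_2(x'')$, $$\|f\|_{L_{p,q}(w\,d\mu)}=\Big(\int_{\mathcal X''}\Big(\int_{\mathcal X'}|f|^pI_{\mathcal X}\,w_1(x')\,\mu_1(dx')\Big)^{q/p}w_2(x'')\,\mu_2(dx'')\Big)^{1/q}.$$ Dyadic filtration on $\mathcal X$ (exists by Christ's theorem): for each $n\in\mathbb Z$ a collection $\mathbb C_n=\{Q^n_\alpha:\alpha\in I_n\}$ of disjoint open subsets such that (1) $\mu(\mathcal X\setminus\bigcup_\alpha Q^n_\alpha)=0$; (2) for each $n$ and $\alpha\in I_n$ there is a unique $\beta\in I_{n-1}$ with $Q^n_\alpha\subset Q^{n-1}_\beta$; (3) $\operatorname{diam}(Q^n_\alpha)\le N_0\delta^n$; (4) each $Q^n_\alpha$ contains a ball $B_{\varepsilon_0\delta^n}(z^n_\alpha)$; $\delta\in(0,1)$, $\varepsilon_0>0$, $N_0$ depend only on the constants $K_1,K_2$. With $\tilde{\mathcal X}=\bigcap_n\bigcup_\alpha Q^n_\alpha$ and, for $f\in L_{1,\mathrm{loc}}(\mathcal X,\mu)$, $f_{|n}(x)=\frac1{\mu(Q^n_\alpha)}\int_{Q^n_\alpha}f\,d\mu$ for $x\in Q^n_\alpha$, the dyadic sharp function is $f^{\#}_{\mathrm{dy}}(x)=\sup_{n<\infty}\frac1{\mu(Q^n_\alpha)}\int_{Q^n_\alpha\ni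 x}|f(y)-f_{|n}(x)|\,\mu(dy)$ for $x\in\tilde{\mathcal X}$ and $0$ otherwise. $L_{1,\mathrm{loc}}$ means integrable on balls.
   Formalization: Condition (b) is taken quantitatively: the A_p constant of w_1w_2 on X is at most Φ(p,K) whenever [w_1],[w_2] ≤ K, and ε and N may also depend on Φ; with (b) only qualitative, N cannot be uniform over X. *)

(* Defs.v *)
From HB Require Import structures.
From mathcomp Require Import all_boot all_order all_algebra.
From mathcomp Require Import all_classical all_reals all_analysis.

Set Implicit Arguments.
Unset Strict Implicit.
Unset Printing Implicit Defensive.
Import Order.TTheory GRing.Theory Num.Theory.
Import numFieldNormedType.Exports.

Local Open Scope classical_set_scope.
Local Open Scope ring_scope.
Local Open Scope ereal_scope.

(* A subset X of an ambient type T carries the restrictions of a quasi-metric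
   rho and of a measure mu defined on T; only their values on X (and, for mu, on
   measurable subsets of X) are ever used.  A whole space is the case X = setT. *)
Section QuasiMetric.
Context (R : realType) (T : Type).
Implicit Types (X U A : set T) (rho : T -> T -> R).

Definition qball X rho (x : T) (r : R) : set T :=
  [set y | X y /\ (rho x y < r)%R].

Definition quasi_metric X rho (K1 : R) : Prop :=
  [/\ forall x y, X x -> X y -> (0 <= rho x y)%R,
      forall x y, X x -> X y -> rho x y = rho y x,
      forall x y, X x -> X y -> (rho x y = 0%R <-> x = y) &
      forall x y z, X x -> X y -> X z ->
        (rho x y <= K1 * (rho x z + rho z y))%R].

Definition qopen X rho U : Prop :=
  U `<=` X /\
  forall x, U x -> exists r : R, (0 < r)%R /\ qball X rho x r `<=` U.

Definition qdiam rho A : \bar R :=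
  ereal_sup [set (rho z.1 z.2)%:E | z in A `*` A].

End QuasiMetric.

Section Homogeneous.
Context (R : realType) (d : measure_display) (T : measurableType d).
Variable mu : {measure set T -> \bar R}.
Implicit Types (X A : set T) (rho : T -> T -> R).

Definition avg A (g : T -> \bar R) : \bar R := (mu A)^-1 * \int[mu]_(x in A) g x.

Definition L1loc X rho (f : T -> R) : Prop :=
  measurable_fun X f /\
  forall (x : T) (r : R), X x -> (0 < r)%R ->
    mu.-integrable (qball X rho x r) (EFin \o f).

Definition lebesgue_differentiation X rho : Prop :=
  forall f : T -> R, L1loc X rho f ->
    {ae mu, forall x, X x ->
      avg (qball X rho x r) (EFin \o f) @[r --> 0%R^'+] --> (f x)%:E}.

Record homogeneous_type X rho (K1 K2 : R) : Prop := HomogeneousType {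
  ht_measurable : measurable X;
  ht_quasi_metric : quasi_metric X rho K1;
  ht_ball_open : forall (x : T) (r : R), X x -> (0 < r)%R ->
    qopen X rho (qball X rho x r);
  ht_borel : forall U, qopen X rho U -> measurable U;
  ht_complete : forall A, A `<=` X -> mu.-negligible A -> measurable A;
  ht_doubling : forall (x : T) (r : R), X x -> (0 < r)%R ->
    [/\ 0 < mu (qball X rho x (2 * r)),
        mu (qball X rho x (2 * r)) <= K2%:E * mu (qball X rho x r) &
        mu (qball X rho x r) < +oo];
  ht_lebesgue : lebesgue_differentiation X rho }.

(* The inverse is taken in \bar R, where 0^-1 = +oo: the real power 0 `^ s is 0
   for every s != 0, also for s < 0, so w `^ (- (p - 1)^-1) would be wrong on
   the zero set of w. *)
Definition Ap_const X rho (p : R) (w : T -> R) : \bar R :=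
  ereal_sup [set
    avg (qball X rho z.1 z.2) (EFin \o w) *
    (avg (qball X rho z.1 z.2)
       (fun y => ((w y)%:E `^ (p - 1)^-1)^-1)) `^ (p - 1)
    | z in X `*` [set r : R | (0 < r)%R]].

Definition Ap_weight X rho (p : R) (w : T -> R) : Prop :=
  [/\ forall x, X x -> (0 <= w x)%R,
      measurable_fun X w &
      Ap_const X rho p w < +oo].

Record dyadic_filtration X rho (delta eps0 N0 : R) (I : int -> Type)
    (Q : forall n : int, I n -> set T) : Prop := DyadicFiltration {
  df_open : forall n a, qopen X rho (Q n a);
  df_disjoint : forall n, trivIset setT (Q n);
  df_full : forall n, mu (X `\` \bigcup_a Q n a) = 0;
  df_nested : forall (n : int) a, exists! b, Q n a `<=` Q (n - 1)%R b;
  df_diam : forall n a, qdiam rho (Q n a) <= (N0 * delta ^ n)%:E;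
  df_ball : forall n a, exists z, X z /\
    qball X rho z (eps0 * delta ^ n) `<=` Q n a }.

Definition dyadic_core (I : int -> Type) (Q : forall n : int, I n -> set T)
    : set T := \bigcap_n \bigcup_a Q n a.

(* For x in the core and every n, exactly one cube Q n a contains x. *)
Definition dyadic_sharp (I : int -> Type) (Q : forall n : int, I n -> set T)
    (f : T -> R) (x : T) : \bar R :=
  if x \in dyadic_core Q then
    ereal_sup [set s | exists n (a : I n), Q n a x /\
      s = avg (Q n a) (fun y => `|(f y)%:E - avg (Q n a) (EFin \o f)|)]
  else 0.

End Homogeneous.

Section Product.
Context (R : realType) (d1 d2 : measure_display)
  (T1 : measurableType d1) (T2 : measurableType d2).
Variables (mu1 : {sigma_finite_measure set T1 -> \bar R})
          (mu2 : {sigma_finite_measure set T2 -> \bar R}).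
Implicit Types X : set (T1 * T2).

(* The measure lives on the Caratheodory sigma-algebra of the outer measure
   induced by the product measure; by sigma-finiteness this is the completion
   of the product sigma-algebra. *)
Definition completed_product :=
  @completed_measure_extension _ _ _
    (mu1 \x mu2 : {measure set (T1 * T2) -> \bar R}).

HB.instance Definition _ := Measure.on completed_product.

Definition sum_metric (rho1 : T1 -> T1 -> R) (rho2 : T2 -> T2 -> R)
    (x y : T1 * T2) : R := (rho1 x.1 y.1 + rho2 x.2 y.2)%R.

Definition prod_weight (w1 : T1 -> R) (w2 : T2 -> R) (x : T1 * T2) : R :=
  (w1 x.1 * w2 x.2)%R.

(* Every product of A_p weights is an A_p weight on X, with a constant controlled
   through Phi by a bound K on the constants of the factors.  Without such a Phi
   the A_p constant of the product is not bounded in terms of K1, K2, p and K: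
   it also reflects how thin X is inside T1 * T2. *)
Definition product_weights_Ap X (rho1 : T1 -> T1 -> R) (rho2 : T2 -> T2 -> R)
    (Phi : R -> R -> R) : Prop :=
  forall (p K : R) (w1 : T1 -> R) (w2 : T2 -> R), (1 < p)%R ->
    Ap_weight mu1 setT rho1 p w1 -> Ap_weight mu2 setT rho2 p w2 ->
    Ap_const mu1 setT rho1 p w1 <= K%:E ->
    Ap_const mu2 setT rho2 p w2 <= K%:E ->
    Ap_weight completed_product X (sum_metric rho1 rho2) p (prod_weight w1 w2) /\
    Ap_const completed_product X (sum_metric rho1 rho2) p (prod_weight w1 w2)
      <= (Phi p K)%:E.

Definition mixed_norm X (p q : R) (w1 : T1 -> R) (w2 : T2 -> R)
    (f : T1 * T2 -> \bar R) : \bar R :=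
  (\int[mu2]_x2
     ((\int[mu1]_x1 (`|f (x1, x2)| `^ p * (\1_X (x1, x2))%:E * (w1 x1)%:E))
        `^ (q / p) * (w2 x2)%:E)) `^ q^-1.

End Product.

Arguments completed_product {R d1 d2 T1 T2} mu1 mu2 _.

(* Main.v *)
(** The heart of the matter is a one-exponent inequality on X: for an A_P
    weight W, the integral of |f|^s W is bounded by that of (f^#)^s W.  It
    comes from a good-lambda argument: on a maximal dyadic cube where the
    average of |f| exceeds l, either f^# >= l/8 everywhere or |f| >= l/2 on
    half of the cube, and a subset that is not large in mu-proportion is not
    large in W-proportion; the assumption on mu(X) or supp f excludes large
    averages at all scales.  With W(x) = w1(x') v(x'') and s = p, Tonelli's
    theorem turns this inequality into

      int A v dmu2 <= N int B v dmu2   for all v in A_P(mu2),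

    where A and B are the inner integrals of |f|^p w1 and (f^#)^p w1.  Rubio
    de Francia extrapolation passes from exponent 1 to exponent r = q/p: for
    r > 1 test with v = H w2, where H is an A_1(w2) majorant of A^(r-1); for
    r < 1 test with v = H^(-2(1-r)/r) w2, where H majorizes (A+B)^(r/2).
    Instead of Hoelder's inequality one compares the two factors pointwise
    and treats both cases. *)
Require Import Defs.
From HB Require Import structures.
From mathcomp Require Import all_boot all_order all_algebra.
From mathcomp Require Import finmap measurable_realfun.
From mathcomp Require Import all_classical all_reals all_analysis.
From mathcomp Require Import ring lra.
Import Order.TTheory GRing.Theory Num.Theory.
Import numFieldNormedType.Exports.
Set Implicit Arguments.
Unset Strict Implicit.
Unset Printing Implicit Defensive.
Local Open Scope classical_set_scope.
Local Open Scope ring_scope.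
Local Open Scope ereal_scope.

(** * Disjoint families and dyadic cubes *)

Lemma le_powR (R : realType) (r x y : R) :
  (0 <= r -> 0 <= x -> x <= y -> x `^ r <= y `^ r)%R.
Proof. by move=> r0 x0 xy; apply: ge0_ler_powR; rewrite ?nnegrE// (le_trans x0). Qed.

Lemma le_poweR (R : realType) (r : R) (x y : \bar R) :
  (0 <= r)%R -> 0 <= x -> x <= y -> x `^ r <= y `^ r.
Proof.
by move=> r0 x0 xy; apply: gt0_ler_poweR; rewrite ?in_itv/= ?leey ?andbT// (le_trans x0).
Qed.

Lemma exists_expr_gt (R : realType) (b r : R) : (1 < b)%R -> exists k, (r < b ^+ k)%R.
Proof.
move=> b1; have h k : (1 + k%:R * (b - 1) <= b ^+ k)%R.
  elim: k => [|k IH]; first by rewrite mul0r addr0 expr0.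
  rewrite exprS; have : (b * (1 + k%:R * (b - 1)) <= b * b ^+ k)%R.
    by rewrite ler_pM2l// (lt_trans _ b1).
  apply: le_trans; rewrite -natr1; have : (0 <= k%:R * ((b - 1) * (b - 1)) :> R)%R.
    by rewrite mulr_ge0// mulr_ge0// subr_ge0 ltW.
  lra.
exists (Num.trunc (`|r| / (b - 1))).+1; apply: lt_le_trans (h _).
have := truncnS_gt (`|r| / (b - 1))%R; rewrite ltr_pdivrMr ?subr_gt0// => h1.
by apply: (le_lt_trans (ler_norm r)); lra.
Qed.

Lemma measurable_bigcup_countType (d : measure_display) (T : measurableType d)
    (I : countType) (F : I -> set T) :
  (forall i, measurable (F i)) -> measurable (\bigcup_i F i).
Proof.
move=> mF.
have -> : \bigcup_i F i =
    \bigcup_k (if choice.unpickle k is Some i then F i else set0).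
  apply/seteqP; split => [x [i _ Fx]|x [k _]].
    by exists (choice.pickle i) => //; rewrite choice.pickleK.
  by case: choice.unpickle => // i Fx; exists i.
by apply: bigcup_measurable => k _; case: choice.unpickle.
Qed.

Lemma measurable_bigcap_countType (d : measure_display) (T : measurableType d)
    (I : countType) (F : I -> set T) :
  (forall i, measurable (F i)) -> measurable (\bigcap_i F i).
Proof.
move=> mF; rewrite -[X in measurable X]setCK setC_bigcap; apply: measurableC.
by apply: measurable_bigcup_countType => i; exact: measurableC.
Qed.

Lemma emeasurable_fun_gt (d : measure_display) (T : measurableType d)
    (R : realType) (D : set T) (f : T -> \bar R) :
  (forall t : R, measurable (D `&` [set x | t%:E < f x])) -> measurable_fun D f.
Proof.
move=> h; apply: (measurability _ (ErealGenOInfty.measurableE R)).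
move=> _ [_ [t ->] <-]; rewrite [X in measurable (_ `&` X)](_ : _ = [set x | t%:E < f x]) //.
by apply/seteqP; split => x /=; rewrite in_itv /= andbT.
Qed.

Lemma measurable_ltr_set (d : measure_display) (T : measurableType d)
    (R : realType) (D : set T) (f g : T -> R) : measurable D ->
  measurable_fun D f -> measurable_fun D g ->
  measurable (D `&` [set x | (f x < g x)%R]).
Proof.
move=> mD mf mg; rewrite (_ : _ `&` _ = D `&` [set x | 0%:E < (g x - f x)%:E]).
  apply: emeasurable_fun_o_infty => //.
  by apply/measurable_EFinP; exact: measurable_funB.
by apply/seteqP; split => x /=; rewrite lte_fin subr_gt0.
Qed.

Lemma negligible_bigcup_countType (d : measure_display) (T : measurableType d)
    (R : realType) (mu : {measure set T -> \bar R}) (I : countType) (F : I -> set T) :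
  (forall i, mu.-negligible (F i)) -> mu.-negligible (\bigcup_i F i).
Proof.
move=> nF.
have -> : \bigcup_i F i =
    \bigcup_k (if choice.unpickle k is Some i then F i else set0).
  apply/seteqP; split => [x [i _ Fx]|x [k _]].
    by exists (choice.pickle i) => //; rewrite choice.pickleK.
  by case: choice.unpickle => // i Fx; exists i.
by apply: negligible_bigcup => k; case: choice.unpickle => //; exact: negligible_set0.
Qed.

Section DisjointFamilies.
Context (R : realType) (d : measure_display) (T : measurableType d).
Variable mu : {measure set T -> \bar R}.
Implicit Types (X A : set T) (D : set (set T)).

Lemma finite_disjoint_large D X (e : R) :
  measurable X -> mu X < +oo -> (0 < e)%R -> trivIset D id ->
  (forall A, D A -> measurable A /\ e%:E <= mu (A `&` X)) -> finite_set D.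
Proof.
move=> mX Xoo e0 tD DA; apply: contrapT => infD.
have [M XM] : exists M : R, mu X = M%:E.
  by exists (fine (mu X)); rewrite fineK // ge0_fin_numE.
have M0 : (0 <= M)%R by rewrite -lee_fin -XM.
pose n := (Num.trunc (M / e)).+1.
have [B BD nB] := infinite_set_fset n infD.
have : (\sum_(A <- B) mu (A `&` X) <= mu X).
  rewrite -measure_fbigsetU; first last.
  - move=> i j Bi Bj [x [[ix _] [jx _]]].
    by apply: tD; [exact: BD|exact: BD|exists x].
  - by move=> i iB; apply: measurableI => //; have [] := DA _ (BD _ iB).
  apply: le_measure; rewrite ?inE//.
  - rewrite big_seq; apply: bigsetU_measurable => i iB.
    by apply: measurableI => //; have [] := DA _ (BD _ iB).
  - by rewrite -bigcup_fset; apply: bigcup_sub => i _ x [].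
have : \sum_(A <- B) e%:E <= \sum_(A <- B) mu (A `&` X).
  by rewrite big_seq [leRHS]big_seq; apply: lee_sum => i iB; have [] := DA _ (BD _ iB).
move=> h1 h2; have := le_trans h1 h2.
rewrite sumEFin big_const_seq count_predT iter_addr addr0 XM lee_fin -mulr_natr.
rewrite leNgt; apply/negP/negPn.
apply: lt_le_trans (_ : e * n%:R <= _)%R; last first.
  by rewrite ler_pM2l// ler_nat.
rewrite -ltr_pdivrMl// mulrC.
by have := truncnS_gt (M / e).
Qed.

Definition finite_cover X :=
  exists F : nat -> set T, (forall k, measurable (F k) /\ mu (F k) < +oo) /\
    X `<=` \bigcup_k F k.

Lemma countable_disjoint_positive D X : finite_cover X -> trivIset D id ->
  (forall A, D A -> [/\ measurable A, A `<=` X & 0 < mu A]) -> countable D.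
Proof.
move=> [F [mF XF]] tD DA.
pose D' k j := [set A | D A /\ (j.+1%:R^-1)%:E <= mu (A `&` F k)].
have DD' : D `<=` \bigcup_k \bigcup_j D' k j.
  move=> A /[dup] DA' /DA[mA AX A0]; apply: contrapT => nA.
  have AF k : mu (A `&` F k) = 0.
    apply/eqP; rewrite eq_le measure_ge0 andbT leNgt; apply/negP => Fk0.
    apply: nA; exists k => //.
    have Ffin : mu (A `&` F k) \is a fin_num.
      rewrite ge0_fin_numE//; apply: le_lt_trans (mF k).2.
      by apply: le_measure; rewrite ?inE//; [apply: measurableI => //; have [] := mF k|have [] := mF k].
    have [j jF] : exists j : nat, (j.+1%:R^-1 <= fine (mu (A `&` F k)))%R.
      have f0 : (0 < fine (mu (A `&` F k)))%R by rewrite fine_gt0// Fk0 -ge0_fin_numE.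
      exists (Num.trunc (fine (mu (A `&` F k)))^-1).
      rewrite -[leRHS]invrK lef_pV2 ?posrE ?invr_gt0//.
      exact/ltW/truncnS_gt.
    by exists j => //; split => //; rewrite -[leRHS]fineK.
  have : mu A <= 0.
    suff : mu.-negligible A by move=> /measure_negligible ->.
    have -> : A = \bigcup_k (A `&` F k).
      by rewrite -setI_bigcupr; apply/esym/setIidl; exact: subset_trans XF.
    apply: negligible_bigcup => k; apply/negligibleP; last exact: AF.
    by apply: measurableI => //; have [] := mF k.
  by rewrite leNgt A0.
apply: sub_countable (_ : countable (\bigcup_k \bigcup_j D' k j)); first exact: subset_card_le.
apply: bigcup_countable => // k _; apply: bigcup_countable => // j _.
apply: finite_set_countable.
apply: (@finite_disjoint_large _ (F k) (j.+1%:R^-1)); [by have [] := mF k|by have [] := mF k|by rewrite invr_gt0| |].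
  by move=> A B [DA1 _] [DB _]; exact: tD.
by move=> A [/DA[]].
Qed.

Lemma le_integral_disjoint_union D X (phi psi : T -> \bar R) :
  finite_cover X -> trivIset D id ->
  (forall A, D A -> [/\ measurable A, A `<=` X & 0 < mu A]) ->
  let U := \bigcup_(A in D) A in
  measurable_fun U phi -> measurable_fun U psi ->
  (forall x, U x -> 0 <= phi x) -> (forall x, U x -> 0 <= psi x) ->
  (forall A, D A -> \int[mu]_(x in A) phi x <= \int[mu]_(x in A) psi x) ->
  measurable U /\ \int[mu]_(x in U) phi x <= \int[mu]_(x in U) psi x.
Proof.
move=> Xc tD DA U mphi mpsi phi0 psi0 h.
have /countable_injP[f finj] := countable_disjoint_positive Xc tD DA.
pose F n := \bigcup_(A in D `&` [set A | f A = n]) A.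
have FA A : D A -> F (f A) = A.
  move=> DA'; apply/seteqP; split => [x [B [DB fB] Bx]|x Ax]; last by exists A.
  by rewrite -(finj _ _ _ _ fB)// inE.
have F0 n : (exists2 A, D A & F n = A) \/ F n = set0.
  have [[A [DA' fA]]|nA] := pselect (exists A, D A /\ f A = n).
    by left; exists A => //; rewrite -fA FA.
  right; apply/seteqP; split => // x [A [DA' fA] _]; apply: nA.
  by exists A.
have mF n : measurable (F n).
  by case: (F0 n) => [[A /DA[mA _ _] ->]//|->]; exact: measurable0.
have UF : U = \bigcup_n F n.
  apply/seteqP; split => [x [A DA' Ax]|x [n _]].
    by exists (f A) => //; rewrite FA.
  by case: (F0 n) => [[A DA' ->] Ax|->//]; exists A.
have tF : trivIset setT F.
  move=> m n _ _ [x [Fmx Fnx]].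
  case: Fmx => A [DA' <-] Ax; case: Fnx => B [DB <-] Bx.
  by rewrite (tD A B)//; exists x.
split; first by rewrite UF; exact: bigcup_measurable.
rewrite UF in mphi mpsi phi0 psi0 *.
rewrite !ge0_integral_bigcup//.
apply: lee_nneseries => n _.
  move=> _; apply: integral_ge0 => x Fx; apply: phi0; by exists n.
case: (F0 n) => [[A DA' ->]|->]; first exact: h.
by rewrite !integral_set0.
Qed.

End DisjointFamilies.

Lemma int_min_exists (P : int -> Prop) n0 n : P n ->
  (forall m : int, (m <= n0)%R -> ~ P m) ->
  exists2 k, P k & forall m : int, (m < k)%R -> ~ P m.
Proof.
move=> Pn nP.
have n0n : (n0 <= n)%R by rewrite leNgt; apply/negP => /ltW /nP.
pose p k := `[< P (n0 + k%:Z)%R >].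
have exp : exists k, p k.
  exists `|(n - n0)%R|%N; apply/asboolP.
  by rewrite gez0_abs ?subr_ge0// addrC subrK.
case: (ex_minnP exp) => k /asboolP Pk kmin.
exists (n0 + k%:Z)%R => // m mk Pm.
have n0m : (n0 <= m)%R by rewrite leNgt; apply/negP => /ltW /nP.
have : p `|(m - n0)%R|%N.
  by apply/asboolP; rewrite gez0_abs ?subr_ge0// addrC subrK.
move=> /kmin; rewrite -lez_nat gez0_abs ?subr_ge0// lerBrDl leNgt mk.
by [].
Qed.

Section Cubes.
Context (R : realType) (d : measure_display) (T : measurableType d).
Variable mu : {measure set T -> \bar R}.
Context (I : int -> Type) (Q : forall n : int, I n -> set T).

(* The cube of generation [n] around [x]; empty if there is none. *)
Definition cub (n : int) (x : T) : set T := [set y | exists a, Q a x /\ Q (n:=n) a y].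

Record dyadic_cubes (X : set T) (D : R) : Prop := DyadicCubes {
  dc_meas : measurable X;
  dc_cover : finite_cover mu X;
  dc_cube : forall n (a : I n), [/\ measurable (Q a), Q a `<=` X, 0 < mu (Q a) & mu (Q a) < +oo];
  dc_disj : forall n (a b : I n) x, Q a x -> Q b x -> Q a = Q b;
  dc_nest : forall n (a : I n), exists b : I (n - 1)%R, Q a `<=` Q b;
  dc_pos : (0 < D)%R;
  dc_parent : forall n x, cub n x x -> mu (cub (n - 1)%R x) <= D%:E * mu (cub n x) }.

Context (X : set T) (D : R).
Hypothesis dc : dyadic_cubes X D.

Lemma cubP n a x : Q (n:=n) a x -> cub n x = Q a.
Proof.
move=> ax; apply/seteqP; split => [y [b [bx yb]]|y ay]; last by exists a.
by rewrite (dc_disj dc ax bx).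
Qed.

Lemma cub_self n x y : cub n x y -> cub n x x.
Proof. by move=> [a [ax ay]]; exists a. Qed.

Lemma cub_eq n x y : cub n x y -> cub n y = cub n x.
Proof. by move=> [a [ax ay]]; rewrite (cubP ax) (cubP ay). Qed.

Lemma cub_cube n x : cub n x x ->
  [/\ measurable (cub n x), cub n x `<=` X, 0 < mu (cub n x) & mu (cub n x) < +oo].
Proof. by move=> [a [ax _]]; rewrite (cubP ax); exact: (dc_cube dc). Qed.

Lemma cub_set0 n x : ~ cub n x x -> cub n x = set0.
Proof. by move=> h; apply/seteqP; split => // y /cub_self. Qed.

Lemma cub_mono (m n : int) x : (m <= n)%R -> cub n x `<=` cub m x.
Proof.
move=> mn; have -> : n = (m + `|(n - m)%R|%N%:Z)%R.
  by rewrite gez0_abs ?subr_ge0// addrC subrK.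
elim: `|(n - m)%R|%N => [|k IH]; first by rewrite addr0.
move=> y [a [ax ay]]; apply: IH.
have [b ab] := dc_nest dc a.
have e : (m + k.+1%:Z - 1 = m + k%:Z)%R by rewrite -addrA intS [(1 + _)%R]addrC addrK.
by rewrite -e; exists b; split; exact: ab.
Qed.

Lemma cub_self_mono (m n : int) x : (m <= n)%R -> cub n x x -> cub m x x.
Proof. by move=> mn; exact: cub_mono. Qed.

Definition stopping (S : set T -> Prop) : set (set T) :=
  [set A | exists n x, [/\ cub n x x, A = cub n x, S A &
    forall m : int, (m < n)%R -> ~ S (cub m x)]].

Lemma stopping_trivIset S : trivIset (stopping S) id.
Proof.
move=> _ _ [n [x [xx -> Sx xmin]]] [m [y [yy -> Sy ymin]]] [z [xz yz]].
wlog mn : m n x y xx yy Sx Sy xmin ymin xz yz / (m <= n)%R.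
  move=> h; have [mn|/ltW nm] := leP m n; first exact: h.
  by apply/esym; exact: h.
move: mn; rewrite le_eqVlt => /orP[/eqP e|mn].
  by subst m; rewrite -(cub_eq xz) -(cub_eq yz).
exfalso; apply: (xmin _ mn).
by rewrite -(cub_eq (cub_mono (ltW mn) xz)) (cub_eq yz).
Qed.

Lemma stopping_cube S A : stopping S A ->
  [/\ measurable A, A `<=` X & 0 < mu A].
Proof. by move=> [n [x [xx -> _ _]]]; have [] := cub_cube xx. Qed.

Lemma stopping_cover S n x n0 : cub n x x -> S (cub n x) ->
  (forall m : int, (m <= n0)%R -> ~ S (cub m x)) -> exists2 A, stopping S A & A x.
Proof.
move=> xx Sx nS.
have [k [kx Sk] kmin] := @int_min_exists (fun m => cub m x x /\ S (cub m x)) n0 n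
  (conj xx Sx) (fun m mn => fun h => nS m mn h.2).
exists (cub k x) => //; exists k, x; split => // m mk Sm.
by apply: (kmin _ mk); split => //; exact: cub_self_mono (ltW mk) kx.
Qed.

Definition dsup (g : set T -> R) (x : T) : \bar R :=
  ereal_sup [set (g (cub n x))%:E | n in [set: int]].

Lemma dsup_gtP g x (t : R) : (t%:E < dsup g x)%E <-> exists n, (t < g (cub n x))%R.
Proof.
split.
  move=> /ereal_sup_gt[_ [n _ <-]]; rewrite lte_fin => h; by exists n.
move=> [n h]; apply: lt_le_trans (_ : (g (cub n x))%:E <= _); first by rewrite lte_fin.
by apply: ereal_sup_ubound; exists n.
Qed.

Lemma le_dsup g n x : (g (cub n x))%:E <= dsup g x.
Proof. by apply: ereal_sup_ubound; exists n. Qed.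

Lemma dsup_ge0 g x : (forall A, (0 <= g A)%R) -> 0 <= dsup g x.
Proof. by move=> g0; apply: le_trans (le_dsup g 0%R x); rewrite lee_fin. Qed.

Lemma measurable_level n (S : set T -> Prop) :
  measurable [set x | cub n x x /\ S (cub n x)].
Proof.
pose F := [set A | exists x, [/\ cub n x x, A = cub n x & S A]].
have -> : [set x | cub n x x /\ S (cub n x)] = \bigcup_(A in F) A.
  apply/seteqP; split => [x [xx Sx]|x [A [y [yy -> Sy]] yx]].
    by exists (cub n x) => //; exists x.
  by rewrite /= (cub_eq yx).
apply: (@le_integral_disjoint_union _ _ _ mu F X (cst 0) (cst 0) (dc_cover dc) _ _ _ _ _ _ _).1 => //.
- move=> _ _ [x [xx -> _]] [y [yy -> _]] [z [xz yz]].
  by rewrite -(cub_eq xz) -(cub_eq yz).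
- by move=> _ [x [xx -> _]]; have [] := cub_cube xx.
Qed.

Lemma measurable_cubs : measurable [set x | forall n, cub n x x].
Proof.
have -> : [set x | forall n, cub n x x] = \bigcap_(n in [set: int]) [set x | cub n x x /\ True].
  apply/seteqP; split => [x h n _|x h n]; first by split.
  by have [] := h n.
by apply: measurable_bigcap_countType => n; exact: (measurable_level n (fun=> True)).
Qed.

Lemma measurable_dsup g : (forall A, (0 <= g A)%R) -> g set0 = 0%R ->
  measurable_fun X (dsup g).
Proof.
move=> g0 gs0.
apply: emeasurable_fun_gt => t.
have [t0|t0] := ltP t 0%R.
  have -> : X `&` [set x | t%:E < dsup g x] = X.
    apply/seteqP; split => [x []//|x Xx]; split => //=.
    by apply: lt_le_trans (dsup_ge0 x g0); rewrite lte_fin.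
  exact: (dc_meas dc).
have -> : X `&` [set x | t%:E < dsup g x] =
    \bigcup_(n in [set: int]) [set x | cub n x x /\ (t < g (cub n x))%R].
  apply/seteqP; split => [x [_ /dsup_gtP[n tn]]|x [n _ [xx tn]]].
    exists n => //; split => //; apply: contrapT => /cub_set0 e.
    by move: tn; rewrite e gs0 ltNge t0.
  split; first by have [_ + _ _] := cub_cube xx; exact.
  by apply/dsup_gtP; exists n.
by apply: measurable_bigcup_countType => n; exact: (measurable_level n (fun A => (t < g A)%R)).
Qed.

End Cubes.

Section Averages.
Context (R : realType) (d : measure_display) (T : measurableType d).
Variable mu : {measure set T -> \bar R}.
Variable f : T -> R.

(* All three vanish on [set0], since [0^-1 = 0]. *)
Definition av (A : set T) : R := (fine (\int[mu]_(x in A) (`|f x|)%:E) / fine (mu A))%R.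
Definition cn (A : set T) : R := (fine (\int[mu]_(x in A) (f x)%:E) / fine (mu A))%R.
Definition os (A : set T) : R :=
  (fine (\int[mu]_(x in A) (`|f x - cn A|)%:E) / fine (mu A))%R.

Lemma av_ge0 A : (0 <= av A)%R.
Proof. by rewrite divr_ge0// fine_ge0//; apply: integral_ge0 => x _; rewrite lee_fin. Qed.

Lemma os_ge0 A : (0 <= os A)%R.
Proof. by rewrite divr_ge0// fine_ge0//; apply: integral_ge0 => x _; rewrite lee_fin. Qed.

Lemma av_set0 : av set0 = 0%R.
Proof. by rewrite /av measure0 invr0 mulr0. Qed.

Lemma os_set0 : os set0 = 0%R.
Proof. by rewrite /os measure0 invr0 mulr0. Qed.

Context (A : set T).
Hypotheses (mA : measurable A) (A0 : 0 < mu A) (Aoo : mu A < +oo)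
  (fA : mu.-integrable A (EFin \o f)).

Let m := fine (mu A).

Lemma mu_fine : mu A = m%:E.
Proof. by rewrite /m fineK// ge0_fin_numE. Qed.

Lemma m_gt0 : (0 < m)%R.
Proof. by rewrite fine_gt0// A0. Qed.

Lemma cst_integrable c : mu.-integrable A (EFin \o cst c).
Proof.
apply: measurable_bounded_integrable => //.
by exists `|c|%R; split => // x cx y _; exact: ltW.
Qed.

Lemma sub_cst_integrable c : mu.-integrable A (EFin \o (fun x => f x - c)%R).
Proof.
have := integrableB mA fA (cst_integrable c).
by apply: eq_integrable => // x _ /=.
Qed.

Lemma measurable_f : measurable_fun A f.
Proof. by apply/measurable_EFinP; exact: measurable_int fA. Qed.

Lemma measurable_osc c : measurable_fun A (fun x => (`|f x - c|)%:E).
Proof.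
apply/measurable_EFinP; apply: (measurableT_comp (@normr_measurable R setT)).
by apply: measurable_funB => //; exact: measurable_f.
Qed.

Lemma measurable_absf : measurable_fun A (fun x => (`|f x|)%:E).
Proof.
by apply/measurable_EFinP; apply: (measurableT_comp (@normr_measurable R setT)); exact: measurable_f.
Qed.

Lemma int_osc_fin c : \int[mu]_(x in A) (`|f x - c|)%:E \is a fin_num.
Proof. by apply: integrable_fin_num => //; exact: integrable_norm (sub_cst_integrable c). Qed.

Lemma int_avE : \int[mu]_(x in A) (`|f x|)%:E = (av A * m)%:E.
Proof.
rewrite /av mulfVK ?gt_eqF ?m_gt0// fineK//.
by apply: integrable_fin_num => //; exact: integrable_norm fA.
Qed.

Lemma int_cnE : \int[mu]_(x in A) (f x)%:E = (cn A * m)%:E.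
Proof.
rewrite /cn mulfVK ?gt_eqF ?m_gt0// fineK//; exact: integrable_fin_num fA.
Qed.

Lemma int_osE : \int[mu]_(x in A) (`|f x - cn A|)%:E = (os A * m)%:E.
Proof. by rewrite /os mulfVK ?gt_eqF ?m_gt0// fineK// int_osc_fin. Qed.

Lemma norm_cn_le : (`|cn A| <= av A)%R.
Proof.
rewrite -(ler_pM2r m_gt0) -{1}(ger0_norm (ltW m_gt0)) -normrM -lee_fin -int_avE.
rewrite -abse_EFin -int_cnE.
by apply: (le_abse_integral mu (f := fun x => (f x)%:E)) => //; exact: measurable_int fA.
Qed.

Lemma av_le c : (av A * m)%:E <= (`|c| * m)%:E + \int[mu]_(x in A) (`|f x - c|)%:E.
Proof.
rewrite -int_avE EFinM -mu_fine -integral_cst// -ge0_integralD//; last 1 first.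
- exact: measurable_osc.
- apply: ge0_le_integral => //.
  + exact: measurable_absf.
  + by apply: emeasurable_funD => //; exact: measurable_osc.
  + move=> x _; rewrite /cst -EFinD lee_fin; have := ler_normD (f x - c)%R c.
    by rewrite subrK addrC.
- by move=> x _; rewrite lee_fin.
Qed.

Lemma av_le_cn : (av A <= `|cn A| + os A)%R.
Proof.
have := av_le (cn A); rewrite int_osE -EFinD lee_fin -mulrDl.
by rewrite ler_pM2r// m_gt0.
Qed.

Lemma measurable_large (l : R) : measurable (A `&` [set x | (l <= `|f x|)%R]).
Proof.
have := measurable_absf mA (emeasurable_itv `[l%:E, +oo[).
rewrite [X in measurable X -> _](_ : _ = A `&` [set x | (l <= `|f x|)%R])//.
by apply/seteqP; split => x /=; rewrite in_itv /= andbT lee_fin.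
Qed.

Lemma osc_or_large (l : R) : (0 < l)%R -> (l < av A)%R -> (os A < l / 8)%R ->
  mu A <= 2%:E * mu (A `&` [set x | (l / 2 <= `|f x|)%R]).
Proof.
move=> l0 lA osA; set E := A `&` _.
have mE : measurable E := measurable_large _.
have cl : (7 * l / 8 < `|cn A|)%R by have := av_le_cn; lra.
have mAE : measurable (A `\` E) by exact: measurableD.
have Em : mu A = mu E + mu (A `\` E).
  rewrite -measureU//; last by rewrite setDE setICA setICr setI0.
  by rewrite setDUK// => x [].
have [e Ee] : exists e, mu E = e%:E.
  exists (fine (mu E)); rewrite fineK// ge0_fin_numE//.
  by apply: le_lt_trans Aoo; apply: le_measure; rewrite ?inE// => x [].
have [g Eg] : exists g, mu (A `\` E) = g%:E.
  exists (fine (mu (A `\` E))); rewrite fineK// ge0_fin_numE//.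
  by apply: le_lt_trans Aoo; apply: le_measure; rewrite ?inE// => x [].
have : (3 * l / 8)%:E * mu (A `\` E) <= (os A * m)%:E.
  rewrite -integral_cst// -int_osE.
  apply: (@le_trans _ _ (\int[mu]_(x in A `\` E) (`|f x - cn A|)%:E)); last first.
    by apply: ge0_subset_integral => //; exact: measurable_osc.
  apply: ge0_le_integral => //.
  - by move=> x _; rewrite lee_fin; lra.
  - by apply: measurable_funS (measurable_osc _) => // x [].
  - move=> x [Ax nE]; rewrite /cst lee_fin.
    have fl : (`|f x| < l / 2)%R by rewrite ltNge; apply/negP => h; apply: nE.
    by have := lerB_dist (cn A) (f x); rewrite distrC; lra.
rewrite mu_fine Ee Eg -!EFinM !lee_fin => h.
have mg : m = (e + g)%R by apply: EFin_inj; rewrite -mu_fine Em Ee Eg.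
have := m_gt0; have : (os A * m < l / 8 * m)%R by rewrite ltr_pM2r// m_gt0.
have : (0 <= g)%R by rewrite -lee_fin -Eg.
have : (0 <= e)%R by rewrite -lee_fin -Ee.
rewrite mg => e0 g0 h1 h2; nra.
Qed.

End Averages.

(** * Good-lambda inequalities *)

Section SetIntegrals.
Context (R : realType) (d : measure_display) (T : measurableType d).
Variable mu : {measure set T -> \bar R}.

Lemma measurable_patch (X E : set T) (phi : T -> \bar R) :
  measurable X -> measurable E -> measurable_fun X phi ->
  measurable_fun X (phi \_ E).
Proof.
move=> mX mE mphi; apply/(measurable_restrict _ mE mX).
by apply: measurable_funS mphi => // x [].
Qed.

Lemma ge0_integral_setID (A E : set T) (phi : T -> \bar R) :
  measurable A -> measurable E -> measurable_fun A phi ->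
  (forall x, A x -> 0 <= phi x) ->
  \int[mu]_(x in A) phi x =
  \int[mu]_(x in A `&` E) phi x + \int[mu]_(x in A `\` E) phi x.
Proof.
move=> mA mE mphi phi0; rewrite -ge0_integral_setU ?setUIDK//.
- exact: measurableI.
- exact: measurableD.
- by apply/disj_set2P; rewrite setDE setIACA setICr setI0.
Qed.

Lemma ge0_integral_le_setU (A B C : set T) (phi : T -> \bar R) :
  measurable A -> measurable B -> measurable C -> C `<=` A `|` B ->
  measurable_fun (A `|` B) phi -> (forall x, (A `|` B) x -> 0 <= phi x) ->
  \int[mu]_(x in C) phi x <= \int[mu]_(x in A) phi x + \int[mu]_(x in B) phi x.
Proof.
move=> mA mB mC CAB mphi phi0.
have mU : measurable (A `|` B) by exact: measurableU.
apply: (@le_trans _ _ (\int[mu]_(x in A `|` B) phi x)).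
  exact: ge0_subset_integral.
rewrite (ge0_integral_setID mU mA mphi phi0); apply: leeD.
  apply: ge0_subset_integral => //; first exact: measurableI.
  by apply: measurable_funS mphi => // x; left.
  by move=> x Ax; apply: phi0; left.
apply: ge0_subset_integral => //; first exact: measurableD.
- by apply: measurable_funS mphi => // x; right.
- by move=> x Bx; apply: phi0; right.
- by move=> x [[]].
Qed.

Lemma le_integral_disjoint_unionI (D : set (set T)) X E (phi psi : T -> \bar R) :
  finite_cover mu X -> trivIset D id ->
  (forall A, D A -> [/\ measurable A, A `<=` X & 0 < mu A]) ->
  measurable X -> measurable E ->
  measurable_fun X phi -> measurable_fun X psi ->
  (forall x, X x -> 0 <= phi x) -> (forall x, X x -> 0 <= psi x) ->
  (forall A, D A -> \int[mu]_(x in A `&` E) phi x <= \int[mu]_(x in A) psi x) ->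
  let U := \bigcup_(A in D) A in
  [/\ measurable U, U `<=` X &
  \int[mu]_(x in U `&` E) phi x <= \int[mu]_(x in U) psi x].
Proof.
move=> cX tD DA mX mE mphi mpsi phi0 psi0 h U.
have UX : U `<=` X by move=> x [A /DA[_ AX _]]; exact: AX.
have [|||||mU le] := @le_integral_disjoint_union _ _ _ mu D X (phi \_ E) psi cX tD DA.
- by apply: measurable_funS UX _ => //; exact: measurable_patch.
- exact: measurable_funS UX mpsi.
- move=> x Ux; rewrite /patch; case: ifPn => // _; exact/phi0/UX.
- by move=> x Ux; exact/psi0/UX.
- by move=> A DA'; rewrite -integral_mkcondr; exact: h.
- by split => //; rewrite integral_mkcondr.
Qed.

End SetIntegrals.

Section GoodLambda.
Context (R : realType) (d : measure_display) (T : measurableType d).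
Variable mu : {measure set T -> \bar R}.
Context (I : int -> Type) (Q : forall n : int, I n -> set T).
Context (X : set T) (D : R).
Hypothesis dc : dyadic_cubes mu Q X D.
Context (f : T -> R).
Hypothesis mf : measurable_fun X f.
Hypothesis fint : forall n x, cub Q n x x -> mu.-integrable (cub Q n x) (EFin \o f).
Context (W : T -> R) (kap : R).
Hypotheses (W0 : forall x, X x -> (0 <= W x)%R) (mW : measurable_fun X W).
Let wt (A : set T) := \int[mu]_(x in A) (W x)%:E.
Hypothesis kap1 : (1 <= kap)%R.
Hypothesis Wfin : forall n x, cub Q n x x -> wt (cub Q n x) < +oo.
Hypothesis Wc : forall n x (E : set T), cub Q n x x -> measurable E ->
  E `<=` cub Q n x -> mu (cub Q n x) <= 2%:E * mu E ->
  wt (cub Q n x) <= kap%:E * wt E.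
Let th : R := (1 - kap^-1)%R.
Let mX : measurable X := dc_meas dc.
Local Notation cub := (cub Q).
Local Notation av := (av mu f).
Local Notation os := (os mu f).
Local Notation Mf := (dsup Q av).
Local Notation sh := (dsup Q os).

Let mWE A : A `<=` X -> measurable_fun A (EFin \o W).
Proof. by move=> AX; apply/measurable_EFinP; exact: measurable_funS mW. Qed.

Let WE0 x : X x -> 0 <= (W x)%:E.
Proof. by move=> Xx; rewrite lee_fin W0. Qed.

Lemma wt_le A B : measurable A -> measurable B -> A `<=` B -> B `<=` X -> wt A <= wt B.
Proof.
move=> mA mB AB BX; apply: ge0_subset_integral => //; first exact: mWE.
by move=> x /BX /WE0.
Qed.

Lemma wt_setU A B C : measurable A -> measurable B -> measurable C ->
  C `<=` A `|` B -> A `<=` X -> B `<=` X -> wt C <= wt A + wt B.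
Proof.
move=> mA mB mC CAB AX BX; apply: ge0_integral_le_setU => //.
  by apply: mWE => x [/AX|/BX].
by move=> x [/AX|/BX] /WE0.
Qed.

Lemma wt_ge0 A : A `<=` X -> 0 <= wt A.
Proof. by move=> AX; apply: integral_ge0 => x /AX /WE0. Qed.

Lemma wt_small n x E : cub n x x -> measurable E -> E `<=` cub n x ->
  2%:E * mu E <= mu (cub n x) -> wt E <= th%:E * wt (cub n x).
Proof.
move=> xx mE EA hE; set A := cub n x.
have [mA AX A0 Aoo] := cub_cube dc xx.
have mAE : measurable (A `\` E) by exact: measurableD.
have muA : mu A = mu E + mu (A `\` E).
  rewrite -measureU//; last by rewrite setDE setICA setICr setI0.
  by rewrite setDUK.
have Efin : mu E \is a fin_num.
  rewrite ge0_fin_numE//; apply: le_lt_trans Aoo.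
  by apply: le_measure; rewrite ?inE.
have Dfin : mu (A `\` E) \is a fin_num.
  rewrite ge0_fin_numE//; apply: le_lt_trans Aoo.
  by apply: le_measure; rewrite ?inE// => y [].
have : wt A <= kap%:E * wt (A `\` E).
  apply: Wc => //.
  move: hE; rewrite -/A muA -(fineK Efin) -(fineK Dfin) -!EFinM -EFinD.
  by rewrite !lee_fin; lra.
have wA : wt A = wt E + wt (A `\` E).
  rewrite /wt (@ge0_integral_setID _ _ _ mu A E)//; first by rewrite setIidr.
    exact: mWE.
  by move=> y /AX /WE0.
have wfE B : measurable B -> B `<=` A -> wt B \is a fin_num.
  move=> mB BA; rewrite ge0_fin_numE; last by apply: wt_ge0; exact: subset_trans AX.
  by apply: le_lt_trans (Wfin xx); apply: wt_le.
rewrite wA -(fineK (wfE E mE EA)) -(fineK (wfE (A `\` E) mAE _)); last by move=> y [].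
rewrite -!EFinD -!EFinM !lee_fin => h.
set e := fine _ in h *; set g := fine _ in h *.
have k0 : (0 < kap)%R by exact: lt_le_trans kap1.
suff : (kap^-1 * (e + g) <= g)%R by rewrite /th; lra.
by rewrite mulrC ler_pdivrMr// mulrC.
Qed.

Let mMf : measurable_fun X Mf.
Proof. apply: (measurable_dsup dc) => [A|]; [exact: av_ge0|exact: av_set0]. Qed.

Let msh : measurable_fun X sh.
Proof. apply: (measurable_dsup dc) => [A|]; [exact: os_ge0|exact: os_set0]. Qed.

Let Om (l : R) := X `&` [set x | l%:E < Mf x].

Let mOm l : measurable (Om l).
Proof. by apply: emeasurable_fun_o_infty. Qed.

Lemma av_gt_cub l n x : (0 <= l)%R -> (l < av (cub n x))%R -> cub n x x.
Proof.
move=> l0 h; apply: contrapT => /(cub_set0) e.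
by move: h; rewrite e av_set0 ltNge l0.
Qed.

Lemma int_f n x (A : set T) : cub n x x -> A = cub n x ->
  [/\ measurable A, 0 < mu A, mu A < +oo & mu.-integrable A (EFin \o f)].
Proof. by move=> xx ->; have [] := cub_cube dc xx; split => //; exact: fint. Qed.

Hypothesis bad : forall (l : R) x, (0 < l)%R -> X x ->
  (forall n0 : int, exists2 n, (n <= n0)%R & (l < av (cub n x))%R) -> (l / 8)%:E <= sh x.

Let cover_Om (l : R) x : (0 < l)%R -> Om l x ->
  (\bigcup_(A in stopping Q (fun A => (l < av A)%R)) A) x \/ (l / 8)%:E <= sh x.
Proof.
move=> l0 [Xx /dsup_gtP[n ln]].
have [h|] := pselect (forall n0 : int, exists2 n, (n <= n0)%R & (l < av (cub n x))%R).
  by right; exact: bad.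
move=> /existsNP[n0 h]; left.
have xx : cub n x x by exact: av_gt_cub (ltW l0) ln.
have [|A SA Ax] := stopping_cover dc (n0 := n0) (S := (fun A => (l < av A)%R)) xx ln.
  by move=> m mn lm; apply: h; exists m.
by exists A.
Qed.

Lemma apriori_level l : (0 < l)%R ->
  wt (Om l) <= kap%:E * wt (X `&` [set x | (l / 2 <= `|f x|)%R]) +
               wt (X `&` [set x | (l / 8)%:E <= sh x]).
Proof.
move=> l0; set F := X `&` _; set G := X `&` [set x | _].
have mF : measurable F.
  have mnf : measurable_fun X (fun x => (`|f x|)%:E).
    by apply/measurable_EFinP; exact: (measurableT_comp (@normr_measurable R setT)).
  rewrite (_ : F = X `&` [set x | (l / 2)%:E <= (`|f x|)%:E]).
    exact: emeasurable_fun_c_infty.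
  by apply/seteqP; split => x /=; rewrite lee_fin.
have mG : measurable G by exact: emeasurable_fun_c_infty.
pose D2 := [set A | stopping Q (fun A => (l < av A)%R) A /\ (os A < l / 8)%R].
have D2c A : D2 A -> [/\ measurable A, A `<=` X & 0 < mu A].
  by move=> [/(stopping_cube dc)].
pose psi x := kap%:E * ((EFin \o W) \_ F) x.
have pF0 x : X x -> 0 <= ((EFin \o W) \_ F) x.
  by move=> Xx; rewrite /patch; case: ifPn => // _; exact: WE0.
have mpF : measurable_fun X ((EFin \o W) \_ F) by apply: measurable_patch => //; exact: mWE.
have psi0 x : X x -> 0 <= psi x.
  by move=> Xx; apply: mule_ge0; [rewrite lee_fin; exact: le_trans kap1|exact: pF0].
have mpsi : measurable_fun X psi by exact: measurable_funeM.
have UX : (\bigcup_(A in D2) A) `<=` X by move=> x [A /D2c[_ AX _]]; exact: AX.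
have psiE A : measurable A -> A `<=` X ->
    \int[mu]_(x in A) psi x = kap%:E * wt (A `&` F).
  move=> mA AX; rewrite /psi ge0_integralZl_EFin//.
  - by rewrite -integral_mkcondr.
  - by move=> x /AX /pF0.
  - exact: measurable_funS mpF.
  - exact: le_trans kap1.
have [||||||mU hU] := @le_integral_disjoint_union _ _ _ mu D2 X (EFin \o W) psi (dc_cover dc) _ D2c.
- by move=> A B [SA _] [SB _]; exact: (stopping_trivIset dc SA SB).
- exact: mWE.
- exact: measurable_funS mpsi.
- by move=> x /UX /WE0.
- by move=> x /UX /psi0.
- move=> A /[dup] D2A [[n [x [xx Ax lA _]]] osA].
  have [mA AX _] := D2c _ D2A; rewrite psiE//.
  have [_ A0 Aoo fA] := int_f xx Ax.
  have AFE : A `&` F = A `&` [set x | (l / 2 <= `|f x|)%R].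
    by rewrite /F setIA (setIidl AX).
  rewrite /= Ax; apply: Wc => //; rewrite -?Ax; first exact: measurableI.
  rewrite AFE; exact: osc_or_large.
apply: (@le_trans _ _ (wt (\bigcup_(A in D2) A) + wt G)).
  apply: wt_setU => //; last by move=> x [].
  move=> x Omx; have [|h] := cover_Om l0 Omx; last by right; split => //; case: Omx.
  move=> [A SA Ax]; have [osA|osA] := ltP (os A) (l / 8)%R; first by left; exists A.
  right; split; first by case: Omx.
  rewrite /=; case: SA => [n [y [yy Ay _ _]]].
  apply: le_trans (le_dsup _ _ n x); rewrite lee_fin.
  by rewrite (@cub_eq _ _ _ _ _ _ _ _ dc n y) -?Ay.
apply: leeD => //; apply: (le_trans hU).
rewrite psiE//; apply: lee_pmul.
- by rewrite lee_fin; exact: le_trans kap1.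
- by apply: wt_ge0 => x [/UX].
- by [].
- by apply: wt_le => //; try exact: measurableI; move=> x [].
Qed.

Let av_sub (A B : set T) (l t : R) : measurable A -> 0 < mu A -> mu A < +oo ->
  measurable B -> 0 < mu B -> mu B < +oo -> mu.-integrable B (EFin \o f) -> A `<=` B ->
  mu B <= D%:E * mu A -> (av B <= l)%R -> (os B <= t)%R -> (av A <= l + D * t)%R.
Proof.
move=> mA A0 Aoo mB B0 Boo fB AB BA avB osB.
have fA : mu.-integrable A (EFin \o f) by exact: integrableS fB.
have mA0 := m_gt0 A0 Aoo; rewrite -(ler_pM2r mA0).
have := av_le mA A0 Aoo fA (cn mu f B).
have : \int[mu]_(y in A) (`|f y - cn mu f B|)%:E <= (os B * fine (mu B))%:E.
  by rewrite -int_osE//; apply: ge0_subset_integral => //; exact: (measurable_osc fB).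
move=> h1 h2; have := le_trans h2 (leeD2l _ h1).
rewrite -EFinD lee_fin => h; apply: (le_trans h); rewrite mulrDl.
have BA' : (fine (mu B) <= D * fine (mu A))%R.
  by rewrite -lee_fin EFinM -!mu_fine.
apply: lerD; first by rewrite ler_pM2r//; exact: le_trans (norm_cn_le mB B0 Boo fB) avB.
have -> : (D * t * fine (mu A) = t * (D * fine (mu A)))%R by ring.
by apply: (ler_pM (os_ge0 mu f B) _ osB BA'); exact: fine_ge0.
Qed.

Let osc_ge (A : set T) (a c k : R) : measurable A -> 0 < mu A -> mu A < +oo ->
  mu.-integrable A (EFin \o f) -> (c < av A)%R -> (`|k| <= a)%R ->
  (c - a)%:E * mu A <= \int[mu]_(y in A) (`|f y - k|)%:E.
Proof.
move=> mA A0 Aoo fA cA ka; have mA0 := m_gt0 A0 Aoo.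
have := av_le mA A0 Aoo fA k; have hf := int_osc_fin mA Aoo fA k.
rewrite -(fineK hf) (mu_fine Aoo) -EFinD -EFinM !lee_fin => h.
have h1 : (`|k| * fine (mu A) <= a * fine (mu A))%R by rewrite ler_pM2r.
have h2 : (c * fine (mu A) <= av A * fine (mu A))%R by rewrite ler_pM2r// ltW.
lra.
Qed.

Let stopping_small (n : int) x (a c t : R) (S : set T -> Prop) : cub n x x ->
  (av (cub n x) <= a)%R -> (os (cub n x) <= t)%R -> (0 < t)%R -> (a + 2 * t <= c)%R ->
  (forall A, S A -> A `<=` cub n x /\ (c < av A)%R) ->
  let U := \bigcup_(A in stopping Q S) A in
  [/\ measurable U, U `<=` cub n x & 2%:E * mu U <= mu (cub n x)].
Proof.
move=> xx avA osA t0 act SA U.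
have [mA A0 Aoo fA] := int_f xx erefl.
have UA : U `<=` cub n x by move=> y [A' [k [z [_ _ /SA[A'A _] _]]] /A'A].
have Sc A' : stopping Q S A' -> [/\ measurable A', A' `<=` X & 0 < mu A'].
  exact: (stopping_cube dc).
have ca0 : (0 <= c - a)%R by lra.
have [|||||||mU hU] := @le_integral_disjoint_union _ _ _ mu (stopping Q S) X
  (cst (c - a)%:E) (fun y => (`|f y - cn mu f (cub n x)|)%:E) (dc_cover dc).
- exact: (stopping_trivIset dc).
- exact: Sc.
- exact: measurable_cst.
- by apply: measurable_funS UA _ => //; exact: (measurable_osc fA).
- by move=> y _; rewrite lee_fin.
- by move=> y _; rewrite lee_fin.
- move=> A' [k [z [zz A'z /SA[A'A cA'] _]]].
  have [mA' A'0 A'oo fA'] := int_f zz A'z.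
  rewrite integral_cst//; apply: osc_ge => //.
  exact: le_trans (norm_cn_le mA A0 Aoo fA) avA.
split => //; have Uoo : mu U < +oo.
  by apply: le_lt_trans Aoo; apply: le_measure; rewrite ?inE.
have : (c - a)%:E * mu U <= (t * fine (mu (cub n x)))%:E.
  rewrite -integral_cst//; apply: (le_trans hU).
  apply: (@le_trans _ _ (os (cub n x) * fine (mu (cub n x)))%:E).
    by rewrite -int_osE//; apply: ge0_subset_integral => //; exact: (measurable_osc fA).
  by rewrite lee_fin ler_wpM2r// fine_ge0.
have Ufin : mu U \is a fin_num by rewrite ge0_fin_numE.
rewrite (mu_fine Aoo) -(fineK Ufin) -!EFinM !lee_fin => h.
rewrite -(ler_pM2l t0); apply: le_trans h.
by rewrite mulrA ler_wpM2r ?fine_ge0//; lra.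
Qed.

Lemma good_lambda_level (b g l : R) : (1 < b)%R -> (0 < g < 8^-1)%R ->
  (g * (2 + D) <= b - 1)%R -> (0 < l)%R ->
  wt (Om (b * l)) <= th%:E * wt (Om l) + wt (X `&` [set x | (g * l)%:E < sh x]).
Proof.
move=> b1 /andP[g0 g8] gD l0; set G := X `&` [set x | (g * l)%:E < sh x].
have mG : measurable G by exact: emeasurable_fun_o_infty.
have lbl : (l < b * l)%R by rewrite ltr_pMl.
have bl0 : (0 < b * l)%R by exact: lt_trans lbl.
have th0 : (0 <= th)%R by rewrite /th subr_ge0 invf_le1// (lt_le_trans _ kap1).
pose S A := (l < av A)%R.
pose E := Om (b * l) `\` G.
have mE : measurable E by apply: measurableD.
have SD A : stopping Q S A -> [/\ measurable A, A `<=` X & 0 < mu A].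
  exact: (stopping_cube dc).
have UX : (\bigcup_(A in stopping Q S) A) `<=` X by move=> x [A /SD[_ AX _]]; exact: AX.
have [|||||||||mU _ hU] := @le_integral_disjoint_unionI _ _ _ mu (stopping Q S) X E
    (EFin \o W) (fun x => th%:E * (W x)%:E) (dc_cover dc).
- exact: (stopping_trivIset dc).
- by [].
- by [].
- by [].
- exact: mWE.
- by apply: measurable_funeM; exact: mWE.
- by [].
- by move=> x Xx; apply: mule_ge0; rewrite ?lee_fin ?W0.
- move=> A [n [x [xx Ax lA xmin]]].
  have [mA A0 Aoo fA] := int_f xx Ax.
  have AX : A `<=` X by have [_ + _ _] := cub_cube dc xx; rewrite Ax.
  rewrite ge0_integralZl_EFin//; [|by move=> y /AX /WE0|exact: mWE].
  have [AE0|/eqP/set0P[z [Az [Omz nGz]]]] := pselect (A `&` E = set0).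
    by rewrite AE0 integral_set0; apply: mule_ge0 => //; exact: wt_ge0.
  have nn : (n - 1 <= n)%R by rewrite gerBl.
  pose B := cub (n - 1)%R x.
  have xxB : cub (n - 1)%R x x by exact: (cub_self_mono dc nn).
  have [mB B0 Boo fB] := int_f xxB (erefl B).
  have AB : A `<=` B by rewrite Ax; exact: (cub_mono dc (x := x) nn).
  have shz : sh z <= (g * l)%:E.
    by rewrite leNgt; apply/negP => h; apply: nGz; split => //; exact: AX.
  have Anz : cub n z = A by rewrite Ax; apply: (cub_eq dc); rewrite -Ax.
  have Bnz : cub (n - 1)%R z = B by apply: (cub_eq dc); exact: AB.
  have osA : (os A <= g * l)%R.
    by rewrite -lee_fin; apply: le_trans shz; rewrite -Anz; exact: le_dsup.
  have osB : (os B <= g * l)%R.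
    by rewrite -lee_fin; apply: le_trans shz; rewrite -Bnz; exact: le_dsup.
  have avB : (av B <= l)%R.
    by rewrite leNgt; apply/negP => h; apply: (xmin (n - 1)%R) => //; rewrite gtrBl.
  have avA : (av A <= l + D * (g * l))%R.
    apply: (av_sub mA A0 Aoo mB B0 Boo fB AB _ avB osB).
    by rewrite Ax; exact: (dc_parent dc).
  pose S' A' := A' `<=` A /\ (b * l < av A')%R.
  have S'A A' : S' A' -> A' `<=` cub n x /\ (b * l < av A')%R by rewrite -Ax.
  have gl0 : (0 < g * l)%R by exact: mulr_gt0.
  have gDl : (l + D * (g * l) + 2 * (g * l) <= b * l)%R.
    have : (g * (2 + D) * l <= (b - 1) * l)%R by rewrite ler_pM2r.
    lra.
  have [] := stopping_small xx (eq_ind A (fun C => av C <= _)%R avA _ Ax)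
    (eq_ind A (fun C => os C <= _)%R osA _ Ax) gl0 gDl S'A.
  rewrite -Ax => mU' U'A muU'.
  have AEU : A `&` E `<=` \bigcup_(A' in stopping Q S') A'.
    move=> y [Ay [[Xy /dsup_gtP[m blm]] _]].
    have yy : cub m y y by exact: av_gt_cub (ltW bl0) blm.
    have small (j : int) : (j < n)%R -> ~ (b * l < av (cub j y))%R.
      move=> jn; have -> : cub j y = cub j x.
        by apply: (cub_eq dc); apply: (cub_mono dc (ltW jn)); rewrite -Ax.
      by move=> h; apply: (xmin _ jn); exact: lt_trans h.
    have nm : (n <= m)%R by rewrite leNgt; apply/negP => /small.
    have yA : cub m y `<=` A.
      apply: subset_trans (cub_mono dc nm) _.
      by rewrite (@cub_eq _ _ _ _ _ _ _ _ dc n x) -?Ax.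
    have [||A' SA' A'y] := stopping_cover dc (n0 := (n - 1)%R) (S := S') yy.
    - by [].
    - move=> j jn [_]; apply: small; apply: le_lt_trans jn _; by rewrite gtrBl.
    - by exists A'.
  apply: (@le_trans _ _ (wt (\bigcup_(A' in stopping Q S') A'))).
    apply: wt_le => //; first exact: measurableI.
    exact: subset_trans U'A AX.
  by rewrite Ax; apply: wt_small => //; rewrite -Ax.
apply: (@le_trans _ _ (wt ((\bigcup_(A in stopping Q S) A) `&` E) + wt G)).
  apply: wt_setU => //; first exact: measurableI.
  - move=> x Omx; have [Gx|nGx] := pselect (G x); first by right.
    left; split => //.
    have Oml : Om l x.
      by case: Omx => Xx h; split => //=; apply: lt_trans h; rewrite lte_fin.
    have [//|sh8] := cover_Om l0 Oml; exfalso; apply: nGx; split; first by case: Oml.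
    by apply: lt_le_trans sh8; rewrite lte_fin; nra.
  - by move=> x [/UX].
  - by move=> x [].
apply: leeD => //; apply: (le_trans hU).
rewrite ge0_integralZl_EFin//; [|by move=> x /UX /WE0|exact: mWE].
apply: lee_pmul => //; first exact: wt_ge0.
apply: wt_le => //; last by move=> x [].
move=> x [A /[dup] SA' [n [y [yy Ay SA _]]] Ax]; split; first by apply: UX; exists A.
apply/dsup_gtP; exists n; rewrite (@cub_eq _ _ _ _ _ _ _ _ dc n y) -?Ay//.
Qed.
End GoodLambda.

Section LayerPointwise.
Context (R : realType) (b s : R).
Hypotheses (b1 : (1 < b)%R) (s0 : (0 < s)%R).
Let be : R := b `^ s.

Let b0 : (0 < b)%R. Proof. exact: lt_trans b1. Qed.

Lemma powR_gt1 : (1 < be)%R.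
Proof. by rewrite /be -[X in (X < _)%R](congr1 (@^~ s) (powR1 R)) gt0_ltr_powR ?nnegrE ?ltW. Qed.

Lemma layerS (c : R) i : (0 < c)%R -> ((c * b ^+ i.+1) `^ s = be * (c * b ^+ i) `^ s)%R.
Proof.
move=> c0; have ci0 : (0 <= c * b ^+ i)%R by rewrite mulr_ge0 ?exprn_ge0 ?ltW.
by rewrite exprS (mulrCA c) (@powRM _ b) ?(ltW b0).
Qed.

Lemma layer_sum_real (c r : R) n : (0 < c)%R -> (0 <= r)%R ->
  (\sum_(0 <= i < n) (if c * b ^+ i < r then (c * b ^+ i) `^ s else 0) <=
    be / (be - 1) * r `^ s /\
  \sum_(0 <= i < n) (if c * b ^+ i < r then (c * b ^+ i) `^ s else 0) <=
    (c * b ^+ n) `^ s / (be - 1))%R.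
Proof.
move=> c0 r0; have be1 := powR_gt1; have be10 : (0 < be - 1)%R by rewrite subr_gt0.
elim: n => [|n [IH1 IH2]].
  rewrite big_nil; split; last by rewrite divr_ge0 ?powR_ge0 ?ltW.
  by rewrite mulr_ge0 ?powR_ge0// divr_ge0 ?ltW// (lt_trans _ be1).
rewrite big_nat_recr//= layerS//; set L := ((c * b ^+ n) `^ s)%R in IH2 *.
set S := (\sum_(0 <= i < n) _)%R in IH1 IH2 *.
have L0 : (0 <= L)%R by exact: powR_ge0.
have e : (L / (be - 1) + L = be * L / (be - 1))%R by field; rewrite gt_eqF.
case: ifPn => [cr|_].
  have h : (S + L <= be * L / (be - 1))%R by rewrite -e lerD2r.
  split => //; apply: (le_trans h); rewrite mulrAC ler_pM2l ?divr_gt0 ?(lt_trans _ be1)//.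
  rewrite /L le_powR ?(ltW s0) ?(ltW cr)//.
  by rewrite mulr_ge0 ?exprn_ge0 ?ltW.
rewrite addr0; split => //; apply: (le_trans IH2).
by rewrite ler_pM2r ?invr_gt0// ler_peMl// ltW.
Qed.

Lemma layer_sum_poweR_le (c : R) (u : \bar R) n : (0 < c)%R -> 0 <= u ->
  \sum_(0 <= i < n) (if (c * b ^+ i)%:E < u then ((c * b ^+ i) `^ s)%:E else 0)
  <= (be / (be - 1))%:E * u `^ s.
Proof.
move=> c0; have be1 := powR_gt1; have be10 : (0 < be - 1)%R by rewrite subr_gt0.
case: u => [r||//]; rewrite ?lee_fin => r0.
  under eq_bigr do rewrite lte_fin -(fun_if EFin).
  rewrite sumEFin poweR_EFin -EFinM lee_fin.
  by have [] := layer_sum_real n c0 r0.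
by rewrite poweRyr ?gt_eqF// gt0_muley ?leey// lte_fin divr_gt0// (lt_trans _ be1).
Qed.

Lemma layer_sum_poweR_ge (c : R) (u : \bar R) n : (0 < c)%R -> c%:E < u ->
  (mine u (c * b ^+ n.+1)%:E) `^ s <=
  be%:E * \sum_(0 <= i < n.+1) (if (c * b ^+ i)%:E < u then ((c * b ^+ i) `^ s)%:E else 0).
Proof.
move=> c0 cu; have be1 := powR_gt1; have be0 : (0 < be)%R by exact: lt_trans be1.
have S0 m : 0 <= \sum_(0 <= i < m) (if (c * b ^+ i)%:E < u then ((c * b ^+ i) `^ s)%:E else 0).
  by apply: sume_ge0 => i _; case: ifP => // _; rewrite lee_fin powR_ge0.
have u0 : 0 <= u by apply: le_trans (ltW cu); rewrite lee_fin ltW.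
elim: n => [|n IH]; last first.
  rewrite big_nat_recr//=; case: ifPn => h; last first.
    rewrite adde0; move: h; rewrite -leNgt => h.
    rewrite (_ : mine u _ = mine u (c * b ^+ n.+1)%:E)//.
    rewrite !min_l//; apply: (le_trans h); rewrite lee_fin ler_pM2l//.
    by rewrite [leRHS]exprS ler_peMl ?exprn_ge0 ?ltW.
  apply: (@le_trans _ _ (be%:E * ((c * b ^+ n.+1) `^ s)%:E)); last first.
    by rewrite lee_pmul2l ?lte_fin// leeDr.
  rewrite -EFinM -layerS// -poweR_EFin le_poweR ?(ltW s0)//.
  - by rewrite le_min u0 lee_fin mulr_ge0 ?exprn_ge0 ?ltW.
  - by rewrite ge_min lexx orbT.
rewrite big_nat1 expr0 mulr1 cu -EFinM -[X in (be * X `^ s)%R]mulr1 -(expr0 b) -layerS//.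
rewrite -poweR_EFin le_poweR ?(ltW s0)//.
- by rewrite le_min u0 lee_fin mulr_ge0 ?exprn_ge0 ?ltW.
- by rewrite ge_min lexx orbT.
Qed.

End LayerPointwise.

Section LayerIntegral.
Context (R : realType) (d : measure_display) (T : measurableType d).
Variable mu : {measure set T -> \bar R}.
Context (X : set T) (mX : measurable X) (w : T -> \bar R).
Hypotheses (w0 : forall x, X x -> 0 <= w x) (mw : measurable_fun X w).
Context (b s : R).
Hypotheses (b1 : (1 < b)%R) (s0 : (0 < s)%R).

Implicit Types u v : T -> \bar R.

Definition level_mass (u : T -> \bar R) (l : R) : \bar R :=
  \int[mu]_(x in X `&` [set x | l%:E < u x]) w x.

Definition layer_mass (u : T -> \bar R) (c : R) (n : nat) : \bar R :=
  \sum_(0 <= i < n) ((c * b ^+ i) `^ s)%:E * level_mass u (c * b ^+ i).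

Let be : R := b `^ s.
Let K : R := (be / (be - 1))%R.
Let b0 : (0 < b)%R. Proof. exact: lt_trans b1. Qed.
Let be1 : (1 < be)%R := powR_gt1 b1 s0.
Let K0 : (0 < K)%R. Proof. by rewrite divr_gt0 ?subr_gt0// (lt_trans _ be1). Qed.

Lemma level_mass_ge0 u l : 0 <= level_mass u l.
Proof. by apply: integral_ge0 => x [Xx _]; exact: w0. Qed.

Lemma measurable_gt u l : measurable_fun X u -> measurable (X `&` [set x | l%:E < u x]).
Proof. by move=> mu'; exact: emeasurable_fun_o_infty. Qed.

Lemma layer_massE u c n : measurable_fun X u ->
  layer_mass u c n = \int[mu]_(x in X)
    ((\sum_(0 <= i < n) (if (c * b ^+ i)%:E < u x then ((c * b ^+ i) `^ s)%:E else 0)) * w x).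
Proof.
move=> mu'; pose F i x := ((c * b ^+ i) `^ s)%:E * (w \_ (X `&` [set x | (c * b ^+ i)%:E < u x])) x.
have p0 i x : X x -> 0 <= (w \_ (X `&` [set x | (c * b ^+ i)%:E < u x])) x.
  by move=> Xx; rewrite /patch; case: ifPn => // _; exact: w0.
have mp i : measurable_fun X (w \_ (X `&` [set x | (c * b ^+ i)%:E < u x])).
  by apply: measurable_patch => //; exact: measurable_gt.
transitivity (\int[mu]_(x in X) \sum_(0 <= i < n) F i x).
  rewrite ge0_integral_sum//.
  - apply: eq_bigr => i _; rewrite /F ge0_integralZl_EFin//; first last.
    + exact: powR_ge0.
    + by move=> x /p0.
    congr (_ * _); rewrite /level_mass -integral_mkcondr setIA setIid//.
  - by move=> i; apply: measurable_funeM.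
  - by move=> i x Xx; apply: mule_ge0; [rewrite lee_fin powR_ge0|exact: p0].
apply: eq_integral => x; rewrite inE => Xx.
rewrite ge0_sume_distrl; last by move=> i _; case: ifP => // _; rewrite lee_fin powR_ge0.
apply: eq_bigr => i _; rewrite /F /patch; case: ifPn => [|h].
  by rewrite inE => -[_ /= ->].
case: ifPn => ux; last by rewrite mul0e mule0.
by exfalso; move/negP: h; apply; rewrite inE.
Qed.

Lemma measurable_poweR_w u r : measurable_fun X u ->
  measurable_fun X (fun x => u x `^ r * w x).
Proof.
move=> mu'; apply: emeasurable_funM => //.
by apply: (measurableT_comp (measurable_poweR r)).
Qed.

Lemma measurable_layer u c n : measurable_fun X u ->
  measurable_fun X (fun x => (\sum_(0 <= i < n)
    (if (c * b ^+ i)%:E < u x then ((c * b ^+ i) `^ s)%:E else 0)) * w x).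
Proof.
move=> mu'; apply: emeasurable_funM => //.
apply: emeasurable_sum => i.
apply: (eq_measurable_fun ((cst ((c * b ^+ i) `^ s)%:E : T -> \bar R) \_
   (X `&` [set x | (c * b ^+ i)%:E < u x]))).
  move=> x; rewrite inE => Xx; rewrite /patch; case: ifPn => [|h].
    by rewrite inE => -[_ /= ->].
  case: ifPn => // ux; exfalso; move/negP: h; apply; by rewrite inE.
by apply: measurable_patch => //; exact: measurable_gt.
Qed.

Lemma layer_mass_le u c n : (0 < c)%R -> measurable_fun X u ->
  (forall x, X x -> 0 <= u x) ->
  layer_mass u c n <= K%:E * \int[mu]_(x in X) (u x `^ s * w x).
Proof.
move=> c0 mu' u0; rewrite layer_massE// -ge0_integralZl_EFin//; first last.
- exact: ltW.
- exact: measurable_poweR_w.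
- by move=> x Xx; apply: mule_ge0; [exact: poweR_ge0|exact: w0].
apply: ge0_le_integral => //.
- move=> x Xx; apply: mule_ge0; last exact: w0.
  by apply: sume_ge0 => i _; case: ifP => // _; rewrite lee_fin powR_ge0.
- exact: measurable_layer.
- by apply: measurable_funeM; exact: measurable_poweR_w.
move=> x Xx; rewrite muleA; apply: lee_wpmul2r; first exact: w0.
by apply: layer_sum_poweR_le => //; exact: u0.
Qed.

Lemma layer_mass_le_scaled u c n g : (0 < c)%R -> (0 < g)%R -> measurable_fun X u ->
  (forall x, X x -> 0 <= u x) ->
  \sum_(0 <= i < n) ((c * b ^+ i) `^ s)%:E * level_mass u (g * (c * b ^+ i)) <=
  (K / g `^ s)%:E * \int[mu]_(x in X) (u x `^ s * w x).
Proof.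
move=> c0 g0 mu' u0; have gs0 : (0 < g `^ s)%R by exact: powR_gt0.
have -> : \sum_(0 <= i < n) ((c * b ^+ i) `^ s)%:E * level_mass u (g * (c * b ^+ i)) =
    ((g `^ s)^-1)%:E * layer_mass u (g * c) n.
  rewrite /layer_mass ge0_sume_distrr; last first.
    by move=> i _; apply: mule_ge0; [rewrite lee_fin powR_ge0|exact: level_mass_ge0].
  apply: eq_bigr => i _; rewrite muleA -EFinM -(mulrA g).
  have ci0 : (0 <= c * b ^+ i)%R by rewrite mulr_ge0 ?exprn_ge0 ?ltW.
  by rewrite (@powRM _ g) ?(ltW g0)// mulKf ?gt_eqF.
rewrite (mulrC K) EFinM -muleA lee_pmul2l// ?lte_fin ?invr_gt0//.
by apply: layer_mass_le => //; exact: mulr_gt0.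
Qed.

Lemma integral_poweR_le_layer u (B : \bar R) : measurable_fun X u ->
  (forall x, X x -> 0 <= u x) ->
  (forall c n, (0 < c)%R -> layer_mass u c n <= B) ->
  \int[mu]_(x in X) (u x `^ s * w x) <= be%:E * B.
Proof.
move=> mu' u0 h.
have be0 : (0 < be)%R by exact: lt_trans be1.
have B0 : 0 <= B by apply: le_trans (h 1%R 0%N _) => //; rewrite /layer_mass big_nil.
have muw := measurable_poweR_w s mu'.
have uw0 x : X x -> 0 <= u x `^ s * w x.
  by move=> Xx; apply: mule_ge0; [exact: poweR_ge0|exact: w0].
pose P k := (X `&` [set x | (b ^- k)%:E < u x]) `&` (X `&` [set x | u x <= (b ^+ k)%:E]).
have mP k : measurable (P k).
  by apply: measurableI; [exact: measurable_gt|exact: emeasurable_fun_infty_c].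
have PX k : P k `<=` X by move=> x [[]].
have hP k : \int[mu]_(x in P k) (u x `^ s * w x) <= be%:E * B.
  apply: (@le_trans _ _ (be%:E * layer_mass u (b ^- k) (2 * k).+1)); last first.
    by rewrite lee_pmul2l// h// invr_gt0 exprn_gt0.
  rewrite layer_massE// -ge0_integralZl_EFin//; first last.
  - exact: ltW.
  - exact: measurable_layer.
  - move=> x Xx; apply: mule_ge0; last exact: w0.
    by apply: sume_ge0 => i _; case: ifP => // _; rewrite lee_fin powR_ge0.
  have F0 x : X x -> 0 <= be%:E * ((\sum_(0 <= i < (2 * k).+1)
    (if (b ^- k * b ^+ i)%:E < u x then ((b ^- k * b ^+ i) `^ s)%:E else 0)) * w x).
    move=> Xx; apply: mule_ge0; first by rewrite lee_fin ltW.
    apply: mule_ge0; last exact: w0.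
    by apply: sume_ge0 => i _; case: ifP => // _; rewrite lee_fin powR_ge0.
  have mF : measurable_fun X (fun x => be%:E * ((\sum_(0 <= i < (2 * k).+1)
    (if (b ^- k * b ^+ i)%:E < u x then ((b ^- k * b ^+ i) `^ s)%:E else 0)) * w x)).
    by apply: measurable_funeM; exact: measurable_layer.
  apply: (@le_trans _ _ (\int[mu]_(x in P k) (be%:E * ((\sum_(0 <= i < (2 * k).+1)
    (if (b ^- k * b ^+ i)%:E < u x then ((b ^- k * b ^+ i) `^ s)%:E else 0)) * w x)))); last first.
    by apply: ge0_subset_integral => //; exact: PX.
  apply: ge0_le_integral => //.
  - by move=> x /PX /uw0.
  - exact: measurable_funS (@PX k) muw.
  - exact: measurable_funS (@PX k) mF.
  move=> x [[Xx /= kx] [_ /= xk]]; rewrite muleA; apply: lee_wpmul2r; first exact: w0.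
  apply: le_trans (layer_sum_poweR_ge b1 s0 _ _ kx); last by rewrite invr_gt0 exprn_gt0.
  rewrite min_l//; apply: (le_trans xk); rewrite lee_fin mul2n -addnn -addnS exprD mulrA.
  by rewrite mulVf ?mul1r ?expf_neq0 ?gt_eqF// exprS ler_peMl ?exprn_ge0 ?ltW.
have nP : {homo P : n m / (n <= m)%N >-> (n <= m)%O}.
  move=> m n mn; apply/subsetPset => x [[Xx mx] [_ xm]]; split; split => //=.
    apply: le_lt_trans mx; rewrite lee_fin lef_pV2 ?posrE ?exprn_gt0//.
    by rewrite ler_eXn2l.
  by apply: (le_trans xm); rewrite lee_fin ler_eXn2l.
pose PP := \bigcup_k P k.
have PPX : PP `<=` X by move=> x [k _ /PX].
have mPP : measurable PP by exact: bigcup_measurable.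
have hPP : \int[mu]_(x in PP) (u x `^ s * w x) <= be%:E * B.
  have cv := @ge0_nondecreasing_set_cvg_integral _ _ _ P (fun x => u x `^ s * w x) mu nP mP
    (fun k => measurable_funS mX (@PX k) muw) (fun k x Px => uw0 x (@PX k x Px)).
  rewrite -(cvg_lim _ cv)//; apply: lime_le; first by apply/cvg_ex; eexists; exact: cv.
  by apply: nearW => k; exact: hP.
rewrite (@ge0_integral_setID _ _ _ mu X PP)// (setIidr PPX).
have [->|Boo] := eqVneq B +oo; first by rewrite gt0_muley ?leey// lte_fin.
suff -> : \int[mu]_(x in X `\` PP) (u x `^ s * w x) = 0 by rewrite adde0.
pose Y := X `&` [set x | u x = +oo].
have mY : measurable Y.
  rewrite (_ : Y = X `&` [set x | +oo <= u x]); first exact: emeasurable_fun_c_infty.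
  by apply/seteqP; split => x [Xx /= hx]; split => //=; [rewrite hx|apply/eqP; rewrite -leye_eq].
have mXP : measurable (X `\` PP) by exact: measurableD.
have Y0 : \int[mu]_(x in Y) w x = 0.
  have Bfin : B \is a fin_num by rewrite ge0_fin_numE// ltey.
  have wY0 : 0 <= \int[mu]_(x in Y) w x by apply: integral_ge0 => x [/w0].
  have hc (t : R) : (0 < t)%R -> t%:E * \int[mu]_(x in Y) w x <= B.
    move=> t0; have := h (t `^ s^-1)%R 1%N (powR_gt0 _ t0).
    rewrite /layer_mass big_nat1 expr0 mulr1 -powRrM mulVf ?gt_eqF// powRr1 ?(ltW t0)//.
    apply: le_trans; rewrite lee_pmul2l//.
    apply: ge0_subset_integral => //; first exact: measurable_gt.
    - by apply: measurable_funS mw => // x [].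
    - by move=> x [/w0].
    - by move=> x [Xx /= ->]; split => //=; rewrite ltry.
  have wYfin : \int[mu]_(x in Y) w x \is a fin_num.
    rewrite ge0_fin_numE//; apply: (@le_lt_trans _ _ B); last by rewrite ltey.
    by have := hc 1%R ltr01; rewrite mul1e.
  have [//|Yn0] := eqVneq (\int[mu]_(x in Y) w x) 0.
  have Ypos : (0 < fine (\int[mu]_(x in Y) w x))%R.
    by rewrite fine_gt0// lt_neqAle eq_sym Yn0 wY0 -ge0_fin_numE.
  set m := fine _ in Ypos; have E1 : \int[mu]_(x in Y) w x = m%:E by rewrite /m fineK.
  have E2 : B = (fine B)%:E by rewrite fineK.
  have fB := fine_ge0 B0.
  have : ((fine B + 1) / m)%:E * m%:E <= (fine B)%:E.
    by rewrite -E1 -E2; apply: hc; rewrite divr_gt0// ltr_wpDl.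
  by rewrite -EFinM lee_fin mulfVK ?gt_eqF// gerDl ler10.
rewrite (_ : \int[mu]_(x in X `\` PP) (u x `^ s * w x) =
  \int[mu]_(x in X `\` PP) (+oo * (w \_ Y) x)).
  rewrite ge0_integralZl//.
  - rewrite -integral_mkcondr.
    have -> : \int[mu]_(x in (X `\` PP) `&` Y) w x = 0; last by rewrite mule0.
    apply/eqP; rewrite eq_le -{1}Y0 integral_ge0 ?andbT; last by move=> x [_ [/w0]].
    apply: ge0_subset_integral => //; first exact: measurableI.
    + by apply: measurable_funS mw => // x [].
    + by move=> x [/w0].
  - apply: (measurable_funS mX); first by move=> x [].
    exact: measurable_patch.
  - by move=> x [Xx _]; rewrite /patch; case: ifPn => // _; exact: w0.
apply: eq_integral => x; rewrite inE => -[Xx nPx]; rewrite /patch.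
case: ifPn => [|hY]; first by rewrite inE => -[_ /= ->]; rewrite poweRyr// gt_eqF.
have ux : u x != +oo.
  by apply/eqP => e; move/negP: hY; apply; rewrite inE; split.
have -> : u x = 0.
  apply/eqP; apply: contrapT => /negP un0; apply: nPx.
  have uf : u x \is a fin_num by rewrite ge0_fin_numE ?u0// ltey.
  have up : (0 < fine (u x))%R by rewrite fine_gt0// lt_neqAle eq_sym un0 u0//= -ge0_fin_numE ?u0.
  have [k hk] := exists_expr_gt (fine (u x)) b1.
  have [j hj] := exists_expr_gt (fine (u x))^-1 b1.
  exists (maxn k j) => //; split; split => //=; rewrite -(fineK uf).
    rewrite lte_fin -[ltRHS]invrK ltf_pV2 ?posrE ?exprn_gt0 ?invr_gt0//.
    by apply: (lt_le_trans hj); rewrite ler_eXn2l// leq_maxr.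
  by rewrite lee_fin; apply: (le_trans (ltW hk)); rewrite ler_eXn2l// leq_maxl.
by rewrite poweR0r ?gt_eqF// mul0e mule0.
Qed.

Lemma good_lambda_integral u v g (th kap gam : R) :
  measurable_fun X u -> measurable_fun X v -> measurable_fun X g ->
  (forall x, X x -> 0 <= u x) -> (forall x, X x -> 0 <= v x) ->
  (forall x, X x -> 0 <= g x) ->
  (0 <= th)%R -> (be * th < 1)%R -> (0 <= kap)%R -> (0 < gam)%R ->
  (forall l : R, (0 < l)%R ->
    level_mass u (b * l) <= th%:E * level_mass u l + level_mass g (gam * l)) ->
  (forall l : R, (0 < l)%R ->
    level_mass u l <= kap%:E * level_mass v (4^-1 * l) + level_mass g (16^-1 * l)) ->
  \int[mu]_(x in X) (v x `^ s * w x) < +oo ->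
  \int[mu]_(x in X) (u x `^ s * w x) <=
    (be * (be * (K / gam `^ s) / (1 - be * th)))%:E * \int[mu]_(x in X) (g x `^ s * w x).
Proof.
move=> mfu mfv mfg u0 v0 g0 th0 bth kap0 gam0 h1 h2 vfin.
have be0 : (0 < be)%R by exact: lt_trans be1.
have N0 : (0 < be * (K / gam `^ s) / (1 - be * th))%R.
  by rewrite divr_gt0 ?subr_gt0// mulr_gt0// divr_gt0// powR_gt0.
set G := (X in _ <= _ * X); set V := (X in X < _) in vfin.
have G0 : 0 <= G.
  by apply: integral_ge0 => x Xx; apply: mule_ge0; [exact: poweR_ge0|exact: w0].
have V0 : 0 <= V.
  by apply: integral_ge0 => x Xx; apply: mule_ge0; [exact: poweR_ge0|exact: w0].
have [->|Goo] := eqVneq G +oo; first by rewrite gt0_muley ?leey// lte_fin mulr_gt0.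
have EG : G = (fine G)%:E by rewrite fineK// ge0_fin_numE// ltey.
have EV : V = (fine V)%:E by rewrite fineK// ge0_fin_numE.
have layer_split (c : R) n (F1 F2 F3 : nat -> \bar R) (t : R) : (0 <= t)%R -> (0 < c)%R ->
    (forall i, 0 <= F2 i) -> (forall i, 0 <= F3 i) ->
    (forall i, F1 i <= t%:E * F2 i + F3 i) ->
    \sum_(0 <= i < n) ((c * b ^+ i) `^ s)%:E * F1 i <=
    t%:E * (\sum_(0 <= i < n) ((c * b ^+ i) `^ s)%:E * F2 i) +
    \sum_(0 <= i < n) ((c * b ^+ i) `^ s)%:E * F3 i.
  move=> t0 c0 F20 F30 F123.
  rewrite ge0_sume_distrr; last first.
    by move=> i _; apply: mule_ge0 => //; rewrite lee_fin powR_ge0.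
  rewrite -big_split /=; apply: lee_sum => i _.
  rewrite muleCA -ge0_muleDr//; last by apply: mule_ge0.
  by apply: lee_wpmul2l => //; rewrite lee_fin powR_ge0.
have apriori c n : (0 < c)%R -> layer_mass u c n <=
    kap%:E * ((K / 4^-1 `^ s)%:E * V) + (K / 16^-1 `^ s)%:E * G.
  move=> c0; have h2' i := h2 (c * b ^+ i)%R (mulr_gt0 c0 (exprn_gt0 i b0)).
  apply: le_trans (layer_split c n _ _ _ _ kap0 c0 _ _ h2') _.
  - by move=> i; exact: level_mass_ge0.
  - by move=> i; exact: level_mass_ge0.
  by apply: leeD; [apply: lee_wpmul2l => //|]; apply: layer_mass_le_scaled.
pose S := ereal_sup [set layer_mass u cn.1 cn.2 | cn in [set cn : R * nat | (0 < cn.1)%R]].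
have S_ub c n : (0 < c)%R -> layer_mass u c n <= S.
  by move=> c0; apply: ereal_sup_ubound; exists (c, n).
have S0 : 0 <= S.
  by apply: le_trans (S_ub 1%R 0%N ltr01); rewrite /layer_mass big_nil.
have ES : S = (fine S)%:E.
  rewrite fineK// ge0_fin_numE//.
  apply: (@le_lt_trans _ _ (kap%:E * ((K / 4^-1 `^ s)%:E * V) + (K / 16^-1 `^ s)%:E * G)).
    by apply: ge_ereal_sup => _ [[c n] c0 <-]; exact: apriori.
  by rewrite EV EG -!EFinM -EFinD ltry.
pose M := (be * (K / gam `^ s))%R.
have shift c n : (0 < c)%R -> layer_mass u c n <= ((be * th) * fine S + M * fine G)%:E.
  move=> c0; have cb0 : (0 < c / b)%R by exact: divr_gt0.
  have -> : layer_mass u c n = be%:E *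
      \sum_(0 <= i < n) ((c / b * b ^+ i) `^ s)%:E * level_mass u (b * (c / b * b ^+ i)).
    rewrite ge0_sume_distrr; last first.
      by move=> i _; apply: mule_ge0; [rewrite lee_fin powR_ge0|exact: level_mass_ge0].
    apply: eq_bigr => i _; rewrite muleA -EFinM -layerS//.
    have -> : (c / b * b ^+ i.+1 = c * b ^+ i)%R by rewrite exprS mulrA divfK// gt_eqF.
    by rewrite !mulrA (mulrC b) mulfK// gt_eqF.
  rewrite EFinD -mulrA EFinM /M -(mulrA be) (EFinM be) -ge0_muleDr; first last.
  - by rewrite lee_fin mulr_ge0 ?fine_ge0// divr_ge0 ?ltW// powR_gt0.
  - by rewrite lee_fin mulr_ge0 ?fine_ge0.
  rewrite lee_pmul2l//.
  have h1' i := h1 (c / b * b ^+ i)%R (mulr_gt0 cb0 (exprn_gt0 i b0)).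
  apply: le_trans (layer_split _ n _ _ _ _ th0 cb0 _ _ h1') _.
  - by move=> i; exact: level_mass_ge0.
  - by move=> i; exact: level_mass_ge0.
  apply: leeD.
    by rewrite EFinM; apply: lee_wpmul2l => //; rewrite -ES; exact: S_ub.
  by rewrite EFinM -EG; apply: layer_mass_le_scaled.
have : S <= ((be * th) * fine S + M * fine G)%:E.
  by apply: ge_ereal_sup => _ [[c n] c0 <-]; exact: shift.
rewrite {1}ES lee_fin => hS.
have hS' : (fine S <= M / (1 - be * th) * fine G)%R.
  rewrite mulrAC ler_pdivlMr ?subr_gt0//.
  by rewrite mulrBr mulr1 lerBlDl (mulrC (fine S)).
rewrite EFinM -muleA.
apply: (le_trans (integral_poweR_le_layer mfu u0 S_ub)).
by rewrite lee_pmul2l// ES EG -EFinM lee_fin.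
Qed.

End LayerIntegral.

(** * Balls and A_p weights *)

Section Homogeneous.
Context (R : realType) (d : measure_display) (T : measurableType d).
Variable mu : {measure set T -> \bar R}.
Context (X : set T) (rho : T -> T -> R) (K1 K2 : R).
Hypothesis ht : homogeneous_type mu X rho K1 K2.
Local Notation B := (qball X rho).
Let K := Num.max K1 1%R.
Let L := Num.max K2 1%R.

Lemma rho_ge0 x y : X x -> X y -> (0 <= rho x y)%R.
Proof. by have [h _ _ _] := ht_quasi_metric ht; exact: h. Qed.

Lemma rho_sym x y : X x -> X y -> rho x y = rho y x.
Proof. by have [_ h _ _] := ht_quasi_metric ht; exact: h. Qed.

Lemma rho_xx x : X x -> rho x x = 0%R.
Proof. by move=> Xx; have [_ _ h _] := ht_quasi_metric ht; exact/(h x x Xx Xx). Qed.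

Lemma rho_triangle x y z : X x -> X y -> X z ->
  (rho x y <= K * (rho x z + rho z y))%R.
Proof.
move=> Xx Xy Xz; have [_ _ _ h] := ht_quasi_metric ht.
apply: (le_trans (h x y z Xx Xy Xz)); apply: ler_wpM2r.
  by rewrite addr_ge0// rho_ge0.
by rewrite le_max lexx.
Qed.

Lemma measurable_qball x r : X x -> (0 < r)%R -> measurable (B x r).
Proof. by move=> Xx r0; apply: (ht_borel ht); exact: (ht_ball_open ht). Qed.

Lemma qball_self x r : X x -> (0 < r)%R -> B x r x.
Proof. by move=> Xx r0; split => //; rewrite rho_xx. Qed.

Lemma qball_sub x r : B x r `<=` X. Proof. by move=> y []. Qed.

Lemma qball_mono x r s : (r <= s)%R -> B x r `<=` B x s.
Proof. by move=> rs y [Xy h]; split => //; exact: lt_le_trans rs. Qed.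

Lemma qball_finite x r : X x -> (0 < r)%R -> mu (B x r) < +oo.
Proof. by move=> Xx r0; have [] := ht_doubling ht Xx r0. Qed.

Lemma qball_gt0 x r : X x -> (0 < r)%R -> 0 < mu (B x r).
Proof.
move=> Xx r0; have r20 : (0 < r / 2)%R by exact: divr_gt0.
have [+ _ _] := ht_doubling ht Xx r20.
by rewrite mulrC divfK.
Qed.

Lemma qball_doubling x r m : X x -> (0 < r)%R ->
  mu (B x (2 ^+ m * r)) <= (L ^+ m)%:E * mu (B x r).
Proof.
move=> Xx r0; elim: m => [|m IH]; first by rewrite !expr0 mul1r mul1e.
have rm0 : (0 < 2 ^+ m * r)%R by rewrite mulr_gt0// exprn_gt0.
have [_ h _] := ht_doubling ht Xx rm0.
rewrite exprS -mulrA; apply: (le_trans h).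
apply: (@le_trans _ _ (L%:E * mu (B x (2 ^+ m * r)))).
  by apply: lee_wpmul2r => //; rewrite lee_fin le_max lexx.
by rewrite exprS EFinM -muleA; apply: lee_wpmul2l => //; rewrite lee_fin le_max ler01 orbT.
Qed.

Lemma qball_engulf x z r s M : X x -> X z -> (rho z x <= M * r)%R -> (s <= M * r)%R ->
  B x s `<=` B z (K * (2 * M) * r).
Proof.
move=> Xx Xz zx sM y [Xy xy]; split => //.
apply: (le_lt_trans (rho_triangle Xz Xy Xx)).
have K0 : (0 < K)%R by rewrite lt_max ltr01 orbT.
rewrite -!mulrA ltr_pM2l//; lra.
Qed.

Lemma finite_cover_homogeneous : finite_cover mu X.
Proof.
have [->|/eqP/set0P[x Xx]] := pselect (X = set0).
  by exists (fun=> set0); split => // k; split => //; rewrite measure0.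
exists (fun k => B x k.+1%:R); split => [k|y Xy].
  by split; [exact: measurable_qball|exact: qball_finite].
exists (Num.trunc (rho x y)) => //; split => //.
exact: truncnS_gt.
Qed.

Lemma qball_exhaust (c a : R) x (t : \bar R) : X x -> (0 < c)%R -> (0 < a < 1)%R ->
  t < mu X -> exists n0 : int, forall n : int, (n <= n0)%R -> t < mu (B x (c * a ^ n)).
Proof.
move=> Xx c0 /andP[a0 a1] tX.
have ca0 (n : int) : (0 < c * a ^ n)%R by rewrite mulr_gt0// exprz_gt0.
pose F k := B x (c * a ^ (- k%:Z)).
have ia1 : (1 < a^-1)%R by rewrite invf_gt1.
have Fmono : {homo F : n m / (n <= m)%N >-> (n <= m)%O}.
  move=> m n mn; apply/subsetPset/qball_mono.
  by rewrite ler_pM2l// -!exprz_inv -!exprnP ler_eXn2l.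
have FU : \bigcup_k F k = X.
  apply/seteqP; split => [y [k _ []]//|y Xy].
  have [k hk] := exists_expr_gt (rho x y / c)%R ia1.
  exists k => //; split => //.
  by rewrite -exprz_inv -exprnP mulrC -ltr_pdivrMr.
have mF k : measurable (F k) by exact: measurable_qball.
have := @nondecreasing_cvg_mu _ _ _ mu F mF _ Fmono.
rewrite FU => /(_ (ht_measurable ht)) cv.
have [k hk] : exists k, t < mu (F k).
  apply: contrapT => /forallNP h.
  have : mu X <= t.
    rewrite -(cvg_lim _ cv)//; apply: lime_le; first by apply/cvg_ex; eexists; exact: cv.
    by apply: nearW => k; rewrite leNgt; apply/negP; exact: h.
  by rewrite leNgt tX.
exists (- k%:Z)%R => n nk; apply: (lt_le_trans hk).
apply: le_measure; rewrite ?inE; [exact: measurable_qball|exact: measurable_qball|].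
apply: qball_mono; rewrite ler_pM2l// -[n]opprK -(exprz_inv a k) -(exprz_inv a (- n)) ler_eXz2l//.
by rewrite lerNr.
Qed.

End Homogeneous.

Lemma engulf_constant (R : realType) (K1 K2 M : R) : exists2 C : R, (0 < C)%R &
  forall (d : measure_display) (T : measurableType d) (mu : {measure set T -> \bar R})
    (X : set T) (rho : T -> T -> R), homogeneous_type mu X rho K1 K2 ->
  forall (x z : T) (r s : R), X x -> X z -> (0 < r)%R -> (0 < s)%R -> (rho z x <= M * r)%R -> (s <= M * r)%R ->
  mu (qball X rho x s) <= C%:E * mu (qball X rho z r).
Proof.
have [m hm] := exists_expr_gt (Num.max K1 1 * (2 * M))%R (ltr1n R 2).
exists (Num.max K2 1 ^+ m)%R; first by rewrite exprn_gt0// lt_max ltr01 orbT.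
move=> d T mu X rho ht x z r s Xx Xz r0 s0 zx sM.
apply: le_trans (qball_doubling ht m Xz r0).
apply: le_measure; rewrite ?inE.
- exact: measurable_qball ht _ _ _ _.
- by apply: (measurable_qball ht) => //; rewrite mulr_gt0// exprn_gt0.
apply: (subset_trans (qball_engulf ht Xx Xz zx sM)); apply: qball_mono.
by rewrite ler_pM2r// ltW.
Qed.

Lemma dyadic_constant (R : realType) (K1 K2 delta eps0 N0 : R) :
  (0 < delta < 1)%R -> (0 < eps0)%R ->
  exists M D : R, [/\ (0 < M)%R, (1 <= D)%R &
  forall (d : measure_display) (T : measurableType d) (mu : {measure set T -> \bar R})
    (X : set T) (rho : T -> T -> R) (I : int -> Type) (Q : forall n : int, I n -> set T),
  homogeneous_type mu X rho K1 K2 -> dyadic_filtration mu X rho delta eps0 N0 Q ->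
  dyadic_cubes mu Q X D /\
  forall n x, cub Q n x x -> cub Q n x `<=` qball X rho x (M * delta ^ n) /\
    mu (qball X rho x (M * delta ^ n)) <= D%:E * mu (cub Q n x)].
Proof.
move=> /andP[d0 d1] e0.
pose M : R := (2 * Num.max N0 1)%R.
have N1 : (1 <= Num.max N0 1)%R by rewrite le_max lexx orbT.
have N2 : (N0 <= Num.max N0 1)%R by rewrite le_max lexx.
have M0 : (0 < M)%R by rewrite mulr_gt0// (lt_le_trans _ N1).
pose M' := (M / (eps0 * delta))%R.
have [C C0 hC] := engulf_constant K1 K2 M'.
exists M, (Num.max C 1%R); split => //; first by rewrite le_max lexx orbT.
move=> d T mu X rho I Q ht df.
have dn0 (n : int) : (0 < delta ^ n)%R by rewrite exprz_gt0.
have mQ n a : measurable (Q n a) by apply: (ht_borel ht); exact: (df_open df).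
have QX n a : Q n a `<=` X by have [] := df_open df a.
have Qdist n a x y : Q n a x -> Q n a y -> (rho x y < M * delta ^ n)%R.
  move=> ax ay; apply: (@le_lt_trans _ _ (N0 * delta ^ n)%R).
    rewrite -lee_fin; apply: le_trans (df_diam df a).
    by apply: ereal_sup_ubound; exists (x, y).
  by rewrite ltr_pM2r// /M; apply: (le_lt_trans N2); rewrite ltr_pMl ?ltr1n// (lt_le_trans _ N1).
have big n a x (s : R) : Q n a x -> (0 < s)%R -> (s <= M * delta ^ (n - 1))%R ->
    mu (qball X rho x s) <= C%:E * mu (Q n a).
  move=> ax s0 sM; have [z [Xz zQ]] := df_ball df a.
  have ed0 : (0 < eps0 * delta ^ n)%R by exact: mulr_gt0.
  have az : Q n a z by apply: zQ; exact: (qball_self ht).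
  have MM : (M * delta ^ (n - 1) = M' * (eps0 * delta ^ n))%R.
    rewrite /M' expfzDr ?gt_eqF// exprN1; field.
    by rewrite !gt_eqF.
  apply: (@le_trans _ _ (C%:E * mu (qball X rho z (eps0 * delta ^ n)))).
    apply: (hC _ _ _ _ _ ht) => //; rewrite -?MM//; first exact: QX ax.
    apply/ltW/(lt_le_trans (Qdist _ _ _ _ az ax)).
    rewrite ler_pM2l// expfzDr ?gt_eqF// exprN1 ler_peMr ?invf_ge1 ?ltW//.
  apply: lee_wpmul2l; first by rewrite lee_fin ltW.
  by apply: le_measure; rewrite ?inE//; exact: (measurable_qball ht).
have Q0 n a : 0 < mu (Q n a).
  have [z [Xz zQ]] := df_ball df a.
  have ed0 : (0 < eps0 * delta ^ n)%R by exact: mulr_gt0.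
  apply: (lt_le_trans (qball_gt0 ht Xz ed0)).
  by apply: le_measure; rewrite ?inE//; exact: (measurable_qball ht).
have Qball n a x : Q n a x -> Q n a `<=` qball X rho x (M * delta ^ n).
  by move=> ax y ay; split; [exact: QX ay|exact: Qdist ax ay].
have Qoo n a : mu (Q n a) < +oo.
  have [z [Xz zQ]] := df_ball df a.
  have ed0 : (0 < eps0 * delta ^ n)%R by exact: mulr_gt0.
  have Md0 : (0 < M * delta ^ n)%R by exact: mulr_gt0.
  have az : Q n a z by apply: zQ; exact: (qball_self ht).
  apply: (le_lt_trans _ (qball_finite ht Xz Md0)).
  apply: le_measure; rewrite ?inE//; [exact: (measurable_qball ht)|exact: Qball].
have disj n a b x : Q n a x -> Q n b x -> Q n a = Q n b.
  by move=> ax bx; rewrite (df_disjoint df (i := a) (j := b))//; exists x.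
have cubE n a x : Q n a x -> cub Q n x = Q n a.
  move=> ax; apply/seteqP; split => [y [b [bx yb]]|y ay]; last by exists a.
  by rewrite (disj _ _ _ _ ax bx).
have CD A : C%:E * mu A <= (Num.max C 1%R)%:E * mu A.
  by apply: lee_wpmul2r => //; rewrite lee_fin le_max lexx.
have dle n : (M * delta ^ n <= M * delta ^ (n - 1))%R.
  by rewrite ler_pM2l// expfzDr ?gt_eqF// exprN1 ler_peMr ?invf_ge1 ?ltW.
have nest n (a : I n) : exists b, Q n a `<=` Q (n - 1)%R b.
  by have [b [ab _]] := df_nested df a; exists b.
split; last first.
  move=> n x [a [ax _]]; rewrite (cubE _ _ _ ax); split; first exact: Qball.
  by apply: le_trans (CD _); apply: big => //; rewrite mulr_gt0.
split => //.
- exact: (ht_measurable ht).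
- exact: (finite_cover_homogeneous ht).
- by rewrite lt_max ltr01 orbT.
move=> n x [a [ax _]]; have [b ab] := nest n a.
have bx := ab _ ax; rewrite (cubE _ _ _ ax) (cubE _ _ _ bx); apply: le_trans (CD _).
have Md0 : (0 < M * delta ^ (n - 1))%R by exact: mulr_gt0.
apply: le_trans (big _ _ _ _ ax Md0 (lexx _)).
by apply: le_measure; rewrite ?inE//; [apply: (measurable_qball ht) => //; exact: QX ax|exact: Qball].
Qed.

Section BadPoints.
Context (R : realType) (d : measure_display) (T : measurableType d).
Variable mu : {measure set T -> \bar R}.
Context (I : int -> Type) (Q : forall n : int, I n -> set T).
Context (X : set T) (D : R).
Hypothesis dc : dyadic_cubes mu Q X D.
Context (f : T -> R).
Hypothesis fint : forall n x, cub Q n x x -> mu.-integrable (cub Q n x) (EFin \o f).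

Lemma bad_point (l : R) x (n0 : int) : (0 < l)%R ->
  (forall n, (n <= n0)%R -> cub Q n x x ->
    2%:E * mu (cub Q n x `&` [set y | (l / 2 <= `|f y|)%R]) < mu (cub Q n x)) ->
  (forall n1 : int, exists2 n, (n <= n1)%R & (l < av mu f (cub Q n x))%R) ->
  (l / 8)%:E <= dsup Q (os mu f) x.
Proof.
move=> l0 h /(_ n0)[n nn0 ln].
have xx : cub Q n x x.
  apply: contrapT => /(cub_set0) e.
  by move: ln; rewrite e av_set0 ltNge ltW.
have [mA _ A0 Aoo] := cub_cube dc xx.
apply: le_trans (le_dsup _ _ n x); rewrite lee_fin leNgt; apply/negP => osl.
by have := osc_or_large mA A0 Aoo (fint xx) l0 ln osl; rewrite leNgt h.
Qed.

End BadPoints.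

Section DualWeight.
Context (R : realType) (d : measure_display) (T : measurableType d).
Implicit Types (D : set T) (w : T -> R).

Definition dual_weight w (e : R) (y : T) : \bar R := ((w y)%:E `^ e)^-1.

Lemma dual_weight_ge0 w e y : 0 <= dual_weight w e y.
Proof. by rewrite /dual_weight inve_ge0 poweR_ge0. Qed.

Lemma dual_weight_gt0 w e y : 0 < dual_weight w e y.
Proof.
rewrite /dual_weight poweR_EFin inver; case: eqP => // h.
by rewrite lte_fin invr_gt0 lt_neqAle eq_sym powR_ge0 andbT; apply/eqP.
Qed.

Lemma measurable_inve_EFin D (g : T -> R) : measurable D -> measurable_fun D g ->
  (forall x, D x -> (0 <= g x)%R) -> measurable_fun D (fun x => ((g x)%:E)^-1).
Proof.
move=> mD mg g0; apply: emeasurable_fun_gt => t.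
have [t0|t0] := ltP t 0%R.
  rewrite (_ : _ `&` _ = D)//; apply/seteqP; split => [x []//|x Dx]; split => //=.
  by apply: (@lt_le_trans _ _ 0); rewrite ?lte_fin// inve_ge0 lee_fin g0.
have mtg : measurable_fun D (fun x => t * g x)%R by exact: measurable_funM.
have := measurable_ltr_set mD mtg (measurable_cst (1%R : R)).
rewrite (_ : _ `&` _ = D `&` [set x | t%:E < ((g x)%:E)^-1])//.
apply/seteqP; split => x [Dx /= h]; split => //=; move: h; rewrite inver.
  case: eqP => [_ _|/eqP gx h]; first exact: ltry.
  by rewrite lte_fin -div1r ltr_pdivlMr// lt_neqAle eq_sym gx g0.
case: eqP => [-> _|/eqP gx]; first by rewrite mulr0 ltr01.
by rewrite lte_fin -div1r ltr_pdivlMr// lt_neqAle eq_sym gx g0.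
Qed.

Lemma measurable_dual_weight D w e : measurable D -> measurable_fun D w ->
  measurable_fun D (dual_weight w e).
Proof.
move=> mD mw; rewrite (_ : dual_weight w e = fun x => (((w x) `^ e)%:E)^-1).
  apply: measurable_inve_EFin => [//||x _]; last exact: powR_ge0.
  by apply: (measurableT_comp (@measurable_powR R e)).
by apply/funext => x; rewrite /dual_weight poweR_EFin.
Qed.

End DualWeight.

Section ApBall.
Context (R : realType) (d : measure_display) (T : measurableType d).
Variable mu : {measure set T -> \bar R}.
Context (X : set T) (rho : T -> T -> R) (K1 K2 : R).
Hypothesis ht : homogeneous_type mu X rho K1 K2.
Context (P K : R) (w : T -> R).
Hypotheses (P1 : (1 < P)%R) (K1' : (1 <= K)%R) (Aw : Ap_weight mu X rho P w)
  (AK : Ap_const mu X rho P w <= K%:E).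
Let e := (P - 1)^-1%R.
Let e0 : (0 < e)%R. Proof. by rewrite invr_gt0 subr_gt0. Qed.

Lemma Ap_ball x r : X x -> (0 < r)%R -> exists a : R, [/\ (0 <= a)%R,
  \int[mu]_(y in qball X rho x r) (w y)%:E = a%:E * mu (qball X rho x r) &
  (0 < a)%R -> \int[mu]_(y in qball X rho x r) dual_weight w e y <=
     ((K / a) `^ e)%:E * mu (qball X rho x r)].
Proof.
move=> Xx r0; set B := qball X rho x r.
have mB : measurable B by apply: (measurable_qball ht).
have B0 : 0 < mu B by apply: (qball_gt0 ht).
have Boo : mu B < +oo by apply: (qball_finite ht).
have BX : B `<=` X by exact: qball_sub.
have [m Em] : exists m, mu B = m%:E by exists (fine (mu B)); rewrite fineK// ge0_fin_numE.
have m0 : (0 < m)%R by rewrite -lte_fin -Em.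
have [w0 mw _] := Aw.
have mwB : measurable_fun B w by exact: measurable_funS (ht_measurable ht) BX mw.
have wB0 : 0 <= \int[mu]_(y in B) (w y)%:E.
  by apply: integral_ge0 => y /BX Xy; rewrite lee_fin w0.
have sB0 : 0 <= \int[mu]_(y in B) dual_weight w e y.
  by apply: integral_ge0 => y _; exact: dual_weight_ge0.
have msB : measurable_fun B (dual_weight w e) by exact: measurable_dual_weight.
have sBpos : 0 < \int[mu]_(y in B) dual_weight w e y.
  rewrite lt_neqAle sB0 andbT; apply/eqP => s0.
  have : \int[mu]_(y in B) `|dual_weight w e y| = 0.
    by rewrite s0; apply: eq_integral => y _; rewrite gee0_abs ?dual_weight_ge0.
  move/(ae_eq_integral_abs _ mB msB) => [N [mN N0 BN]].
  have : mu B <= mu N.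
    apply: le_measure; rewrite ?inE// => y By; apply: BN => /= h.
    by have := dual_weight_gt0 w e y; rewrite h// ltxx.
  by rewrite N0 leNgt B0.
have term : avg mu B (EFin \o w) * (avg mu B (dual_weight w e)) `^ (P - 1) <= K%:E.
  by apply: le_trans AK; apply: ereal_sup_ubound; exists (x, r).
have P10 : (0 < P - 1)%R by rewrite subr_gt0.
have im : (mu B)^-1 = (m^-1)%:E by rewrite Em inver gt_eqF.
have spos : 0 < (avg mu B (dual_weight w e)) `^ (P - 1).
  by apply: poweR_gt0; rewrite /avg im mule_gt0// lte_fin invr_gt0.
have wfin : \int[mu]_(y in B) (w y)%:E \is a fin_num.
  rewrite ge0_fin_numE// ltey; apply/eqP => h.
  have hy : avg mu B (EFin \o w) = +oo.
    by rewrite /avg h im gt0_muley ?lte_fin ?invr_gt0.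
  by move: term; rewrite hy gt0_mulye// leye_eq.
exists (fine (\int[mu]_(y in B) (w y)%:E) / m)%R.
have Ew : \int[mu]_(y in B) (w y)%:E =
  (fine (\int[mu]_(y in B) (w y)%:E) / m)%:E * mu B.
  by rewrite Em -EFinM divfK ?gt_eqF// fineK.
split => //; first by rewrite divr_ge0 ?fine_ge0 ?(ltW m0).
set a := (_ / m)%R in Ew *; move=> a0.
have avw : avg mu B (EFin \o w) = a%:E.
  by rewrite /avg Ew im Em -EFinM mulrCA mulVf ?mulr1// gt_eqF.
move: term; rewrite avw => term.
have h1 : (avg mu B (dual_weight w e)) `^ (P - 1) <= (K / a)%:E.
  by rewrite -(@lee_pmul2l _ a%:E) ?lte_fin// -EFinM mulrC divfK// gt_eqF.
have h2 : avg mu B (dual_weight w e) <= ((K / a) `^ e)%:E.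
  have av0 : 0 <= avg mu B (dual_weight w e).
    by rewrite /avg im mule_ge0// lee_fin invr_ge0 ltW.
  have := le_poweR (ltW e0) (poweR_ge0 _ _) h1.
  by rewrite -poweRrM /e mulfV ?gt_eqF// poweRe1// poweR_EFin.
rewrite Em muleC -lee_pdivrMl//; move: h2; rewrite /avg im//.
Qed.

Lemma Ap_ball_fin x r : X x -> (0 < r)%R ->
  \int[mu]_(y in qball X rho x r) (w y)%:E < +oo.
Proof.
move=> Xx r0; have [a [_ -> _]] := Ap_ball Xx r0.
have h := qball_finite ht Xx r0.
have : mu (qball X rho x r) \is a fin_num by rewrite ge0_fin_numE.
by move/fineK <-; rewrite -EFinM ltry.
Qed.

(* Off the set where [w <= tau a] Chebyshev bounds [w]; on that set the dual
   weight is large, so the set is small. *)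
Lemma Ap_large x r (E : set T) (M tau : R) : X x -> (0 < r)%R -> (0 < M)%R -> (0 < tau)%R ->
  ((tau * K) `^ e * M <= 2^-1)%R ->
  measurable E -> E `<=` qball X rho x r -> mu (qball X rho x r) <= M%:E * mu E ->
  \int[mu]_(y in qball X rho x r) (w y)%:E <= (2 * M / tau)%:E * \int[mu]_(y in E) (w y)%:E.
Proof.
move=> Xx r0 M0 tau0 htau mE EB BE; set B := qball X rho x r in EB BE *.
have mB : measurable B by apply: (measurable_qball ht).
have B0 : 0 < mu B by apply: (qball_gt0 ht).
have Boo : mu B < +oo by apply: (qball_finite ht).
have BX : B `<=` X by exact: qball_sub.
have EX : E `<=` X by exact: subset_trans BX.
have [w0 mw _] := Aw.
have mwE : measurable_fun E w by exact: measurable_funS (ht_measurable ht) EX mw.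
have mwB : measurable_fun B w by exact: measurable_funS (ht_measurable ht) BX mw.
have wE0 : 0 <= \int[mu]_(y in E) (w y)%:E.
  by apply: integral_ge0 => y /EX Xy; rewrite lee_fin w0.
have [a [a0 Ea ha]] := Ap_ball Xx r0.
have c0 : (0 <= 2 * M / tau)%R by rewrite divr_ge0 ?ltW// mulr_gt0.
move: a0; rewrite le_eqVlt => /orP[/eqP a0|a0].
  by rewrite Ea -a0 mul0e; apply: mule_ge0.
have {}ha := ha a0.
pose F := E `&` [set y | (w y < tau * a)%R].
have mF : measurable F.
  exact: (measurable_ltr_set mE mwE (measurable_cst (tau * a)%R)).
have [m Em] : exists m, mu B = m%:E by exists (fine (mu B)); rewrite fineK// ge0_fin_numE.
have fin A : measurable A -> A `<=` B -> exists2 m', mu A = m'%:E & (0 <= m')%R.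
  move=> mA AB; exists (fine (mu A)); last exact: fine_ge0.
  rewrite fineK// ge0_fin_numE//; apply: (le_lt_trans _ Boo).
  by apply: le_measure; rewrite ?inE.
have FE : F `<=` E by move=> y [].
have mD : measurable (E `\` F) by exact: measurableD.
have [g Eg g0] := fin F mF (subset_trans FE EB).
have [k Ek k0] := fin (E `\` F) mD (subset_trans (@subDsetl _ _ _) EB).
have muE : mu E = (g + k)%:E.
  rewrite EFinD -Eg -Ek -measureU//; last by rewrite setDE setICA setICr setI0.
  by rewrite setDUK.
have ta0 : (0 < tau * a)%R by exact: mulr_gt0.
have tae0 : (0 < (tau * a) `^ e)%R by exact: powR_gt0.
have hF : (((tau * a) `^ e)^-1)%:E * mu F <= ((K / a) `^ e)%:E * mu B.
  apply: le_trans ha; rewrite -integral_cst//.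
  apply: (@le_trans _ _ (\int[mu]_(y in F) dual_weight w e y)); last first.
    apply: ge0_subset_integral => //.
    - exact: measurable_dual_weight.
    - by move=> y _; exact: dual_weight_ge0.
    - exact: subset_trans EB.
  apply: ge0_le_integral => //.
  - by move=> y _; rewrite lee_fin invr_ge0 ltW.
  - by apply: measurable_dual_weight => //; exact: measurable_funS mwE.
  - move=> y [Ey /= wy]; rewrite /cst /dual_weight poweR_EFin inver.
    have wy0 := w0 _ (EX _ Ey).
    case: eqP => [_|/eqP h]; [by rewrite leey|rewrite lee_fin lef_pV2 ?posrE//].
      by rewrite le_powR// ltW.
    by rewrite lt_neqAle eq_sym h powR_ge0.
move: hF; rewrite Eg Em -!EFinM lee_fin => hF.
move: BE; rewrite muE Em -EFinM lee_fin => BE.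
have gm : (g <= (tau * K) `^ e * m)%R.
  have K0 : (0 < K)%R by exact: lt_le_trans K1'.
  have -> : ((tau * K) `^ e = (tau * a) `^ e * (K / a) `^ e)%R.
    rewrite -powRM ?ltW ?divr_gt0//; congr (_ `^ _)%R; field; by rewrite gt_eqF.
  by rewrite -mulrA -ler_pdivrMl.
have gE : (g <= 2^-1 * (g + k))%R.
  apply: (le_trans gm); apply: (@le_trans _ _ ((tau * K) `^ e * (M * (g + k))))%R.
    by apply: ler_wpM2l; rewrite ?powR_ge0.
  by rewrite mulrA ler_wpM2r// addr_ge0.
have hk : (tau * a)%:E * mu (E `\` F) <= \int[mu]_(y in E) (w y)%:E.
  rewrite -integral_cst//.
  apply: (@le_trans _ _ (\int[mu]_(y in E `\` F) (w y)%:E)); last first.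
    apply: ge0_subset_integral => //; first exact/measurable_EFinP.
    by move=> y /EX Xy; rewrite lee_fin w0.
  apply: ge0_le_integral => //.
  - by move=> y _; rewrite lee_fin ltW.
  - by apply/measurable_EFinP; apply: measurable_funS mwE => // y [].
  - by move=> y [Ey nF]; rewrite lee_fin leNgt; apply/negP => h; apply: nF.
rewrite Ea Em; apply: (@le_trans _ _ ((2 * M / tau)%:E * ((tau * a)%:E * mu (E `\` F)))); last first.
  by apply: lee_wpmul2l.
rewrite Ek -!EFinM lee_fin.
have -> : (2 * M / tau * (tau * a * k) = a * (2 * M * k))%R by field; rewrite gt_eqF.
by rewrite ler_pM2l//; apply: (le_trans BE); rewrite -mulrA mulrCA ler_pM2l//; lra.
Qed.

End ApBall.

Lemma Ap_large_constant (R : realType) (P K M : R) : (1 < P)%R -> (0 < M)%R ->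
  exists2 C : R, (1 <= C)%R &
  forall (d : measure_display) (T : measurableType d) (mu : {measure set T -> \bar R})
    (X : set T) (rho : T -> T -> R) (K1 K2 : R) (w : T -> R),
  homogeneous_type mu X rho K1 K2 -> Ap_weight mu X rho P w ->
  Ap_const mu X rho P w <= K%:E ->
  forall (x : T) (r : R) (E : set T), X x -> (0 < r)%R -> measurable E ->
  E `<=` qball X rho x r -> mu (qball X rho x r) <= M%:E * mu E ->
  \int[mu]_(y in qball X rho x r) (w y)%:E <= C%:E * \int[mu]_(y in E) (w y)%:E.
Proof.
move=> P1 M0; pose K' := Num.max K 1%R.
have K'1 : (1 <= K')%R by rewrite le_max lexx orbT.
have K'0 : (0 < K')%R by exact: lt_le_trans K'1.
pose tau := ((2 * M)^-1 `^ (P - 1) / K')%R.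
have M20 : (0 < (2 * M)^-1)%R by rewrite invr_gt0 mulr_gt0.
have P10 : (0 < P - 1)%R by rewrite subr_gt0.
have tau0 : (0 < tau)%R by rewrite divr_gt0// powR_gt0.
exists (Num.max (2 * M / tau) 1)%R; first by rewrite le_max lexx orbT.
move=> d T mu X rho K1 K2 w ht Aw AK x r E Xx r0 mE EB BE.
have AK' : Ap_const mu X rho P w <= K'%:E.
  by apply: (le_trans AK); rewrite lee_fin le_max lexx.
have EX : E `<=` X by move=> y /EB [].
have [w0 _ _] := Aw.
apply: (@le_trans _ _ ((2 * M / tau)%:E * \int[mu]_(y in E) (w y)%:E)); last first.
  apply: lee_wpmul2r; last by rewrite lee_fin le_max lexx.
  by apply: integral_ge0 => y /EX Xy; rewrite lee_fin w0.
apply: (Ap_large ht P1 K'1 Aw AK') => //.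
rewrite /tau divfK ?gt_eqF// -powRrM mulfV ?gt_eqF// powRr1 ?(ltW M20)//.
by rewrite invfM -mulrA mulVf ?mulr1// gt_eqF.
Qed.

Section Degenerate.
Context (R : realType) (d : measure_display) (T : measurableType d).
Variable mu : {measure set T -> \bar R}.

Lemma integral_eq0_mul (D : set T) (f g : T -> \bar R) : measurable D ->
  measurable_fun D f -> measurable_fun D g -> (forall x, D x -> 0 <= f x) ->
  \int[mu]_(x in D) f x = 0 -> \int[mu]_(x in D) (g x * f x) = 0.
Proof.
move=> mD mf mg f0 f_eq0.
have : \int[mu]_(x in D) `|f x| = 0.
  by rewrite -f_eq0; apply: eq_integral => x /set_mem Dx; rewrite gee0_abs// f0.
move/(ae_eq_integral_abs _ mD mf) => ae0.
rewrite (@ae_eq_integral _ _ _ mu D (cst 0) (fun x => g x * f x))//.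
- by rewrite integral0_eq.
- exact: emeasurable_funM.
by apply: filterS ae0 => x h Dx; rewrite h// mule0.
Qed.

Context (X : set T) (rho : T -> T -> R) (K1 K2 : R).
Hypothesis ht : homogeneous_type mu X rho K1 K2.

Lemma integral_qball_eq0 (f : T -> \bar R) x : X x -> measurable_fun X f ->
  (forall x, X x -> 0 <= f x) ->
  (forall r, (0 < r)%R -> \int[mu]_(y in qball X rho x r) f y = 0) ->
  \int[mu]_(y in X) f y = 0.
Proof.
move=> Xx mf f0 h; pose F (k : nat) := qball X rho x k.+1%:R.
have mF k : measurable (F k) by apply: (measurable_qball ht).
have FX k : F k `<=` X by exact: qball_sub.
have nF : {homo F : n m / (n <= m)%N >-> (n <= m)%O}.
  by move=> m n mn; apply/subsetPset/qball_mono; rewrite ler_nat.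
have UF : \bigcup_k F k = X.
  apply/seteqP; split => [y [k _ /FX]//|y Xy].
  exists (Num.trunc (rho x y)) => //; split => //.
  exact: truncnS_gt.
have cv := @ge0_nondecreasing_set_cvg_integral _ _ _ F f mu nF mF
  (fun k => measurable_funS (ht_measurable ht) (FX k) mf) (fun k y Fy => f0 y (FX k y Fy)).
rewrite -UF -(cvg_lim _ cv)// (_ : (fun k => _) = cst 0) ?lim_cst//.
by apply/funext => k; exact: h.
Qed.

Context (P K : R) (w : T -> R).
Hypotheses (P1 : (1 < P)%R) (Aw : Ap_weight mu X rho P w)
  (AK : Ap_const mu X rho P w <= K%:E).

Lemma Ap_degenerate (E : set T) x r : X x -> (0 < r)%R -> measurable E ->
  E `<=` qball X rho x r -> 0 < mu E -> \int[mu]_(y in E) (w y)%:E <= 0 ->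
  \int[mu]_(y in X) (w y)%:E = 0.
Proof.
move=> Xx r0 mE EB E0 le0; have [w0 mw _] := Aw.
have mwE : measurable_fun X (EFin \o w) by exact/measurable_EFinP.
apply: (integral_qball_eq0 (x := x)) => // s s0; pose t := Num.max r s.
have t0 : (0 < t)%R by rewrite lt_max r0.
have Btoo : mu (qball X rho x t) < +oo by apply: (qball_finite ht).
have Bt0 : 0 < mu (qball X rho x t) by apply: (qball_gt0 ht).
have mB u : (0 < u)%R -> measurable (qball X rho x u) by move=> u0; apply: (measurable_qball ht).
have Et : E `<=` qball X rho x t by apply: (subset_trans EB); apply: qball_mono; rewrite le_max lexx.
have Eoo : mu E < +oo.
  by apply: le_lt_trans Btoo; apply: le_measure; rewrite ?inE//; exact: mB.
pose M := (fine (mu (qball X rho x t)) / fine (mu E))%R.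
have mr0 := m_gt0 E0 Eoo; have mt0 := m_gt0 Bt0 Btoo.
have M0 : (0 < M)%R by rewrite divr_gt0.
have [C C1 hC] := Ap_large_constant K P1 M0.
apply/eqP; rewrite eq_le integral_ge0 ?andbT; last by move=> y [Xy _]; rewrite lee_fin w0.
apply: (@le_trans _ _ (\int[mu]_(y in qball X rho x t) (w y)%:E)).
  apply: ge0_subset_integral => //; try exact: mB.
  - by apply: measurable_funS (ht_measurable ht) _ mwE; exact: qball_sub.
  - by move=> y [Xy _]; rewrite lee_fin w0.
  - by apply: qball_mono; rewrite le_max lexx orbT.
apply: le_trans (hC _ _ _ _ _ _ _ _ ht Aw AK x t E Xx t0 mE Et _) _ => //.
  by rewrite (mu_fine Btoo) (mu_fine Eoo) -EFinM lee_fin /M divfK// gt_eqF.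
by rewrite mule_ge0_le0// lee_fin (le_trans _ C1).
Qed.

End Degenerate.

(** * The sharp function inequality with one exponent *)

Section Domination.
Context (R : realType) (d : measure_display) (T : measurableType d).
Variable mu : {measure set T -> \bar R}.
Context (X : set T) (rho : T -> T -> R) (K1 K2 : R).
Hypothesis ht : homogeneous_type mu X rho K1 K2.
Context (I : int -> Type) (Q : forall n : int, I n -> set T) (D M delta : R).
Hypothesis dc : dyadic_cubes mu Q X D.
Hypotheses (d01 : (0 < delta < 1)%R) (M0 : (0 < M)%R).
Hypothesis cubB : forall n x, cub Q n x x -> cub Q n x `<=` qball X rho x (M * delta ^ n) /\
    mu (qball X rho x (M * delta ^ n)) <= D%:E * mu (cub Q n x).
Hypothesis full : forall n, mu (X `\` \bigcup_(a in [set: I n]) Q a) = 0.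
Context (f : T -> R).
Hypothesis mf : measurable_fun X f.
Hypothesis fint : forall n x, cub Q n x x -> mu.-integrable (cub Q n x) (EFin \o f).

Let mX := dc_meas dc.

Lemma negligible_core : mu.-negligible (X `\` [set x | forall n, cub Q n x x]).
Proof.
have -> : X `\` [set x | forall n, cub Q n x x] =
    \bigcup_(n in [set: int]) (X `\` \bigcup_(a in [set: I n]) Q a).
  apply/seteqP; split => [x [Xx /existsNP[n nn]]|x [n _ [Xx nx]]].
    by exists n => //; split => // -[a _ ax]; apply: nn; exists a.
  by split => // /(_ n)[a [ax _]]; apply: nx; exists a.
apply: negligible_bigcup_countType => n; apply/negligibleP; last exact: full.
apply: measurableD => //.
have -> : \bigcup_(a in [set: I n]) Q a = [set x | cub Q n x x /\ True].
  apply/seteqP; split => [x [a _ ax]|x [[a [ax _]] _]]; last by exists a.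
  by split => //; exists a.
exact: (measurable_level dc n (fun=> True)).
Qed.

Lemma measurable_Mf : measurable_fun X (dsup Q (av mu f)).
Proof. apply: (measurable_dsup dc) => [A|]; [exact: av_ge0|exact: av_set0]. Qed.

Lemma density_point (E : set T) (eta : R) : measurable E -> E `<=` X -> (0 < eta)%R ->
  mu.-negligible (E `\` [set x | exists2 n, cub Q n x x &
    mu (cub Q n x `\` E) <= (eta * D)%:E * mu (cub Q n x)]).
Proof.
move=> mE EX eta0; have [dl0 dl1] := andP d01.
have LE : L1loc mu X rho (\1_E : T -> R).
  split; first exact: measurable_indic.
  move=> x r Xx r0; apply: measurable_bounded_integrable.
  - exact: (measurable_qball ht).
  - exact: (qball_finite ht).
  - exact: measurable_indic.
  - exists 1%R; split => // t t1 y _ /=; rewrite indicE; case: (y \in E) => /=; rewrite ?normr1 ?normr0 ltW//.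
    by rewrite (lt_trans _ t1).
have hL := ht_lebesgue ht LE.
apply: (@negligibleS _ _ _ _ ((X `\` [set x | forall n, cub Q n x x]) `|`
   ~` [set x | X x -> avg mu (qball X rho x r) (EFin \o \1_E) @[r --> 0%R^'+] --> (\1_E x : R)%:E])); last first.
  by apply: negligibleU => //; exact: negligible_core.
move=> x [Ex nx]; have Xx := EX _ Ex.
have [core|] := pselect (forall n, cub Q n x x); last by left.
right=> /(_ Xx); rewrite indicE mem_set//= => /cvge_at_rightP cv.
have {cv} := cv (fun k => M * delta ^+ k)%R (conj _ _).
have dk0 k : (0 < M * delta ^+ k)%R by rewrite mulr_gt0// exprn_gt0.
have u0 : (M * delta ^+ k)%R @[k --> \oo] --> (0 : R)%R.
  by apply: cvg_geometric; rewrite ger0_norm// ltW.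
move=> /(_ (fun k => dk0 k) u0) cv.
have [k hk] : exists k, (1 - eta)%:E < avg mu (qball X rho x (M * delta ^+ k)) (EFin \o \1_E).
  apply: contrapT => /forallNP h.
  have : 1%:E <= (1 - eta)%:E.
    rewrite -(cvg_lim _ cv)//; apply: lime_le; first by apply/cvg_ex; eexists; exact: cv.
    by apply: nearW => k; rewrite leNgt; apply/negP; exact: h.
  by rewrite lee_fin lerBrDr gerDl leNgt eta0.
apply: nx; exists k%:Z => //.
have [cB muB] := cubB (core k%:Z); rewrite -exprnP in cB muB.
set B := qball _ _ _ _ in hk cB muB; set A := cub _ _ _ in cB muB *.
have mB : measurable B by apply: (measurable_qball ht).
have B0 : 0 < mu B by apply: (qball_gt0 ht).
have Boo : mu B < +oo by apply: (qball_finite ht).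
have [mA AX A0 Aoo] := cub_cube dc (core k%:Z).
have [m Em] : exists m, mu B = m%:E.
  by exists (fine (mu B)); rewrite fineK// ge0_fin_numE.
have m0 : (0 < m)%R by rewrite -lte_fin -Em.
have hBE : (1 - eta)%:E * mu B <= mu (B `&` E).
  move: hk; rewrite /avg [X in _ * X](_ : _ = mu (B `&` E)); last first.
    by rewrite setIC -integral_indic.
  move/ltW; rewrite Em inver gt_eqF// => h.
  by rewrite muleC -lee_pdivlMl// muleC// muleC.
have fin F : measurable F -> mu (B `&` F) \is a fin_num.
  move=> mF; rewrite ge0_fin_numE//; apply: le_lt_trans Boo.
  by apply: le_measure; rewrite ?inE//; exact: measurableI.
have muBE : mu B = mu (B `&` E) + mu (B `\` E).
  rewrite -measureU//; [by rewrite setUIDK|exact: measurableI|exact: measurableD|].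
  by rewrite setDE setIACA setICr setI0.
have fin2 : mu (B `\` E) \is a fin_num.
  by rewrite setDE; apply: fin; exact: measurableC.
have h1 : mu (B `\` E) <= eta%:E * mu B.
  move: hBE; rewrite muBE -(fineK (fin _ mE)) -(fineK fin2) -!EFinD -!EFinM !lee_fin; lra.
apply: (@le_trans _ _ (mu (B `\` E))).
  by apply: le_measure; rewrite ?inE; [exact: measurableD|exact: measurableD|exact: setSD].
apply: (le_trans h1); rewrite EFinM -muleA; apply: lee_wpmul2l => //.
by rewrite lee_fin ltW.
Qed.

Lemma ae_le_Mf : {ae mu, forall x, X x -> (`|f x|)%:E <= dsup Q (av mu f) x}.
Proof.
pose E (q : rat * rat) := X `&` [set x | (dsup Q (av mu f) x <= (ratr q.1 : R)%:E) /\ (ratr q.2 <= `|f x|)%R].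
have mE q : measurable (E q).
  have -> : E q = (X `&` [set x | dsup Q (av mu f) x <= (ratr q.1 : R)%:E]) `&`
      (X `&` [set x | (ratr q.2 : R)%:E <= (`|f x|)%:E]).
    by apply/seteqP; split => [x [Xx [h1 h2]]|x [[Xx h1] [_ h2]]].
  apply: measurableI.
    by apply: emeasurable_fun_infty_c => //; exact: measurable_Mf.
  apply: emeasurable_fun_c_infty => //.
  by apply/measurable_EFinP; exact: (measurableT_comp (@normr_measurable R setT)).
have nE q : (ratr q.1 < ratr q.2 :> R)%R -> (0 <= ratr q.1 :> R)%R -> mu.-negligible (E q).
  move=> q12 q10; set a : R := ratr q.1 in q12 q10; set b : R := ratr q.2 in q12.
  have D0 := dc_pos dc; have b0 : (0 < b)%R by exact: le_lt_trans q12.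
  pose eta : R := ((b - a) / (2 * b * D))%R.
  have eta0 : (0 < eta)%R by rewrite /eta divr_gt0 ?subr_gt0//; apply: mulr_gt0 => //; apply: mulr_gt0.
  have EX : E q `<=` X by move=> x [].
  apply: negligibleS (density_point (mE q) EX eta0) => x Ex; split => // -[n xx h].
  have [Xx [/= fa _]] := Ex.
  have [mA AX A0 Aoo] := cub_cube dc xx; set A := cub _ _ _ in mA AX A0 Aoo h.
  have avA : (av mu f A <= a)%R by rewrite -lee_fin; apply: le_trans fa; exact: le_dsup.
  have hint : b%:E * mu (A `&` E q) <= (av mu f A * fine (mu A))%:E.
    rewrite -(int_avE mA A0 Aoo (fint xx)) -integral_cst; last exact: measurableI.
    apply: (@le_trans _ _ (\int[mu]_(x in A `&` E q) (`|f x|)%:E)); last first.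
      apply: ge0_subset_integral => //; first exact: measurableI.
      exact: (measurable_absf (fint xx)).
    apply: ge0_le_integral => //; first exact: measurableI.
    - by move=> y _; rewrite lee_fin ltW.
    - apply: (measurable_funS mA) => //; exact: (measurable_absf (fint xx)).
    - by move=> y [_ [_ [_ /= h2]]]; rewrite /cst lee_fin.
  have muAE : mu A = mu (A `&` E q) + mu (A `\` E q).
    rewrite -measureU//; [by rewrite setUIDK|exact: measurableI|exact: measurableD|].
    by rewrite setDE setIACA setICr setI0.
  have fin F : measurable F -> mu (A `&` F) \is a fin_num.
    move=> mF; rewrite ge0_fin_numE//; apply: le_lt_trans Aoo.
    by apply: le_measure; rewrite ?inE//; exact: measurableI.
  have fin2 : mu (A `\` E q) \is a fin_num.
    by rewrite setDE; apply: fin; exact: measurableC.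
  have mA0 := m_gt0 A0 Aoo; set m := fine (mu A) in mA0 hint.
  have Em : mu A = m%:E by rewrite (mu_fine Aoo).
  have [g Eg] : exists g, mu (A `&` E q) = g%:E.
    by exists (fine (mu (A `&` E q))); rewrite fineK// fin.
  have [k Ek] : exists k, mu (A `\` E q) = k%:E.
    by exists (fine (mu (A `\` E q))); rewrite fineK.
  move: hint h muAE; rewrite Em Eg Ek -!EFinM -EFinD !lee_fin => hint h [] muAE.
  have h3 : (av mu f A * m <= a * m)%R by rewrite ler_pM2r.
  have h4 : (b * k <= (b - a) / 2 * m)%R.
    have -> : ((b - a) / 2 * m = b * (eta * D * m))%R by rewrite /eta; field; rewrite !gt_eqF.
    by rewrite ler_pM2l.
  have h5 : (b * m <= a * m + (b - a) / 2 * m)%R by rewrite muAE mulrDr -muAE; lra.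
  have : (0 < (b - a) * m)%R by rewrite mulr_gt0// subr_gt0.
  lra.
apply: (@negligibleS _ _ _ _ (\bigcup_(q in [set: rat * rat])
  (if (ratr q.1 < ratr q.2 :> R)%R && (0 <= ratr q.1 :> R)%R then E q else set0))); last first.
  by apply: negligible_bigcup_countType => q; case: ifP => [/andP[]|_]; [exact: nE|exact: negligible_set0].
move=> x /not_implyP[Xx /negP]; rewrite -ltNge => h.
have Mf0 : 0 <= dsup Q (av mu f) x by apply: dsup_ge0; exact: av_ge0.
have fin : dsup Q (av mu f) x \is a fin_num.
  by rewrite ge0_fin_numE//; apply: (lt_trans h); exact: ltry.
move: h; rewrite -(fineK fin) lte_fin => h.
have [q1 q1P] := rat_in_itvoo h; move: q1P; rewrite in_itv /= => /andP[h1 h2].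
have [q2 q2P] := rat_in_itvoo h2; move: q2P; rewrite in_itv /= => /andP[h3 h4].
exists (q1, q2) => //=; rewrite h3 /= ifT; last first.
  by apply: le_trans (ltW h1); exact: fine_ge0.
by split => //=; rewrite -(fineK fin) lee_fin; split; exact: ltW.
Qed.

End Domination.

Section DyadicSharp.
Context (R : realType) (d : measure_display) (T : measurableType d).
Variable mu : {measure set T -> \bar R}.
Context (I : int -> Type) (Q : forall n : int, I n -> set T) (X : set T) (D : R).
Hypothesis dc : dyadic_cubes mu Q X D.
Context (f : T -> R).
Hypothesis fint : forall n x, cub Q n x x -> mu.-integrable (cub Q n x) (EFin \o f).

Lemma avg_cnE A : measurable A -> 0 < mu A -> mu A < +oo ->
  mu.-integrable A (EFin \o f) -> avg mu A (EFin \o f) = (cn mu f A)%:E.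
Proof.
move=> mA A0 Aoo fA; rewrite /avg (int_cnE mA A0 Aoo fA) (mu_fine Aoo).
have m0 := m_gt0 A0 Aoo; rewrite inver gt_eqF// -EFinM mulrCA mulVf ?mulr1//.
by rewrite gt_eqF.
Qed.

Lemma avg_osE A : measurable A -> 0 < mu A -> mu A < +oo ->
  mu.-integrable A (EFin \o f) ->
  avg mu A (fun y => `|(f y)%:E - avg mu A (EFin \o f)|) = (os mu f A)%:E.
Proof.
move=> mA A0 Aoo fA; rewrite avg_cnE// /avg.
rewrite (_ : \int[mu]_(x in A) `|(f x)%:E - (cn mu f A)%:E| =
   \int[mu]_(x in A) (`|f x - cn mu f A|)%:E); last first.
  by apply: eq_integral.
rewrite (int_osE mA A0 Aoo fA) (mu_fine Aoo).
have m0 := m_gt0 A0 Aoo; rewrite inver gt_eqF// -EFinM mulrCA mulVf ?mulr1//.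
by rewrite gt_eqF.
Qed.

Lemma dyadic_sharpE : dyadic_sharp mu Q f =
  (dsup Q (os mu f)) \_ [set x | forall n, cub Q n x x].
Proof.
have core x : (x \in dyadic_core Q) = (x \in [set x | forall n, cub Q n x x]).
  apply/idP/idP; rewrite !inE.
    by move=> h n; have [a _ ax] := h n Logic.I; exists a.
  by move=> h n _; have [a [ax _]] := h n; exists a.
apply/funext => x; rewrite /dyadic_sharp /patch core; case: ifPn => //.
rewrite inE => xx; congr ereal_sup; apply/seteqP; split => s.
  move=> [n [a [ax ->]]]; exists n => //; rewrite (cubP dc ax).
  have [mA _ A0 Aoo] := dc_cube dc a; rewrite avg_osE//.
  by rewrite -(cubP dc ax); exact: fint.
move=> [n _ <-]; have [a [ax _]] := xx n; exists n, a; split => //.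
have [mA _ A0 Aoo] := dc_cube dc a; rewrite (cubP dc ax) avg_osE//.
by rewrite -(cubP dc ax); exact: fint.
Qed.

End DyadicSharp.

Section WeightedFeffermanStein.
Context (R : realType) (d : measure_display) (T : measurableType d).
Variable mu : {measure set T -> \bar R}.
Context (X : set T) (rho : T -> T -> R) (K1 K2 : R).
Hypothesis ht : homogeneous_type mu X rho K1 K2.
Context (I : int -> Type) (Q : forall n : int, I n -> set T) (D M delta : R).
Hypothesis dc : dyadic_cubes mu Q X D.
Hypotheses (d01 : (0 < delta < 1)%R) (M0 : (0 < M)%R) (D1 : (1 <= D)%R).
Hypothesis cubB : forall n x, cub Q n x x -> cub Q n x `<=` qball X rho x (M * delta ^ n) /\
    mu (qball X rho x (M * delta ^ n)) <= D%:E * mu (cub Q n x).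
Context (W : T -> R) (kap : R).
Hypotheses (W0 : forall x, X x -> (0 <= W x)%R) (mW : measurable_fun X W).
Let wt (A : set T) := \int[mu]_(x in A) (W x)%:E.
Hypothesis kap1 : (1 <= kap)%R.
Hypothesis Wfin : forall n x, cub Q n x x -> wt (cub Q n x) < +oo.
Hypothesis Wc : forall n x (E : set T), cub Q n x x -> measurable E ->
  E `<=` cub Q n x -> mu (cub Q n x) <= 2%:E * mu E ->
  wt (cub Q n x) <= kap%:E * wt E.
Local Notation cub := (cub Q).
Let mX := dc_meas dc.

Let wtle A B : measurable A -> measurable B -> A `<=` B -> B `<=` X -> wt A <= wt B.
Proof. by move=> mA mB AB BX; exact: (wt_le dc W0 mW). Qed.

(* Otherwise all cubes around [x] have bounded weight, and the supremum S of
   these weights satisfies S <= (1 - 1/kap) S: a cube is a small part of a much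
   larger one. *)
Lemma bad_infinite (E : set T) x : X x -> mu X = +oo -> measurable E -> E `<=` X ->
  wt E < +oo -> (forall n y, cub n y y -> 0 < wt (cub n y)) ->
  exists n0 : int, forall n : int, (n <= n0)%R -> cub n x x ->
    2%:E * mu (cub n x `&` E) < mu (cub n x).
Proof.
move=> Xx Xoo mE EX Eoo Wpos; apply: contrapT => /forallNP nbad.
have bad n0 : exists n : int, [/\ (n <= n0)%R, cub n x x & mu (cub n x) <= 2%:E * mu (cub n x `&` E)].
  have /existsNP[n /not_implyP[nn0 /not_implyP[xx /negP]]] := nbad n0.
  by rewrite -leNgt => h; exists n.
have k0 : (0 < kap)%R by exact: lt_le_trans kap1.
have bound n : cub n x x -> wt (cub n x) <= kap%:E * wt E.
  move=> xx; have [m [mn mm mE2]] := bad n.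
  have [mA AX _ _] := cub_cube dc xx; have [mB BX _ _] := cub_cube dc mm.
  apply: (@le_trans _ _ (wt (cub m x))); first by apply: wtle => //; exact: (cub_mono dc mn).
  apply: (@le_trans _ _ (kap%:E * wt (cub m x `&` E))).
    by apply: Wc => //; [exact: measurableI].
  apply: lee_wpmul2l; first by rewrite lee_fin ltW.
  by apply: wtle => //; exact: measurableI.
pose S := ereal_sup [set wt (cub n x) | n in [set n | cub n x x]].
have S_ub n : cub n x x -> wt (cub n x) <= S by move=> xx; apply: ereal_sup_ubound; exists n.
have [n1 [_ xx1 _]] := bad 0%R.
have Spos : 0 < S by apply: lt_le_trans (S_ub _ xx1); exact: Wpos.
have Soo : S < +oo.
  apply: (@le_lt_trans _ _ (kap%:E * wt E)).
    by apply: ge_ereal_sup => _ [n xx <-]; exact: bound.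
  have Efin : wt E \is a fin_num.
    by rewrite ge0_fin_numE//; apply: integral_ge0 => y /EX Xy; rewrite lee_fin W0.
  by rewrite -(fineK Efin) -EFinM ltry.
have Sfin : S \is a fin_num by rewrite ge0_fin_numE// ltW.
have th0 : (0 <= 1 - kap^-1)%R by rewrite subr_ge0 invf_le1.
have : S <= (1 - kap^-1)%:E * S.
  apply: ge_ereal_sup => _ [m mm <-].
  have [mA AX A0 Aoo] := cub_cube dc mm.
  have Afin : mu (cub m x) \is a fin_num by rewrite ge0_fin_numE// ltW.
  have [n2 hn2] : exists n0 : int, forall n : int, (n <= n0)%R ->
      (2 * D)%:E * mu (cub m x) < mu (qball X rho x (M * delta ^ n)).
    apply: (qball_exhaust ht) => //.
    by rewrite Xoo -(fineK Afin) -EFinM ltry.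
  have [n [nn xx _]] := bad (Num.min n2 m).
  have nn2 : (n <= n2)%R by apply: (le_trans nn); rewrite ge_min lexx.
  have nm : (n <= m)%R by apply: (le_trans nn); rewrite ge_min lexx orbT.
  apply: (@le_trans _ _ ((1 - kap^-1)%:E * wt (cub n x))); last first.
    by apply: lee_wpmul2l => //; exact: S_ub.
  apply: (wt_small dc W0 mW kap1 Wfin Wc) => //; first exact: (cub_mono dc nm).
  have [_ hD] := cubB xx.
  have := le_trans (ltW (hn2 _ nn2)) hD.
  rewrite (mulrC 2%R) EFinM -muleA lee_pmul2l// lte_fin; exact: lt_le_trans D1.
rewrite -(fineK Sfin) -EFinM lee_fin; have : (0 < fine S)%R by rewrite fine_gt0// Spos.
have : (0 < kap^-1)%R by rewrite invr_gt0.
set a := fine S; set b := kap^-1%R => b0 a0 h.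
have : (0 < b * a)%R by exact: mulr_gt0.
have -> : (b * a = a - (1 - b) * a)%R by ring.
by rewrite subr_gt0 ltNge h.
Qed.

Lemma bad_finite (E : set T) x x0 r0 : X x -> X x0 -> (0 < r0)%R -> mu X < +oo ->
  measurable E -> E `<=` qball X rho x0 r0 ->
  mu (qball X rho x0 r0) <= (8 * D)^-1%:E * mu X ->
  exists n0 : int, forall n : int, (n <= n0)%R -> cub n x x ->
    2%:E * mu (cub n x `&` E) < mu (cub n x).
Proof.
move=> Xx Xx0 r00 Xoo mE EB hB.
have D0 : (0 < D)%R by exact: lt_le_trans D1.
have mB : measurable (qball X rho x0 r0) by apply: (measurable_qball ht).
have Xpos : 0 < mu X.
  apply: lt_le_trans (qball_gt0 ht Xx0 r00) _.
  by apply: le_measure; rewrite ?inE//; exact: qball_sub.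
have [v Ev] : exists v, mu X = v%:E.
  by exists (fine (mu X)); rewrite fineK// ge0_fin_numE// ltW.
have v0 : (0 < v)%R by rewrite -lte_fin -Ev.
have hv : (v / 2)%:E < mu X by rewrite Ev lte_fin ltr_pdivrMr// ltr_pMr// ltr1n.
have [n0 hn0] := qball_exhaust ht Xx M0 d01 hv.
exists n0 => n nn0 xx.
have [mA AX A0 Aoo] := cub_cube dc xx.
have [_ hD] := cubB xx.
have h1 := le_lt_trans (lexx _) (lt_le_trans (hn0 n nn0) hD).
apply: (@le_lt_trans _ _ (2%:E * ((8 * D)^-1%:E * mu X))).
  apply: lee_wpmul2l => //; apply: le_trans hB.
  by apply: le_measure; rewrite ?inE//; [exact: measurableI|move=> y [_ /EB]].
have Afin : mu (cub n x) \is a fin_num by rewrite ge0_fin_numE// ltW.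
move: h1; rewrite Ev -(fineK Afin) -!EFinM !lte_fin; set m := fine _ => h1.
rewrite -(ltr_pM2l D0); apply: le_lt_trans h1.
have -> : (D * (2 * ((8 * D)^-1 * v)) = v / 4)%R by field; rewrite gt_eqF.
lra.
Qed.

Context (f : T -> R) (s : R).
Hypotheses (s0 : (0 < s)%R) (floc : L1loc mu X rho f).

Let mf : measurable_fun X f. Proof. by have [] := floc. Qed.

Let fint n x : cub n x x -> mu.-integrable (cub n x) (EFin \o f).
Proof.
move=> xx; have [mA AX _ _] := cub_cube dc xx; have [cB _] := cubB xx.
have Xx := AX _ xx.
have r0 : (0 < M * delta ^ n)%R by rewrite mulr_gt0// exprz_gt0//; case/andP: d01.
have [_ h] := floc; apply: integrableS (h x _ Xx r0) => //.
exact: (measurable_qball ht).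
Qed.

Hypothesis full : forall n, mu (X `\` \bigcup_(a in [set: I n]) Q a) = 0.
Hypothesis fs : \int[mu]_(x in X) (`|(f x)%:E| `^ s * (W x)%:E) < +oo.
Hypothesis alternative : mu X = +oo \/
   exists (x0 : T) (r0 : R),
     [/\ X x0, (0 < r0)%R, X `&` [set x | f x != 0%R] `<=` qball X rho x0 r0 &
         mu (qball X rho x0 r0) <= (8 * D)^-1%:E * mu X].
Hypothesis Wpos : forall n y, cub n y y -> 0 < wt (cub n y).

Let mW' : measurable_fun X (EFin \o W). Proof. exact/measurable_EFinP. Qed.
Let W0' x : X x -> 0 <= (W x)%:E. Proof. by move=> Xx; rewrite lee_fin W0. Qed.

Let mnf : measurable_fun X (fun x => (`|f x|)%:E).
Proof. by apply/measurable_EFinP; exact: (measurableT_comp (@normr_measurable R setT)). Qed.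

Let large l := X `&` [set y | (l <= `|f y|)%R].

Let mlarge l : measurable (large l).
Proof.
rewrite (_ : large l = X `&` [set x | l%:E <= (`|f x|)%:E]).
  exact: emeasurable_fun_c_infty.
by apply/seteqP; split => x /=; rewrite lee_fin.
Qed.

Lemma bad (l : R) x : (0 < l)%R -> X x ->
  (forall n0 : int, exists2 n, (n <= n0)%R & (l < av mu f (cub n x))%R) ->
  (l / 8)%:E <= dsup Q (os mu f) x.
Proof.
move=> l0 Xx h.
have [n0 hn0] : exists n0 : int, forall n : int, (n <= n0)%R -> cub n x x ->
    2%:E * mu (cub n x `&` large (l / 2)%R) < mu (cub n x).
  have l20 : (0 < l / 2)%R by exact: divr_gt0.
  have [Xoo|Xfin] := eqVneq (mu X) +oo.
    apply: bad_infinite => //; first by move=> y [].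
    have ls0 : (0 < (l / 2) `^ s)%R by exact: powR_gt0.
    have : ((l / 2) `^ s)%:E * wt (large (l / 2)%R) < +oo.
      apply: le_lt_trans fs.
      have <- : \int[mu]_(y in large (l / 2)%R) (((l / 2) `^ s)%:E * (W y)%:E) =
          ((l / 2) `^ s)%:E * wt (large (l / 2)%R).
        apply: ge0_integralZl_EFin => //.
        - by move=> y [Xy _]; exact: W0'.
        - by apply: measurable_funS mW' => // y [].
        - exact: ltW.
      have mF : measurable_fun X (fun y => `|(f y)%:E| `^ s * (W y)%:E).
        exact: (measurable_poweR_w mW').
      apply: (@le_trans _ _ (\int[mu]_(y in large (l / 2)%R) (`|(f y)%:E| `^ s * (W y)%:E))).
        apply: ge0_le_integral => //.
        - by move=> y [Xy _]; apply: mule_ge0; [rewrite lee_fin ltW|exact: W0'].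
        - by apply: measurable_funeM; apply: measurable_funS mW' => // y [].
        - by apply: measurable_funS mF => // y [].
        move=> y [Xy /= fy]; apply: lee_wpmul2r; first exact: W0'.
        by rewrite lee_fin le_powR// ltW.
      apply: ge0_subset_integral => //; last by move=> y [].
      by move=> y Xy; apply: mule_ge0; [exact: poweR_ge0|exact: W0'].
    move=> hl; rewrite ltNge leye_eq; apply/negP => /eqP e.
    by move: hl; rewrite e gt0_muley ?lte_fin// ltxx.
  case: alternative => [Xoo|[x0 [r0 [Xx0 r00 supp hB]]]]; first by rewrite Xoo eqxx in Xfin.
  apply: (@bad_finite _ x x0 r0) => //; first by rewrite ltey.
  move=> y [Xy /= fy]; apply: supp; split => //=; apply/eqP => fy0.
  by move: fy; rewrite fy0 normr0 leNgt l20.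
apply: (bad_point dc fint l0 (n0 := n0)) => // n nn0 xx.
have := hn0 n nn0 xx; rewrite /large setIA (@setIidl _ (cub n x) X)//.
by have [] := cub_cube dc xx.
Qed.

Let mMf : measurable_fun X (dsup Q (av mu f)) := measurable_Mf dc f.

Let msh : measurable_fun X (dsup Q (os mu f)).
Proof. by apply: (measurable_dsup dc) => [A|]; [exact: os_ge0|exact: os_set0]. Qed.

Let Mf0 x : X x -> 0 <= dsup Q (av mu f) x.
Proof. by move=> _; apply: dsup_ge0; exact: av_ge0. Qed.

Let sh0 x : X x -> 0 <= dsup Q (os mu f) x.
Proof. by move=> _; apply: dsup_ge0; exact: os_ge0. Qed.

Lemma weighted_sharp_Mf (b g : R) : (1 < b)%R -> (0 < g < 8^-1)%R ->
  (g * (2 + D) <= b - 1)%R -> (b `^ s * (1 - kap^-1) < 1)%R ->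
  \int[mu]_(x in X) (dsup Q (av mu f) x `^ s * (W x)%:E) <=
  (b `^ s * (b `^ s * (b `^ s / (b `^ s - 1) / g `^ s) / (1 - b `^ s * (1 - kap^-1))))%:E *
  \int[mu]_(x in X) (dsup Q (os mu f) x `^ s * (W x)%:E).
Proof.
move=> b1 g8 gD bs; have /andP[g0 _] := g8.
have th0 : (0 <= 1 - kap^-1)%R by rewrite subr_ge0 invf_le1// (lt_le_trans _ kap1).
apply: (good_lambda_integral (v := fun x => (`|f x|)%:E) (kap := kap) mX W0' mW' b1 s0
  mMf mnf msh Mf0 _ sh0 th0 bs _ g0) => //.
- exact: le_trans kap1.
- by move=> l l0; exact: (good_lambda_level dc fint W0 mW kap1 Wfin Wc bad b1 g8 gD l0).
- move=> l l0; apply: (le_trans (apriori_level dc mf fint W0 mW kap1 Wc bad l0)).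
  apply: leeD.
    apply: lee_wpmul2l; first by rewrite lee_fin (le_trans _ kap1).
    apply: wtle; [exact: mlarge|exact: emeasurable_fun_o_infty| |by move=> x []].
    by move=> x [Xx /= h]; split => //=; rewrite lte_fin; lra.
  apply: wtle; [exact: emeasurable_fun_c_infty|exact: emeasurable_fun_o_infty| |by move=> x []].
  move=> x [Xx /= h]; split => //=; apply: lt_le_trans h; rewrite lte_fin; lra.
Qed.

Lemma weighted_sharp (b g : R) : (1 < b)%R -> (0 < g < 8^-1)%R ->
  (g * (2 + D) <= b - 1)%R -> (b `^ s * (1 - kap^-1) < 1)%R ->
  \int[mu]_(x in X) (`|(f x)%:E| `^ s * (W x)%:E) <=
  (b `^ s * (b `^ s * (b `^ s / (b `^ s - 1) / g `^ s) / (1 - b `^ s * (1 - kap^-1))))%:E *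
  \int[mu]_(x in X) (dyadic_sharp mu Q f x `^ s * (W x)%:E).
Proof.
move=> b1 g8 gD bs.
have -> : \int[mu]_(x in X) (dyadic_sharp mu Q f x `^ s * (W x)%:E) =
    \int[mu]_(x in X) (dsup Q (os mu f) x `^ s * (W x)%:E).
  rewrite (dyadic_sharpE dc fint).
  have mc := measurable_cubs dc.
  apply: ge0_ae_eq_integral => //.
  - by apply: measurable_poweR_w => //; exact: measurable_patch.
  - exact: measurable_poweR_w.
  - by move=> x Xx; apply: mule_ge0; [exact: poweR_ge0|exact: W0'].
  - by move=> x Xx; apply: mule_ge0; [exact: poweR_ge0|exact: W0'].
  apply: negligibleS (negligible_core dc full) => x /not_implyP[Xx h]; split => // xx.
  by apply: h; rewrite /patch mem_set.
apply: le_trans (weighted_sharp_Mf b1 g8 gD bs).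
apply: ae_ge0_le_integral => //.
- by move=> x Xx; apply: mule_ge0; [exact: poweR_ge0|exact: W0'].
- exact: (measurable_poweR_w mW').
- by move=> x Xx; apply: mule_ge0; [exact: poweR_ge0|exact: W0'].
- exact: (measurable_poweR_w mW').
have := ae_le_Mf ht dc d01 M0 cubB full mf fint.
apply: filterS => x h Xx; apply: lee_wpmul2r; first exact: W0'.
by apply: le_poweR; [exact: ltW| |exact: h].
Qed.

End WeightedFeffermanStein.

Lemma exists_base (R : realType) (kap s : R) : (1 <= kap)%R -> (0 < s)%R ->
  exists2 b : R, (1 < b)%R & (b `^ s * (1 - kap^-1) < 1)%R.
Proof.
move=> k1 s0; have k0 : (0 < kap)%R by exact: lt_le_trans k1.
pose t : R := kap^-1%R; have t0 : (0 < t)%R by rewrite invr_gt0.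
have t1 : (t <= 1)%R by rewrite invf_le1.
exists ((1 + t) `^ s^-1)%R.
  rewrite -[ltLHS](congr1 (@^~ s^-1%R) (powR1 R)) gt0_ltr_powR ?nnegrE ?invr_gt0//; lra.
rewrite -powRrM mulVf ?gt_eqF// powRr1; last lra.
rewrite -/t; have : (0 < t * t)%R by rewrite mulr_gt0.
lra.
Qed.

Theorem weighted_fefferman_stein (R : realType) (K1 K2 delta eps0 N0 : R)
    (hdelta : (0 < delta < 1)%R) (heps0 : (0 < eps0)%R) :
  exists2 eps : R, (0 < eps)%R & forall P K s : R, (1 < P)%R -> (0 < s)%R ->
  exists2 N : R, (0 < N)%R &
  forall (d : measure_display) (T : measurableType d) (mu : {measure set T -> \bar R})
    (X : set T) (rho : T -> T -> R) (I : int -> Type) (Q : forall n : int, I n -> set T)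
    (W f : T -> R),
  homogeneous_type mu X rho K1 K2 -> dyadic_filtration mu X rho delta eps0 N0 Q ->
  Ap_weight mu X rho P W -> Ap_const mu X rho P W <= K%:E ->
  L1loc mu X rho f ->
  \int[mu]_(x in X) (`|(f x)%:E| `^ s * (W x)%:E) < +oo ->
  (mu X = +oo \/
   exists (x0 : T) (r0 : R),
     [/\ X x0, (0 < r0)%R, X `&` [set x | f x != 0%R] `<=` qball X rho x0 r0 &
         mu (qball X rho x0 r0) <= eps%:E * mu X]) ->
  \int[mu]_(x in X) (`|(f x)%:E| `^ s * (W x)%:E) <=
    N%:E * \int[mu]_(x in X) (dyadic_sharp mu Q f x `^ s * (W x)%:E).
Proof.
have [M [D [M0 D1 hD]]] := dyadic_constant K1 K2 N0 hdelta heps0.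
have D0 : (0 < D)%R by exact: lt_le_trans D1.
exists (8 * D)^-1%R; first by rewrite invr_gt0 mulr_gt0.
move=> P K s P1 s0.
have D20 : (0 < D * 2)%R by rewrite mulr_gt0.
have [kap kap1 hkap] := Ap_large_constant K P1 D20.
have [b b1 bs] := exists_base kap1 s0.
pose g : R := (Num.min 16^-1 ((b - 1) / (2 + D)))%R.
have D20' : (0 < 2 + D)%R by lra.
have g0 : (0 < g)%R by rewrite lt_min invr_gt0 ltr0n/= divr_gt0// subr_gt0.
have g8 : (0 < g < 8^-1)%R.
  rewrite g0/= gt_min; apply/orP; left; lra.
have gD : (g * (2 + D) <= b - 1)%R.
  by rewrite -ler_pdivlMr// ge_min lexx orbT.
exists (b `^ s * (b `^ s * (b `^ s / (b `^ s - 1) / g `^ s) / (1 - b `^ s * (1 - kap^-1))))%R.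
  have bs0 : (0 < b `^ s)%R by rewrite powR_gt0// (lt_trans _ b1).
  have bs1 : (1 < b `^ s)%R := powR_gt1 b1 s0.
  rewrite mulr_gt0// divr_gt0 ?subr_gt0// mulr_gt0// divr_gt0 ?powR_gt0//.
  by rewrite divr_gt0// subr_gt0.
move=> d T mu X rho I Q W f ht df AW AK floc fs alt.
have [dc cubB] := hD _ _ _ _ _ _ _ ht df.
have [W0 mW _] := AW.
have mX := ht_measurable ht.
have r0 n : (0 < M * delta ^ n)%R by rewrite mulr_gt0// exprz_gt0//; case/andP: hdelta.
have W0' x : X x -> 0 <= (W x)%:E by move=> Xx; rewrite lee_fin W0.
have mW' : measurable_fun X (EFin \o W) by exact/measurable_EFinP.
have Wfin n x : cub Q n x x -> \int[mu]_(y in cub Q n x) (W y)%:E < +oo.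
  move=> xx; have [mA AX _ _] := cub_cube dc xx; have [cB _] := cubB _ _ xx.
  have K'1 : (1 <= Num.max K 1)%R by rewrite le_max lexx orbT.
  have AK' : Ap_const mu X rho P W <= ((Num.max K 1)%R)%:E.
    by apply: (le_trans AK); rewrite lee_fin le_max lexx.
  apply: le_lt_trans (Ap_ball_fin ht P1 AW AK' (AX _ xx) (r0 n)).
  apply: ge0_subset_integral => //.
  - by apply: (measurable_qball ht) => //; exact: AX.
  - by apply: measurable_funS mW' => // y [].
  - by move=> y [/W0'].
have Wc n x (E : set T) : cub Q n x x -> measurable E -> E `<=` cub Q n x ->
    mu (cub Q n x) <= 2%:E * mu E ->
    \int[mu]_(y in cub Q n x) (W y)%:E <= kap%:E * \int[mu]_(y in E) (W y)%:E.
  move=> xx mE EA hE; have [mA AX _ _] := cub_cube dc xx; have [cB muB] := cubB _ _ xx.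
  apply: (@le_trans _ _ (\int[mu]_(y in qball X rho x (M * delta ^ n)) (W y)%:E)).
    apply: ge0_subset_integral => //.
    - by apply: (measurable_qball ht) => //; exact: AX.
    - by apply: measurable_funS mW' => // y [].
    - by move=> y [/W0'].
  apply: (hkap _ _ _ _ _ _ _ _ ht AW AK) => //; first exact: AX.
    exact: subset_trans cB.
  apply: (le_trans muB); rewrite EFinM -muleA; apply: lee_wpmul2l => //.
  by rewrite lee_fin ltW.
have [Wpos|] := pselect (forall n y, cub Q n y y -> 0 < \int[mu]_(x in cub Q n y) (W x)%:E).
  by apply: (weighted_sharp ht dc hdelta M0 D1 cubB W0 mW kap1 Wfin Wc s0 floc (df_full df)).
move=> /existsNP[n /existsNP[x /not_implyP[xx /negP]]]; rewrite -leNgt => hle.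
have [mA AX A0 Aoo] := cub_cube dc xx; have [cB _] := cubB _ _ xx.
have Xx := AX _ xx.
have WX0 := Ap_degenerate ht P1 AW AK Xx (r0 n) mA cB A0 hle.
have mf : measurable_fun X (fun x => `|(f x)%:E| `^ s).
  have [mf _] := floc.
  apply: (measurableT_comp (measurable_poweR s)); apply/measurable_EFinP.
  exact: (measurableT_comp (@normr_measurable R setT)).
rewrite (integral_eq0_mul mX mW' mf W0' WX0); apply: mule_ge0; last first.
  by apply: integral_ge0 => y Xy; apply: mule_ge0; [exact: poweR_ge0|exact: W0'].
have bs0 : (0 < b `^ s)%R by rewrite powR_gt0// (lt_trans _ b1).
have bs1 : (1 < b `^ s)%R := powR_gt1 b1 s0.
rewrite lee_fin mulr_ge0 ?(ltW bs0)// divr_ge0//; last by rewrite subr_ge0 ltW.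
rewrite mulr_ge0 ?(ltW bs0)// divr_ge0 ?powR_ge0// divr_ge0 ?(ltW bs0)//.
by rewrite subr_ge0 ltW.
Qed.

(** * Tonelli's theorem for the completed product *)

Section Completion.
Context (R : realType) (d : measure_display) (T : measurableType d).
Variable m : {measure set T -> \bar R}.
Hypothesis sm : sigma_finite [set: T] m.
Let mc := @completed_measure_extension d T R m.

Lemma outer_hull (E : set T) : (m^*)%mu E < +oo -> exists B : set T,
  [/\ measurable B, E `<=` B & m B = (m^*)%mu E].
Proof.
move=> Eoo.
have Efin : (m^*)%mu E \is a fin_num by rewrite ge0_fin_numE// mu_ext_ge0.
have cov n : exists B : set T, [/\ measurable B, E `<=` B & m B <= (m^*)%mu E + (n.+1%:R^-1)%:E].
  have e0 : (0 < n.+1%:R^-1 :> R)%R by rewrite invr_gt0.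
  have [_ [F [mF EF] <-] hF] := lb_ereal_inf_adherent e0 Efin.
  exists (\bigcup_k F k); split => //; first exact: bigcup_measurable.
  apply: le_trans (ltW hF); apply: measure_sigma_subadditive => //.
  exact: bigcup_measurable.
have [F hF] := choice cov.
pose B := \bigcap_n F n.
have mB : measurable B by apply: bigcap_measurable => // n _; have [] := hF n.
have EB : E `<=` B by move=> x Ex n _; have [_ + _] := hF n; exact.
exists B; split => //; apply/eqP; rewrite eq_le; apply/andP; split.
  apply/lee_addgt0Pr => e e0.
  have [n hn] : exists n, (n.+1%:R^-1 < e)%R.
    exists (Num.trunc e^-1); rewrite -[ltRHS]invrK ltf_pV2 ?posrE ?invr_gt0//.
    exact: truncnS_gt.
  have [mFn _ h] := hF n.
  apply: (@le_trans _ _ (m (F n))).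
    by apply: le_measure; rewrite ?inE//; exact: bigcap_inf.
  by apply: (le_trans h); rewrite leeD2l// lee_fin ltW.
by rewrite -(measurable_mu_extE m mB); exact: le_mu_ext.
Qed.

Lemma outer_null (E : set T) : (m^*)%mu E = 0 ->
  exists B : set T, [/\ measurable B, E `<=` B & m B = 0].
Proof. by move=> E0; have [|B []] := @outer_hull E; rewrite E0//; exists B. Qed.

Lemma measurable_completed (A : set T) : measurable A ->
  measurable (A : set (caratheodory_type (m^*)%mu)).
Proof. exact: caratheodory_measurable_mu_ext. Qed.

Lemma completed_hull (E : set (caratheodory_type (m^*)%mu)) : measurable E ->
  exists B N : set T, [/\ measurable B, measurable N, m N = 0, E `<=` B & B `\` E `<=` N].
Proof.
move=> mE; have [F FT hF] := sm.
have fin k : exists BN : set T * set T, [/\ measurable BN.1, measurable BN.2, m BN.2 = 0,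
    E `&` F k `<=` BN.1 & BN.1 `\` (E `&` F k) `<=` BN.2].
  have [mFk Fkoo] := hF k.
  have mEF : measurable (E `&` F k : set (caratheodory_type (m^*)%mu)).
    by apply: measurableI => //; exact: measurable_completed.
  have EFoo : (m^*)%mu (E `&` F k) < +oo.
    apply: le_lt_trans Fkoo; rewrite -(measurable_mu_extE m mFk); exact: le_mu_ext.
  have [B [mB EB muB]] := outer_hull EFoo.
  have h := mEF B.
  have {h} : m B = (m^*)%mu (E `&` F k) + (m^*)%mu (B `\` (E `&` F k)).
    by rewrite -(measurable_mu_extE m mB) h (setIidr EB) setDE.
  have EFfin : (m^*)%mu (E `&` F k) \is a fin_num by rewrite ge0_fin_numE// mu_ext_ge0.
  rewrite muB => /(congr1 (fun z => z - (m^*)%mu (E `&` F k))).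
  rewrite addeAC subee// add0e => /esym h.
  by have [N [mN BN N0]] := outer_null h; exists (B, N).
have [BN hBN] := choice fin.
exists (\bigcup_k (BN k).1), (\bigcup_k (BN k).2); split.
- by apply: bigcup_measurable => k _; have [] := hBN k.
- by apply: bigcup_measurable => k _; have [] := hBN k.
- apply: measure_negligible; first by apply: bigcup_measurable => k _; have [] := hBN k.
  by apply: negligible_bigcup => k; apply/negligibleP; have [] := hBN k.
- move=> x Ex; have : [set: T] x by [].
  by rewrite FT => -[k _ Fx]; exists k => //; have [_ _ _ + _] := hBN k; exact.
- move=> x [[k _ Bx] nEx]; exists k => //; have [_ _ _ _] := hBN k; apply.
  by split => // -[].
Qed.

Lemma completed_function (phi : caratheodory_type (m^*)%mu -> \bar R) :
  measurable_fun setT phi -> (forall x, 0 <= phi x) ->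
  exists (psi : T -> \bar R) (N : set T), [/\ measurable_fun setT psi,
    (forall x, 0 <= psi x), measurable N, m N = 0 & forall x, ~ N x -> phi x = psi x].
Proof.
move=> mphi phi0.
pose E (q : rat) : set (caratheodory_type (m^*)%mu) := setT `&` [set x | (ratr q : R)%:E < phi x].
have mE q : measurable (E q) by exact: emeasurable_fun_o_infty.
have hull q : exists BN : set T * set T, [/\ measurable BN.1, measurable BN.2, m BN.2 = 0,
    E q `<=` BN.1 & BN.1 `\` E q `<=` BN.2].
  by have [B [N h]] := completed_hull (mE q); exists (B, N).
have [BN hBN] := choice hull.
pose N := \bigcup_q (BN q).2.
pose psi0 x := ereal_sup [set (ratr q : R)%:E | q in [set q | (BN q).1 x]].
have mpsi0 : measurable_fun setT psi0.
  apply: emeasurable_fun_gt => t; rewrite setTI.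
  have -> : [set x | t%:E < psi0 x] = \bigcup_q (if (t < ratr q)%R then (BN q).1 else set0).
    apply/seteqP; split => x.
      by move=> /ereal_sup_gt[_ [q Bq <-]]; rewrite lte_fin => tq; exists q => //; rewrite tq.
    move=> [q _]; case: ifP => // tq Bq.
    apply: (@lt_le_trans _ _ (ratr q : R)%:E); first by rewrite lte_fin.
    by apply: ereal_sup_ubound; exists q.
  by apply: measurable_bigcup_countType => q; case: ifP => // _; have [] := hBN q.
exists (fun x => maxe (psi0 x) 0), N; split.
- by apply: measurable_maxe.
- by move=> x; rewrite le_max lexx orbT.
- by apply: measurable_bigcup_countType => q; have [] := hBN q.
- apply: measure_negligible; first by apply: measurable_bigcup_countType => q; have [] := hBN q.
  by apply: negligible_bigcup_countType => q; apply/negligibleP; have [] := hBN q.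
move=> x nN.
have Bq q : (BN q).1 x <-> (ratr q : R)%:E < phi x.
  have [_ _ _ h1 h2] := hBN q; split; last by move=> h; exact: h1.
  move=> Bx; apply: contrapT => h; apply: nN; exists q => //; apply: h2; split => //.
  by move=> [_].
have -> : psi0 x = phi x.
  apply/eqP; rewrite eq_le; apply/andP; split.
    by apply: ge_ereal_sup => _ [q /Bq /ltW h <-].
  have := phi0 x; case E1 : (phi x) => [r| |]// r0.
    apply/lee_subgt0Pr => e e0; rewrite -EFinB.
    have : (r - e < r)%R by rewrite gtrBl.
    move=> /rat_in_itvoo[q]; rewrite in_itv /= => /andP[h1 h2].
    apply: (@le_trans _ _ (ratr q : R)%:E); first by rewrite lee_fin ltW.
    by apply: ereal_sup_ubound; exists q => //; apply/Bq; rewrite E1 lte_fin.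
  rewrite leye_eq; apply/eqP/eqyP => A A0.
  have : (A < A + 1)%R by rewrite ltrDl.
  move=> /rat_in_itvoo[q]; rewrite in_itv /= => /andP[h1 h2].
  apply: (@le_trans _ _ (ratr q : R)%:E); first by rewrite lee_fin ltW.
  by apply: ereal_sup_ubound; exists q => //; apply/Bq; rewrite E1 ltry.
by rewrite max_l.
Qed.

Lemma measurable_fun_completed (psi : T -> \bar R) : measurable_fun setT psi ->
  measurable_fun setT (psi : caratheodory_type (m^*)%mu -> \bar R).
Proof.
move=> mpsi _ Y mY; rewrite setTI.
by apply: measurable_completed; have := mpsi measurableT Y mY; rewrite setTI.
Qed.

Lemma integral_completed (psi : T -> \bar R) : measurable_fun setT psi ->
  (forall x, 0 <= psi x) -> \int[mc]_x psi x = \int[m]_x psi x.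
Proof.
move=> mpsi psi0.
pose i : caratheodory_type (m^*)%mu -> T := id.
have mi : measurable_fun setT i.
  by move=> _ Y mY; rewrite setTI; exact: measurable_completed.
have := @ge0_integral_pushforward _ _ _ _ R i mi mc setT psi measurableT mpsi (fun x _ => psi0 x).
rewrite preimage_setT => <-.
by apply: eq_measure_integral => A mA _; rewrite /pushforward /mc /=; exact: measurable_mu_extE.
Qed.

End Completion.

Lemma sigma_finite_product (R : realType) (d1 d2 : measure_display)
    (T1 : measurableType d1) (T2 : measurableType d2)
    (mu1 : {sigma_finite_measure set T1 -> \bar R})
    (mu2 : {sigma_finite_measure set T2 -> \bar R}) :
  sigma_finite setT (mu1 \x mu2).
Proof.
have [F TF mF] := sigma_finiteT mu1; have [G TG mG] := sigma_finiteT mu2.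
exists (fun k => if @choice.unpickle (nat * nat)%type k is Some (i, j) then F i `*` G j else set0).
  apply/esym/seteqP; split => // -[x y] _.
  have [i _ Fx] : (\bigcup_i F i) x by rewrite -TF.
  have [j _ Gy] : (\bigcup_j G j) y by rewrite -TG.
  by exists (choice.pickle (i, j)) => //; rewrite choice.pickleK.
move=> k; case: choice.unpickle => [[i j]|]; last by rewrite measure0.
have [mFi Foo] := mF i; have [mGj Goo] := mG j; split; first exact: measurableX.
by rewrite product_measure1E// lte_mul_pinfty// ge0_fin_numE.
Qed.

Section TonelliCompleted.
Context (R : realType) (d1 d2 : measure_display)
  (T1 : measurableType d1) (T2 : measurableType d2).
Variables (mu1 : {sigma_finite_measure set T1 -> \bar R})
          (mu2 : {sigma_finite_measure set T2 -> \bar R}).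
Hypothesis cmu1 : forall A, mu1.-negligible A -> measurable A.
Hypothesis cmu2 : forall A, mu2.-negligible A -> measurable A.
Let m : {measure set (T1 * T2) -> \bar R} := mu1 \x mu2.
Let cT := caratheodory_type (m^*)%mu.

Lemma tonelli_completed (phi : cT -> \bar R) (v : T2 -> \bar R) :
  measurable_fun setT phi -> (forall x, 0 <= phi x) ->
  measurable_fun setT v -> (forall x, 0 <= v x) ->
  measurable_fun setT (fun x2 => \int[mu1]_x1 phi (x1, x2)) /\
  \int[completed_product mu1 mu2]_x (phi x * v x.2) =
  \int[mu2]_x2 ((\int[mu1]_x1 phi (x1, x2)) * v x2).
Proof.
move=> mphi phi0 mv v0.
have sm := sigma_finite_product mu1 mu2.
have [psi [N [mpsi psi0 mN N0 phiN]]] := completed_function sm mphi phi0.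
have ysE x2 : ysection N x2 = [set x1 | N (x1, x2)].
  by rewrite /ysection; apply/seteqP; split => z /=; [move/set_mem|exact: mem_set].
have Nsec : {ae mu2, forall x2, mu1 [set x1 | N (x1, x2)] = 0}.
  have mI : measurable_fun setT (fun x => (\1_N x : R)%:E).
    exact/measurable_EFinP/measurable_indic.
  have I0 x : 0 <= (\1_N x : R)%:E by rewrite lee_fin.
  have h : \int[mu2]_x2 `|\int[mu1]_x1 (\1_N (x1, x2) : R)%:E| = 0.
    transitivity (\int[mu2]_x2 \int[mu1]_x1 (\1_N (x1, x2) : R)%:E).
      by apply: eq_integral => x2 _; rewrite gee0_abs//; exact: integral_ge0.
    rewrite -(@fubini_tonelli2 _ _ _ _ _ mu1 mu2 _ mI I0) integral_indic// setIT//.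
  have mG := @measurable_fun_fubini_tonelli_G _ _ _ _ R mu1 (fun x => (\1_N x : R)%:E) mI I0.
  move/(ae_eq_integral_abs mu2 measurableT mG) : h.
  apply: filterS => x2 /(_ I); rewrite /fubini_G /= => <-.
  rewrite (_ : (fun x1 => (\1_N (x1, x2))%:E) = (fun x1 => (\1_[set x1 | N (x1, x2)] x1 : R)%:E)).
    rewrite integral_indic ?setIT//.
    by rewrite -ysE; exact: measurable_ysection.
  apply/funext => x1; rewrite !indicE; congr ((nat_of_bool _)%:R%:E).
have sec_psi x2 : measurable_fun setT (fun x1 => psi (x1, x2)).
  apply: (measurableT_comp mpsi); apply: measurable_fun_pair => //.
have sec_ae x2 : mu1 [set x1 | N (x1, x2)] = 0 ->
    \int[mu1]_x1 phi (x1, x2) = \int[mu1]_x1 psi (x1, x2).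
  move=> h; have mS : measurable [set x1 | N (x1, x2)].
    by rewrite -ysE; exact: measurable_ysection.
  have e : ae_eq mu1 setT (fun x1 => psi (x1, x2)) (fun x1 => phi (x1, x2)).
    exists [set x1 | N (x1, x2)]; split => // x1 /= hx; apply: contrapT => nN; apply: hx => _.
    by rewrite phiN.
  have mp : measurable_fun setT (fun x1 => phi (x1, x2)).
    exact: (ae_measurable_fun cmu1 e (sec_psi x2)).
  by apply: ge0_ae_eq_integral => //; exact: ae_eq_sym.
have G_ae : ae_eq mu2 setT (fun x2 => \int[mu1]_x1 psi (x1, x2)) (fun x2 => \int[mu1]_x1 phi (x1, x2)).
  by apply: filterS Nsec => x2 h _; rewrite sec_ae.
have mGpsi : measurable_fun setT (fun x2 => \int[mu1]_x1 psi (x1, x2)).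
  exact: measurable_fun_fubini_tonelli_G.
have mGphi : measurable_fun setT (fun x2 => \int[mu1]_x1 phi (x1, x2)).
  exact: (ae_measurable_fun cmu2 G_ae mGpsi).
split => //.
have mv2 : measurable_fun setT (fun x : T1 * T2 => v x.2).
  by apply: (measurableT_comp mv).
have mpv : measurable_fun setT (fun x : T1 * T2 => psi x * v x.2) by exact: emeasurable_funM.
have pv0 x : 0 <= psi x * v x.2 by apply: mule_ge0.
transitivity (\int[completed_product mu1 mu2]_x (psi x * v x.2)).
  apply: ge0_ae_eq_integral.
  - exact: measurableT.
  - apply: emeasurable_funM; [exact: mphi|exact: (@measurable_fun_completed _ _ _ m _ mv2)].
  - exact: (@measurable_fun_completed _ _ _ m _ mpv).
  - by move=> x _; apply: mule_ge0; [exact: phi0|exact: v0].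
  - by move=> x _; exact: pv0.
  exists N; split.
  - exact: measurable_completed.
  - have := measurable_mu_extE m mN; by rewrite N0.
  - by move=> x /= hx; apply: contrapT => nN; apply: hx => _; rewrite phiN.
rewrite (integral_completed m mpv pv0) (@fubini_tonelli2 _ _ _ _ _ mu1 mu2 _ mpv pv0).
have e2 : ae_eq mu2 setT (fun x2 => (\int[mu1]_x1 psi (x1, x2)) * v x2) (fun x2 => (\int[mu1]_x1 phi (x1, x2)) * v x2).
  by apply: filterS G_ae => x2 h /h ->.
rewrite /fubini_G /=.
transitivity (\int[mu2]_x2 ((\int[mu1]_x1 psi (x1, x2)) * v x2)).
  apply: eq_integral => x2 _; rewrite ge0_integralZr//.
apply: ge0_ae_eq_integral => //.
- exact: emeasurable_funM.
- exact: emeasurable_funM.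
- by move=> x2 _; apply: mule_ge0 => //; exact: integral_ge0.
- by move=> x2 _; apply: mule_ge0 => //; exact: integral_ge0.
Qed.

End TonelliCompleted.

(** * Maximal functions and A_1 majorants *)

Section CountableBase.
Context (R : realType) (d : measure_display) (T : measurableType d).
Variable mu : {measure set T -> \bar R}.
Context (rho : T -> T -> R) (K1 K2 : R).
Hypothesis ht : homogeneous_type mu setT rho K1 K2.
Local Notation B := (qball setT rho).
Let K := Num.max K1 1%R.
Let K0 : (0 < K)%R. Proof. by rewrite lt_max ltr01 orbT. Qed.

Lemma countable_net (e : R) : (0 < e)%R ->
  exists D : set T, countable D /\ forall x, exists2 y, D y & (rho x y < e)%R.
Proof.
move=> e0; pose r : R := (e / (2 * K))%R.
have r0 : (0 < r)%R by rewrite divr_gt0// mulr_gt0.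
have [D [_ tD maxD]] := ex_maximal_disjoint_subcollection (fun x => B x r) setT.
exists D; split.
  have tI : trivIset [set B x r | x in D] id.
    by move=> _ _ [x Dx <-] [y Dy <-] h; rewrite (tD x y Dx Dy h).
  have cI : countable [set B x r | x in D].
    apply: (@countable_disjoint_positive _ _ _ mu _ setT) => //.
      exact: (finite_cover_homogeneous ht).
    move=> _ [x Dx <-]; split => //; first exact: (measurable_qball ht).
    exact: (qball_gt0 ht).
  move/countable_injP : cI => [g ginj]; apply/countable_injP.
  exists (fun x => g (B x r)) => x y; rewrite !inE => Dx Dy /ginj h.
  have e1 : B x r = B y r by apply: h; rewrite inE; [exists x|exists y].
  by apply: tD => //; exists x; rewrite /= -e1; split; exact: (qball_self ht).
move=> x.
have [y Dy [z [[_ xz] [_ yz]]]] : exists2 y, D y & (B x r `&` B y r) !=set0.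
  apply: contrapT => h.
  have hD y : D y -> B x r `&` B y r = set0.
    by move=> Dy; apply: contrapT => /eqP/set0P h1; apply: h; exists y.
  have nDx : ~ D x.
    move=> Dx; have := hD _ Dx; rewrite setIid => h1.
    by have := qball_self ht (x := x) Logic.I r0; rewrite h1.
  apply: (maxD (D `|` [set x])) => //.
    by split; [move=> y; left|move=> /(_ x) h1; apply: nDx; apply: h1; right].
  move=> y z [Dy|->] [Dz|->] // [u [yu zu]].
  - by apply: tD => //; exists u.
  - by have : (B x r `&` B y r) u by []; rewrite hD.
  - by have : (B x r `&` B z r) u by []; rewrite hD.
exists y => //; apply: (le_lt_trans (rho_triangle ht (z := z) _ _ _)) => //.
have -> : e = (K * (r + r))%R by rewrite /r; field; rewrite gt_eqF.
by rewrite ltr_pM2l// ltrD// (rho_sym ht).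
Qed.

Lemma countable_dense : exists g : nat -> T, forall x e, (0 < e)%R ->
  exists n, (rho x (g n) < e)%R.
Proof.
have net k : exists D : set T, countable D /\ forall x, exists2 y, D y & (rho x y < k.+1%:R^-1)%R.
  by apply: countable_net; rewrite invr_gt0.
have [D hD] := choice net.
have : countable (\bigcup_k D k).
  by apply: bigcup_countable => // k _; have [] := hD k.
move/countable_injP => [f finj].
exists (fun n => xget point [set x | (\bigcup_k D k) x /\ f x = n]) => x e e0.
have [k hk] : exists k, (k.+1%:R^-1 < e)%R.
  exists (Num.trunc e^-1); rewrite -[ltRHS]invrK ltf_pV2 ?posrE ?invr_gt0//.
  exact: truncnS_gt.
have [_ /(_ x)[y Dy xy]] := hD k.
have Uy : (\bigcup_k D k) y by exists k.
exists (f y); case: xgetP => [z _ [Uz /finj fz]|/(_ y) h]; last by exfalso; exact: h.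
rewrite fz ?inE//; exact: lt_trans hk.
Qed.

Lemma countable_ball_base : exists base : nat -> T * R,
  (forall i, (0 < (base i).2)%R) /\
  forall x r, (0 < r)%R -> exists i, [/\ B x r `<=` B (base i).1 (base i).2,
    (rho x (base i).1 < r)%R & ((base i).2 <= 4 * K * r)%R].
Proof.
have [g hg] := countable_dense.
pose base i : T * R := if @choice.unpickle (nat * rat)%type i is Some (n, q) then
  (g n, if (0 < ratr q :> R)%R then ratr q else 1%R) else (point, 1%R).
exists base; split.
  move=> i; rewrite /base; case: choice.unpickle => [[n q]|]//=.
  by case: ifP.
move=> x r r0.
have [n hn] := hg x r r0.
have : (2 * K * r < 4 * K * r)%R by rewrite ltr_pM2r// ltr_pM2r// ltr_nat.
move=> /rat_in_itvoo[q]; rewrite in_itv /= => /andP[q1 q2].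
have q0 : (0 < ratr q :> R)%R.
  by apply: lt_trans q1; rewrite !mulr_gt0.
exists (choice.pickle (n, q)); rewrite /base choice.pickleK q0 /=; split => //; last exact: ltW.
move=> y [_ xy]; split => //; apply: (le_lt_trans (rho_triangle ht (z := x) _ _ _)) => //.
apply: lt_trans q1; rewrite (mulrC 2%R) -mulrA ltr_pM2l//.
by rewrite mulr2n mulrDl mul1r ltrD// (rho_sym ht).
Qed.

End CountableBase.

Section MaximalFunction.
Context (R : realType) (d : measure_display) (T : measurableType d).
Variable mu : {measure set T -> \bar R}.
Context (rho : T -> T -> R) (K1 K2 : R).
Hypothesis ht : homogeneous_type mu setT rho K1 K2.
Local Notation B := (qball setT rho).
Let K := Num.max K1 1%R.
Context (w : T -> R) (C : R).
Hypotheses (w0 : forall x, (0 <= w x)%R) (mw : measurable_fun setT w) (C1 : (1 <= C)%R).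
Let wt (A : set T) := \int[mu]_(x in A) (w x)%:E.
Hypothesis wB0 : forall x r, (0 < r)%R -> 0 < wt (B x r).
Hypothesis wBoo : forall x r, (0 < r)%R -> wt (B x r) < +oo.
Hypothesis wB : forall x z r s, (0 < r)%R -> (0 < s)%R -> (rho z x <= 4 * K ^+ 2 * r)%R ->
  (s <= 4 * K ^+ 2 * r)%R -> wt (B x s) <= C%:E * wt (B z r).
Context (base : nat -> T * R).
Hypothesis base0 : forall i, (0 < (base i).2)%R.
Hypothesis base_ball : forall x r, (0 < r)%R -> exists i,
  [/\ B x r `<=` B (base i).1 (base i).2, (rho x (base i).1 < r)%R &
      ((base i).2 <= 4 * K * r)%R].
Local Notation Bi i := (B (base i).1 (base i).2).
Implicit Types h : T -> \bar R.

Let K1' : (1 <= K)%R. Proof. by rewrite le_max lexx orbT. Qed.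
Let K0 : (0 < K)%R. Proof. exact: lt_le_trans K1'. Qed.
Let C0 : (0 < C)%R. Proof. exact: lt_le_trans C1. Qed.
Let mwE : measurable_fun setT (EFin \o w). Proof. exact/measurable_EFinP. Qed.
Let wE0 x : 0 <= (w x)%:E. Proof. by rewrite lee_fin. Qed.
Let mB x r : (0 < r)%R -> measurable (B x r).
Proof. by move=> r0; exact: (measurable_qball ht). Qed.
Let mBi i : measurable (Bi i). Proof. exact: mB. Qed.

Definition wavg h (A : set T) : \bar R := (wt A)^-1 * \int[mu]_(x in A) (h x * (w x)%:E).

Definition maxfun h (x : T) : \bar R :=
  ereal_sup [set wavg h (Bi i) | i in [set i | Bi i x]].

Lemma wt_fin i : exists2 a : R, wt (Bi i) = a%:E & (0 < a)%R.
Proof.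
have h0 := wB0 (base i).1 (base0 i); have hoo := wBoo (base i).1 (base0 i).
exists (fine (wt (Bi i))); first by rewrite fineK// ge0_fin_numE// ltW.
by rewrite fine_gt0// h0.
Qed.

Lemma maxfun_gtP h x (t : \bar R) : t < maxfun h x <-> exists2 i, Bi i x & t < wavg h (Bi i).
Proof.
split; first by move=> /ereal_sup_gt[_ [i ix <-] ti]; exists i.
by move=> [i ix ti]; apply: (lt_le_trans ti); apply: ereal_sup_ubound; exists i.
Qed.

Lemma measurable_maxfun h : measurable_fun setT (maxfun h).
Proof.
apply: emeasurable_fun_gt => t; rewrite setTI.
have -> : [set x | t%:E < maxfun h x] =
    \bigcup_i (if t%:E < wavg h (Bi i) then Bi i else set0).
  apply/seteqP; split => x.
    by move=> /maxfun_gtP[i ix ti]; exists i => //; rewrite ti.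
  by move=> [i _]; case: ifP => // ti ix; apply/maxfun_gtP; exists i.
by apply: bigcup_measurable => i _; case: ifP.
Qed.

Lemma wavg_ge0 h A : (forall x, 0 <= h x) -> 0 <= wavg h A.
Proof.
move=> h0; apply: mule_ge0.
  by rewrite inve_ge0; apply: integral_ge0.
by apply: integral_ge0 => x _; apply: mule_ge0.
Qed.

Lemma maxfun_ge0 h x : (forall x, 0 <= h x) -> 0 <= maxfun h x.
Proof.
move=> h0; have [i [xi _ _]] := base_ball x ltr01.
apply: (@le_trans _ _ (wavg h (Bi i))); first exact: wavg_ge0.
by apply: ereal_sup_ubound; exists i => //=; apply: xi; exact: (qball_self ht).
Qed.

Lemma integral_le_maxfun h x r y : measurable_fun setT h -> (forall x, 0 <= h x) ->
  (0 < r)%R -> B x r y ->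
  \int[mu]_(z in B x r) (h z * (w z)%:E) <= C%:E * wt (B x r) * maxfun h y.
Proof.
move=> mh h0 r0 xy; have [i [xi rxi ri]] := base_ball x r0.
have mhw : measurable_fun setT (fun z => h z * (w z)%:E) by exact: emeasurable_funM.
apply: (@le_trans _ _ (\int[mu]_(z in Bi i) (h z * (w z)%:E))).
  apply: ge0_subset_integral => //; first exact: mB.
    by apply: measurable_funS mhw.
  by move=> z _; apply: mule_ge0.
have [a Ea a0] := wt_fin i.
have -> : \int[mu]_(z in Bi i) (h z * (w z)%:E) = wt (Bi i) * wavg h (Bi i).
  by rewrite /wavg Ea inver gt_eqF// muleA -EFinM mulfV ?gt_eqF// mul1e.
apply: lee_pmul.
- by rewrite Ea lee_fin ltW.
- exact: wavg_ge0.
- apply: wB => //.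
    apply: (le_trans (ltW rxi)); rewrite -[leLHS]mul1r ler_pM2r//.
    by rewrite -[leLHS]mulr1 ler_pM ?ler1n// exprn_ege1.
  apply: (le_trans ri); rewrite ler_pM2r// ler_pM2l// expr2 ler_peMl// ltW//.
by apply: ereal_sup_ubound; exists i => //; exact: xi.
Qed.

(* Vitali selection: discard the balls meeting the largest one, they lie in its
   dilate. *)
Lemma finite_vitali h (l : R) (s : seq nat) : measurable_fun setT h ->
  (forall x, 0 <= h x) -> (0 < l)%R ->
  (forall i, i \in s -> l%:E * wt (Bi i) <= \int[mu]_(x in Bi i) (h x * (w x)%:E)) ->
  l%:E * wt (\big[setU/set0]_(i <- s) Bi i) <=
  C%:E * \int[mu]_(x in \big[setU/set0]_(i <- s) Bi i) (h x * (w x)%:E).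
Proof.
move=> mh h0 l0.
have mhw : measurable_fun setT (fun z => h z * (w z)%:E) by exact: emeasurable_funM.
have hw0 x : 0 <= h x * (w x)%:E by exact: mule_ge0.
have mU (s' : seq nat) : measurable (\big[setU/set0]_(i <- s') Bi i).
  by apply: bigsetU_measurable => i _.
elim: {s}(size s) {-2}s (leqnn (size s)) => [|n IH] s sn hs.
  move: sn; rewrite leqn0 size_eq0 => /eqP ->.
  by rewrite !big_nil /wt !integral_set0 !mule0.
case: s sn hs => [|i1 s1] sn hs; first by rewrite !big_nil /wt !integral_set0 !mule0.
set s := i1 :: s1 in sn hs *.
have [i0 i0s maxi] : exists2 i0, i0 \in s & forall i, i \in s -> ((base i).2 <= (base i0).2)%R.
  rewrite /s; elim: s1 i1 {sn hs s} => [|j s2 IHs] i1.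
    by exists i1; [rewrite inE|move=> i; rewrite inE => /eqP ->].
  have [k ks kmax] := IHs j.
  have [ik|ik] := leP (base i1).2 (base k).2.
    exists k; first by rewrite inE ks orbT.
    by move=> i; rewrite inE => /orP[/eqP ->//|/kmax].
  exists i1; first by rewrite inE eqxx.
  move=> i; rewrite inE => /orP[/eqP ->//|/kmax hi].
  exact: (le_trans hi (ltW ik)).
pose s' := [seq i <- s | `[< Bi i `&` Bi i0 = set0 >]].
have i0self : Bi i0 (base i0).1 by exact: (qball_self ht).
have s'n : (size s' <= n)%N.
  rewrite -ltnS; apply: leq_trans sn; rewrite size_filter -(count_predC (fun i => `[< Bi i `&` Bi i0 = set0 >])).
  rewrite -addn1 leq_add2l -has_count; apply/hasP; exists i0 => //=.
  apply/asboolP => e0; have : (Bi i0 `&` Bi i0) (base i0).1 by [].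
  by rewrite e0.
have hs' i : i \in s' -> l%:E * wt (Bi i) <= \int[mu]_(x in Bi i) (h x * (w x)%:E).
  by rewrite mem_filter => /andP[_ /hs].
have {}IH := IH s' s'n hs'.
pose Bs := B (base i0).1 (4 * K ^+ 2 * (base i0).2).
have rs0 : (0 < 4 * K ^+ 2 * (base i0).2)%R by rewrite !mulr_gt0// exprn_gt0.
have mBs : measurable Bs by exact: mB.
have cover : \big[setU/set0]_(i <- s) Bi i `<=` Bs `|` \big[setU/set0]_(i <- s') Bi i.
  move=> y; rewrite -!bigcup_seq => -[i /= si iy].
  have [e0|/eqP/set0P[z [iz i0z]]] := pselect (Bi i `&` Bi i0 = set0).
    right; exists i => //=; rewrite mem_filter si andbT; exact/asboolP.
  left; split => //.
  have rii := maxi i si.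
  have h1 : (rho (base i).1 z < (base i).2)%R by case: iz.
  have h2 : (rho (base i).1 y < (base i).2)%R by case: iy.
  have h3 : (rho (base i0).1 z < (base i0).2)%R by case: i0z.
  have h4 : (rho z y < K * (2 * (base i0).2))%R.
    apply: (le_lt_trans (rho_triangle ht (z := (base i).1) _ _ _)) => //.
    by rewrite ltr_pM2l// (rho_sym ht)//; lra.
  apply: (le_lt_trans (rho_triangle ht (z := z) _ _ _)) => //.
  have r0p := base0 i0.
  have : (K * (rho (base i0).1 z + rho z y) < K * ((base i0).2 + K * (2 * (base i0).2)))%R.
    by rewrite ltr_pM2l// ltrD.
  have : ((base i0).2 <= K * (base i0).2)%R by rewrite ler_peMl// ltW.
  move=> h5 h6; apply: (lt_le_trans h6).
  rewrite expr2 -!mulrA [leRHS]mulrCA ler_pM2l//.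
  apply: (@le_trans _ _ (K * (base i0).2 + K * (2 * (base i0).2)))%R; first by rewrite lerD2r.
  have : (0 < K * (base i0).2)%R by exact: mulr_gt0.
  lra.
have sub : Bi i0 `|` \big[setU/set0]_(i <- s') Bi i `<=` \big[setU/set0]_(i <- s) Bi i.
  rewrite -!bigcup_seq => y [i0y|[i /= is' iy]]; first by exists i0.
  by exists i => //=; move: is'; rewrite mem_filter => /andP[].
have disj : Bi i0 `&` \big[setU/set0]_(i <- s') Bi i = set0.
  rewrite -bigcup_seq; apply/seteqP; split => // y [i0y [i /= is' iy]].
  move: is'; rewrite mem_filter => /andP[/asboolP e0 _].
  by have : (Bi i `&` Bi i0) y by []; rewrite e0.
set U := \big[setU/set0]_(i <- s) _ in cover sub *.
set U' := \big[setU/set0]_(i <- s') _ in cover sub disj IH *.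
have mUU : measurable U by exact: mU.
have mU' : measurable U' by exact: mU.
have i0U : \int[mu]_(x in Bi i0) (h x * (w x)%:E) + \int[mu]_(x in U') (h x * (w x)%:E) <=
    \int[mu]_(x in U) (h x * (w x)%:E).
  rewrite -ge0_integral_setU//; last 2 first.
  - by apply: measurable_funS mhw.
  - exact/disj_set2P.
  apply: ge0_subset_integral => //; first exact: measurableU.
  by apply: measurable_funS mhw.
apply: (@le_trans _ _ (l%:E * (wt Bs + wt U'))).
  apply: lee_wpmul2l; first by rewrite lee_fin ltW.
  apply: ge0_integral_le_setU => //.
  by apply: measurable_funS mwE.
have wU'0 : 0 <= wt U' by apply: integral_ge0.
have wBs0 : 0 <= wt Bs by apply: integral_ge0.
rewrite ge0_muleDr//; apply: le_trans (lee_wpmul2l _ i0U); last by rewrite lee_fin ltW.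
have I1 : 0 <= \int[mu]_(x in Bi i0) (h x * (w x)%:E) by apply: integral_ge0.
have I2 : 0 <= \int[mu]_(x in U') (h x * (w x)%:E) by apply: integral_ge0.
rewrite (ge0_muleDr C%:E I1 I2); apply: leeD => //.
apply: (@le_trans _ _ (C%:E * (l%:E * wt (Bi i0)))).
  rewrite muleCA; apply: lee_wpmul2l; first by rewrite lee_fin ltW.
  apply: wB => //; rewrite (rho_xx ht)// ltW//.
by apply: lee_wpmul2l; [rewrite lee_fin ltW|exact: hs].
Qed.

Lemma weak_type h (l : R) : measurable_fun setT h -> (forall x, 0 <= h x) -> (0 < l)%R ->
  l%:E * wt [set x | l%:E < maxfun h x] <= C%:E * \int[mu]_x (h x * (w x)%:E).
Proof.
move=> mh h0 l0.
have mhw : measurable_fun setT (fun z => h z * (w z)%:E) by exact: emeasurable_funM.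
have hw0 x : 0 <= h x * (w x)%:E by exact: mule_ge0.
pose s n := [seq i <- iota 0 n | l%:E < wavg h (Bi i)].
pose U n := \big[setU/set0]_(i <- s n) Bi i.
have UE n : U n = \bigcup_(i in [set i | (i < n)%N /\ l%:E < wavg h (Bi i)]) Bi i.
  rewrite /U -bigcup_seq; apply/seteqP; split => x [i /= hi ix]; exists i => //=.
    by move: hi; rewrite mem_filter mem_iota => /andP[].
  by move: hi; rewrite mem_filter mem_iota => -[-> ->].
have -> : [set x | l%:E < maxfun h x] = \bigcup_n U n.
  apply/seteqP; split => x.
    by move=> /maxfun_gtP[i ix li]; exists i.+1 => //; rewrite UE; exists i => //=.
  by move=> [n _]; rewrite UE => -[i [_ li] ix]; apply/maxfun_gtP; exists i.
have mU n : measurable (U n) by apply: bigsetU_measurable => i _.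
have nU : {homo U : n m / (n <= m)%N >-> (n <= m)%O}.
  move=> m n mn; apply/subsetPset; rewrite !UE => x [i [im li] ix].
  by exists i => //; split => //; exact: leq_trans mn.
have hU n : wt (U n) <= (l^-1)%:E * (C%:E * \int[mu]_x (h x * (w x)%:E)).
  rewrite -lee_pdivrMl ?invr_gt0// invrK.
  apply: (le_trans (finite_vitali mh h0 l0 _)).
    move=> i; rewrite mem_filter => /andP[+ _].
    have [a Ea a0] := wt_fin i; rewrite /wavg Ea inver gt_eqF// => /ltW.
    by rewrite lee_pdivlMl// muleC.
  apply: lee_wpmul2l; first by rewrite lee_fin ltW.
  by apply: ge0_subset_integral => //; exact: mU.
rewrite -lee_pdivlMl//.
have cv := @ge0_nondecreasing_set_cvg_integral _ _ _ U (EFin \o w) mu nU mU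
  (fun k => measurable_funS measurableT (@subsetT _ _) mwE) (fun k x _ => wE0 x).
rewrite /wt -(cvg_lim _ cv)//; apply: lime_le; first by apply/cvg_ex; eexists; exact: cv.
by apply: nearW => n; exact: hU.
Qed.

Lemma maxfun_truncate h (l : R) x : measurable_fun setT h -> (forall x, 0 <= h x) ->
  (0 < l)%R -> l%:E < maxfun h x ->
  (l / 2)%:E < maxfun (h \_ [set y | (l / 2)%:E < h y]) x.
Proof.
move=> mh h0 l0 /maxfun_gtP[i ix li]; apply/maxfun_gtP; exists i => //.
set g := h \_ _; have l20 : (0 < l / 2)%R by exact: divr_gt0.
have mE : measurable [set y | (l / 2)%:E < h y].
  by rewrite -[X in measurable X]setTI; exact: emeasurable_fun_o_infty.
have g0 y : 0 <= g y by rewrite /g /patch; case: ifPn.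
have mg : measurable_fun setT g by exact: measurable_patch.
rewrite ltNge; apply/negP => hg; move: li; rewrite ltNge => /negP; apply.
have [a Ea a0] := wt_fin i.
have mgw : measurable_fun setT (fun z => g z * (w z)%:E) by exact: emeasurable_funM.
have mhw : measurable_fun setT (fun z => h z * (w z)%:E) by exact: emeasurable_funM.
move: hg; rewrite /wavg Ea inver gt_eqF// !lee_pdivrMl// => hg.
apply: (@le_trans _ _ (\int[mu]_(y in Bi i) (g y * (w y)%:E + (l / 2)%:E * (w y)%:E))).
  apply: ge0_le_integral => //.
  - by move=> y _; apply: mule_ge0.
  - by apply: measurable_funS mhw.
  - apply: emeasurable_funD; first by apply: measurable_funS mgw.
    by apply: measurable_funeM; apply: measurable_funS mwE.
  move=> y _; rewrite -ge0_muleDl// ?lee_fin ?(ltW l20)//.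
  apply: lee_wpmul2r => //; rewrite /g /patch; case: ifPn => [_|]; first by rewrite leeDl// lee_fin ltW.
  by rewrite notin_setE /= add0e leNgt => /negP.
rewrite ge0_integralD//; last 4 first.
- by move=> y _; apply: mule_ge0.
- by apply: measurable_funS mgw.
- by move=> y _; apply: mule_ge0 => //; rewrite lee_fin ltW.
- by apply: measurable_funeM; apply: measurable_funS mwE.
rewrite ge0_integralZl_EFin//; last 2 first.
- by apply: measurable_funS mwE.
- exact: ltW.
apply: (le_trans (leeD hg (lexx _))); rewrite -/(wt (Bi i)) Ea -!EFinM -EFinD lee_fin; lra.
Qed.

End MaximalFunction.

Section RubioDeFrancia.
Context (R : realType) (d : measure_display) (T : measurableType d).
Variable mu : {measure set T -> \bar R}.
Context (w : T -> R) (C : R) (Mx : (T -> \bar R) -> T -> \bar R).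
Hypotheses (w0 : forall x, (0 <= w x)%R) (mw : measurable_fun setT w) (C1 : (1 <= C)%R).
Let wt (A : set T) := \int[mu]_(x in A) (w x)%:E.
Hypothesis mMx : forall h, measurable_fun setT (Mx h).
Hypothesis Mx0 : forall h x, (forall x, 0 <= h x) -> 0 <= Mx h x.
Hypothesis weak : forall h (l : R), measurable_fun setT h -> (forall x, 0 <= h x) -> (0 < l)%R ->
  l%:E * wt [set x | l%:E < Mx h x] <= C%:E * \int[mu]_x (h x * (w x)%:E).
Hypothesis trunc : forall h (l : R) x, measurable_fun setT h -> (forall x, 0 <= h x) ->
  (0 < l)%R -> l%:E < Mx h x -> (l / 2)%:E < Mx (h \_ [set y | (l / 2)%:E < h y]) x.
Context (t : R).
Hypothesis t1 : (1 < t)%R.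
Let t0 : (0 < t)%R. Proof. exact: lt_trans t1. Qed.
Let C0 : (0 < C)%R. Proof. exact: lt_le_trans C1. Qed.
Let mwE : measurable_fun setT (EFin \o w). Proof. exact/measurable_EFinP. Qed.
Let wE0 x : 0 <= (w x)%:E. Proof. by rewrite lee_fin. Qed.
Let q : R := (2 `^ (t - 1))%R.
Let St : R := (2 `^ t * (2 * C * (q / (q - 1) / 2^-1 `^ (t - 1))))%R.

Lemma poweRB1M (u : \bar R) : 0 <= u -> u `^ (t - 1) * u = u `^ t.
Proof.
have t10 : (0 < t - 1)%R by rewrite subr_gt0.
case: u => [r| |]//; last by rewrite !poweRyr ?gt_eqF// mulyy.
rewrite lee_fin => r0; rewrite !poweR_EFin -EFinM mulrC mulr_powRB1//.
Qed.

Lemma strong_type h : measurable_fun setT h -> (forall x, 0 <= h x) ->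
  \int[mu]_x (Mx h x `^ t * (w x)%:E) <= St%:E * \int[mu]_x (h x `^ t * (w x)%:E).
Proof.
move=> mh h0; have t10 : (0 < t - 1)%R by rewrite subr_gt0.
have mhw : measurable_fun setT (fun z => h z * (w z)%:E) by exact: emeasurable_funM.
have hw0 x : 0 <= h x * (w x)%:E by exact: mule_ge0.
have two1 : (1 < 2 :> R)%R by rewrite ltr1n.
rewrite /St EFinM -muleA.
apply: (integral_poweR_le_layer measurableT (fun x _ => wE0 x) mwE two1 t0) => //.
  by move=> x _; exact: Mx0.
move=> c n c0.
have lvl (l : R) : (0 < l)%R -> l%:E * level_mass mu setT (fun x => (w x)%:E) (Mx h) l <=
    (2 * C)%:E * level_mass mu setT (fun x => h x * (w x)%:E) h (2^-1 * l).
  move=> l0; have l20 : (0 < l / 2)%R by exact: divr_gt0.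
  pose E := [set y | (l / 2)%:E < h y].
  have mE : measurable E by rewrite -[X in measurable X]setTI; exact: emeasurable_fun_o_infty.
  have g0 y : 0 <= (h \_ E) y by rewrite /patch; case: ifPn.
  have mg : measurable_fun setT (h \_ E) by exact: measurable_patch.
  have := weak mg g0 l20.
  have -> : \int[mu]_x ((h \_ E) x * (w x)%:E) =
      level_mass mu setT (fun x => h x * (w x)%:E) h (2^-1 * l).
    rewrite /level_mass integral_mkcondr mulrC; apply: eq_integral => x _.
    by rewrite /patch; case: ifPn => //; rewrite mul0e.
  move=> hw; apply: (@le_trans _ _ (2%:E * ((l / 2)%:E * wt [set x | (l / 2)%:E < Mx (h \_ E) x]))).
    rewrite muleA -EFinM (_ : (2 * (l / 2) = l)%R); last by field.
    apply: lee_wpmul2l; first by rewrite lee_fin ltW.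
    have mM g (s : R) : measurable [set x | s%:E < Mx g x].
      by rewrite -[X in measurable X]setTI; exact: emeasurable_fun_o_infty.
    rewrite /level_mass setTI; apply: ge0_subset_integral => //.
      by apply: measurable_funS mwE.
    by move=> x /= lx; exact: trunc.
  by rewrite (EFinM 2 C) -muleA; apply: lee_wpmul2l.
have l0 i : (0 < c * 2 ^+ i)%R by rewrite mulr_gt0// exprn_gt0.
apply: (@le_trans _ _ (\sum_(0 <= i < n) (2 * C)%:E * (((c * 2 ^+ i) `^ (t - 1))%:E *
    level_mass mu setT (fun x => h x * (w x)%:E) h (2^-1 * (c * 2 ^+ i))))).
  rewrite /layer_mass; apply: lee_sum => i _.
  rewrite muleCA -(mulr_powRB1 (ltW (l0 i)) t0) mulrC EFinM -muleA.
  by apply: lee_wpmul2l; [rewrite lee_fin powR_ge0|exact: lvl].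
rewrite -ge0_sume_distrr; last first.
  move=> i _; apply: mule_ge0; first by rewrite lee_fin powR_ge0.
  exact: integral_ge0.
rewrite (EFinM (2 * C)) -muleA; apply: lee_wpmul2l; first by rewrite lee_fin mulr_ge0// ltW.
have h20 : (0 < 2^-1 :> R)%R by rewrite invr_gt0.
apply: (le_trans (layer_mass_le_scaled mu measurableT (fun x _ => hw0 x) mhw two1 t10 n c0 h20 mh (fun x _ => h0 x))).
rewrite (_ : \int[mu]_x (h x `^ (t - 1) * (h x * (w x)%:E)) = \int[mu]_x (h x `^ t * (w x)%:E))//.
by apply: eq_integral => x _; rewrite muleA poweRB1M.
Qed.

End RubioDeFrancia.

Lemma nneseries_half (R : realType) (c : \bar R) : 0 <= c ->
  \sum_(0 <= k <oo) ((2 ^- k)%:E * c) <= 2%:E * c.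
Proof.
case: c => [c| |]//; last by rewrite gt0_muley ?leey.
rewrite lee_fin => c0; have c20 : (0 <= 2 * c)%R by rewrite mulr_ge0.
rewrite -EFinM; apply: (le_trans _ (epsilon_trick0 predT c20)).
apply: lee_nneseries => i _; first by move=> _; rewrite mule_ge0// lee_fin ?invr_ge0 ?exprn_ge0.
rewrite -EFinM lee_fin natrX exprS [leRHS](_ : _ = (2 ^- i * c)%R)//.
by field; rewrite expf_neq0.
Qed.

Lemma nneseries_shift (R : realType) (u : nat -> \bar R) : (forall k, 0 <= u k) ->
  \sum_(0 <= k <oo) u k.+1 <= \sum_(0 <= k <oo) u k.
Proof.
move=> u0; apply: lime_le; first exact: is_cvg_nneseries.
apply: nearW => n; apply: (le_trans _ (nneseries_lim_ge n.+1 _)); last by [].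
by rewrite big_nat_recl// leeDr.
Qed.

Section Majorant.
Context (R : realType) (d : measure_display) (T : measurableType d).
Variable mu : {measure set T -> \bar R}.
Context (w : T -> R) (Mx : (T -> \bar R) -> T -> \bar R) (t A : R).
Hypotheses (w0 : forall x, (0 <= w x)%R) (mw : measurable_fun setT w).
Hypotheses (t1 : (1 < t)%R) (A1 : (1 <= A)%R).
Hypothesis mMx : forall h, measurable_fun setT (Mx h).
Hypothesis Mx0 : forall h x, (forall x, 0 <= h x) -> 0 <= Mx h x.
Hypothesis strong : forall h, measurable_fun setT h -> (forall x, 0 <= h x) ->
  \int[mu]_x (Mx h x `^ t * (w x)%:E) <= A%:E * \int[mu]_x (h x `^ t * (w x)%:E).

Let t0 : (0 < t)%R. Proof. exact: lt_trans t1. Qed.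
Let A0 : (0 < A)%R. Proof. exact: lt_le_trans A1. Qed.
Let c0 k : (0 <= ((4 * A) ^- k)%:E :> \bar R).
Proof. by rewrite lee_fin invr_ge0 exprn_ge0// mulr_ge0// ltW. Qed.
Let d0 k : (0 <= ((2 * A) ^- k)%:E :> \bar R).
Proof. by rewrite lee_fin invr_ge0 exprn_ge0// mulr_ge0// ltW. Qed.

(* The series of Rubio de Francia.  The extra factor [4 = 2 * 2] leaves one
   geometric series for the pointwise bound and one for the L^t bound. *)
Definition rdf (h : T -> \bar R) (x : T) : \bar R :=
  \sum_(0 <= k <oo) (((4 * A) ^- k)%:E * iter k Mx h x).

Section majorant_of.
Context (h : T -> \bar R) (mh : measurable_fun setT h) (h0 : forall x, 0 <= h x).
Let u k := iter k Mx h.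

Let mu_ k : measurable_fun setT (u k). Proof. by rewrite /u; case: k => [|k] /=; [exact: mh|exact: mMx]. Qed.
Let u0 k x : 0 <= u k x.
Proof. by rewrite /u; elim: k x => [|k IH] x /=; [exact: h0|exact: Mx0]. Qed.
Let cu0 k x : 0 <= ((4 * A) ^- k)%:E * u k x. Proof. exact: mule_ge0. Qed.

Lemma measurable_rdf : measurable_fun setT (rdf h).
Proof.
rewrite (_ : rdf h = fun x => \sum_(i <oo | i \in predT) (((4 * A) ^- i)%:E * u i x)).
  by apply: ge0_emeasurable_sum => // k _; apply: measurable_funeM.
by [].
Qed.

Lemma rdf_ge x : h x <= rdf h x.
Proof.
apply: (le_trans _ (@nneseries_lim_ge R (fun k => ((4 * A) ^- k)%:E * u k x) predT 0 1 (fun k _ _ => cu0 k x))).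
by rewrite big_nat1 expr0 invr1 mul1e.
Qed.

Lemma rdf_ge0 x : 0 <= rdf h x. Proof. exact: le_trans (rdf_ge x). Qed.

Let int_u k : \int[mu]_x (u k x `^ t * (w x)%:E) <=
  (A ^+ k)%:E * \int[mu]_x (h x `^ t * (w x)%:E).
Proof.
elim: k => [|k IH]; first by rewrite expr0 mul1e.
apply: (le_trans (strong (mu_ k) (u0 k))).
by rewrite exprS EFinM -muleA; apply: lee_wpmul2l => //; rewrite lee_fin ltW.
Qed.

Lemma integral_rdf : \int[mu]_x (rdf h x `^ t * (w x)%:E) <=
  (2 * 2 `^ t)%:E * \int[mu]_x (h x `^ t * (w x)%:E).
Proof.
pose v k x := (((2 * A) ^- k)%:E * u k x) `^ t.
have v0 k x : 0 <= v k x by exact: poweR_ge0.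
have mv k : measurable_fun setT (v k).
  by apply: (measurableT_comp (measurable_poweR t)); exact: measurable_funeM.
pose S x := \sum_(0 <= k <oo) v k x.
have S0 x : 0 <= S x by exact: nneseries_ge0.
have mwE : measurable_fun setT (EFin \o w) by exact/measurable_EFinP.
have wE0 x : 0 <= (w x)%:E by rewrite lee_fin.
have mS : measurable_fun setT S.
  rewrite (_ : S = fun x => \sum_(i <oo | i \in predT) v i x)//.
  exact: ge0_emeasurable_sum.
have HS x : rdf h x `^ t <= (2 `^ t)%:E * S x.
  have vS k : ((2 * A) ^- k)%:E * u k x <= S x `^ t^-1.
    have p0 : 0 <= ((2 * A) ^- k)%:E * u k x by exact: mule_ge0.
    have -> : ((2 * A) ^- k)%:E * u k x = v k x `^ t^-1.
      by rewrite /v -poweRrM divff ?gt_eqF// poweRe1.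
    apply: le_poweR; rewrite ?invr_ge0 ?(ltW t0)//.
    apply: (le_trans _ (@nneseries_lim_ge R (fun k => v k x) predT 0 k.+1 (fun k _ _ => v0 k x))).
    by rewrite big_nat_recr//= leeDr// sume_ge0.
  have : rdf h x <= 2%:E * S x `^ t^-1.
    apply: (le_trans _ (nneseries_half (poweR_ge0 _ _))).
    apply: lee_nneseries => [k _ _|k _]; first exact: cu0.
    rewrite (_ : (4 * A) ^- k = 2 ^- k * (2 * A) ^- k)%R; last first.
      by rewrite -invfM -exprMn mulrA -natrM.
    by rewrite EFinM -muleA; apply: lee_wpmul2l => //; rewrite lee_fin invr_ge0 exprn_ge0.
  move=> /(le_poweR (ltW t0) (rdf_ge0 x))/le_trans; apply.
  rewrite poweRM ?poweR_ge0 ?lee_fin// poweR_EFin -poweRrM mulVf ?gt_eqF//.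
  by rewrite poweRe1.
apply: (@le_trans _ _ (\int[mu]_x ((2 `^ t)%:E * (S x * (w x)%:E)))).
  apply: ge0_le_integral => //.
  - by move=> x _; apply: mule_ge0 => //; exact: poweR_ge0.
  - apply: emeasurable_funM => //.
    by apply: (measurableT_comp (measurable_poweR t)); exact: measurable_rdf.
  - by apply: measurable_funeM; exact: emeasurable_funM.
  by move=> x _; rewrite muleA; apply: lee_wpmul2r.
rewrite ge0_integralZl_EFin//; last 2 first.
- by move=> x _; apply: mule_ge0.
- exact: emeasurable_funM.
rewrite (mulrC 2%R) EFinM -muleA; apply: lee_wpmul2l; first by rewrite lee_fin powR_ge0.
have -> : \int[mu]_x (S x * (w x)%:E) = \int[mu]_x (\sum_(0 <= k <oo) (v k x * (w x)%:E)).
  apply: eq_integral => x _; rewrite muleC /S -nneseriesZl//.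
  by apply: eq_eseriesr => k _; rewrite muleC.
rewrite integral_nneseries//; last 2 first.
- by move=> k; exact: emeasurable_funM.
- by move=> k x _; apply: mule_ge0.
have I0 : 0 <= \int[mu]_x (h x `^ t * (w x)%:E).
  by apply: integral_ge0 => x _; apply: mule_ge0 => //; exact: poweR_ge0.
apply: (le_trans _ (nneseries_half I0)).
apply: lee_nneseries => [k _ _|k _].
  by apply: integral_ge0 => x _; apply: mule_ge0.
have -> : \int[mu]_x (v k x * (w x)%:E) =
    \int[mu]_x ((((2 * A) ^- k) `^ t)%:E * (u k x `^ t * (w x)%:E)).
  by apply: eq_integral => x _; rewrite /v poweRM// poweR_EFin muleA.
rewrite ge0_integralZl_EFin//; last 3 first.
- by move=> x _; apply: mule_ge0 => //; exact: poweR_ge0.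
- apply: emeasurable_funM => //.
  by apply: (measurableT_comp (measurable_poweR t)); exact: mu_.
- exact: powR_ge0.
apply: (le_trans (lee_wpmul2l _ (int_u k))); first by rewrite lee_fin powR_ge0.
rewrite muleA -EFinM; apply: lee_wpmul2r => //; rewrite lee_fin.
have dk1 : ((2 * A) ^- k <= 1)%R.
  by rewrite invf_le1 ?exprn_gt0 ?mulr_gt0// exprn_ege1// (le_trans A1)// ler_peMl ?ler1n// ltW.
have dk0 : (0 < (2 * A) ^- k)%R by rewrite invr_gt0 exprn_gt0 ?mulr_gt0.
apply: (@le_trans _ _ ((2 * A) ^- k * A ^+ k)%R).
  apply: ler_wpM2r; first by rewrite exprn_ge0// ltW.
  by apply: ge1r_powR; rewrite ?dk0 ?dk1 ?(ltW t1).
by rewrite exprMn invfM mulfVK// expf_neq0// gt_eqF.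
Qed.

Lemma integral_rdf_le (D : set T) (cD : \bar R) y : measurable D -> 0 <= cD ->
  (forall g, measurable_fun setT g -> (forall x, 0 <= g x) ->
    \int[mu]_(x in D) (g x * (w x)%:E) <= cD * Mx g y) ->
  \int[mu]_(x in D) (rdf h x * (w x)%:E) <= (4 * A)%:E * cD * rdf h y.
Proof.
move=> mD cD0 hD.
have mwE : measurable_fun setT (EFin \o w) by exact/measurable_EFinP.
have wE0 x : 0 <= (w x)%:E by rewrite lee_fin.
have -> : \int[mu]_(x in D) (rdf h x * (w x)%:E) =
    \int[mu]_(x in D) (\sum_(0 <= k <oo) (((4 * A) ^- k)%:E * (u k x * (w x)%:E))).
  apply: eq_integral => x _; rewrite muleC /rdf -nneseriesZl; last by move=> k _; exact: cu0.
  by apply: eq_eseriesr => k _; rewrite muleC muleA.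
have uw0 k x : 0 <= u k x * (w x)%:E by exact: mule_ge0.
have muw k : measurable_fun D (fun x => u k x * (w x)%:E).
  by apply: (@measurable_funS _ _ _ _ setT) => //; exact: emeasurable_funM.
rewrite integral_nneseries => [|//|k|k x _]; last 2 first.
- exact: measurable_funeM.
- exact: mule_ge0.
apply: (@le_trans _ _ (\sum_(0 <= k <oo)
   ((4 * A)%:E * cD * (((4 * A) ^- k.+1)%:E * u k.+1 y)))).
  apply: lee_nneseries => [k _ _|k _].
    by apply: integral_ge0 => x _; apply: mule_ge0.
  rewrite ge0_integralZl_EFin//; last by have := c0 k; rewrite lee_fin.
  rewrite muleACA -EFinM exprS invfM mulrA divff ?mul1r ?gt_eqF ?mulr_gt0//.
  by apply: lee_wpmul2l => //; exact: hD.
have [cDoo|] := eqVneq cD +oo.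
  rewrite cDoo gt0_muley ?lte_fin ?mulr_gt0//.
  have [H0|Hp] := leP (rdf h y) 0; last by rewrite gt0_mulye// leey.
  have {}H0 : rdf h y = 0 by apply: le_anti; rewrite H0 rdf_ge0.
  rewrite H0 mule0 eseries0// => k _ _.
  rewrite (_ : _ * u k.+1 y = 0) ?mule0//; apply: le_anti; rewrite cu0 andbT -H0.
  apply: (le_trans _ (@nneseries_lim_ge R (fun k => ((4 * A) ^- k)%:E * u k y) predT 0 k.+2 (fun k _ _ => cu0 k y))).
  by rewrite big_nat_recr//= leeDr// sume_ge0.
move=> cDfin; have {cDfin} : cD \is a fin_num by rewrite ge0_fin_numE// lt_neqAle cDfin leey.
move=> /fineK <-; rewrite -EFinM nneseriesZl//.
apply: lee_wpmul2l; first by rewrite lee_fin !mulr_ge0 ?fine_ge0// ltW.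
by apply: (@nneseries_shift _ (fun k => ((4 * A) ^- k)%:E * u k y)) => k.
Qed.

End majorant_of.
End Majorant.

Lemma A1_majorant (R : realType) (K1 K2 P K t : R) : (1 < P)%R -> (1 < t)%R ->
  exists2 C : R, (1 <= C)%R &
  forall (d : measure_display) (T : measurableType d) (mu : {measure set T -> \bar R})
    (rho : T -> T -> R) (w : T -> R),
  homogeneous_type mu setT rho K1 K2 -> Ap_weight mu setT rho P w ->
  Ap_const mu setT rho P w <= K%:E ->
  (forall x r, (0 < r)%R -> 0 < \int[mu]_(y in qball setT rho x r) (w y)%:E) ->
  forall h : T -> \bar R, measurable_fun setT h -> (forall x, 0 <= h x) ->
  exists H : T -> \bar R, [/\ measurable_fun setT H, forall x, h x <= H x,
    \int[mu]_x (H x `^ t * (w x)%:E) <= C%:E * \int[mu]_x (h x `^ t * (w x)%:E) &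
    forall x r y, (0 < r)%R -> qball setT rho x r y ->
      \int[mu]_(z in qball setT rho x r) (H z * (w z)%:E) <=
      C%:E * \int[mu]_(z in qball setT rho x r) (w z)%:E * H y].
Proof.
move=> P1 t1; pose L := Num.max K1 1%R.
have L1 : (1 <= L)%R by rewrite le_max lexx orbT.
have L0 : (0 < L)%R by exact: lt_le_trans L1.
pose M := (4 * L ^+ 2)%R.
have M0 : (0 < M)%R by rewrite mulr_gt0// exprn_gt0.
have M1 : (1 <= L * (2 * M))%R.
  rewrite -[leLHS]mul1r ler_pM// /M.
  have : (1 <= L ^+ 2)%R by rewrite exprn_ege1.
  lra.
have [C0 C00 hC0] := engulf_constant K1 K2 (L * (2 * M)).
have [Cd Cd1 hCd] := Ap_large_constant K P1 C00.
pose q : R := (2 `^ (t - 1))%R.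
pose St : R := (2 `^ t * (2 * Cd * (q / (q - 1) / 2^-1 `^ (t - 1))))%R.
pose A := Num.max St 1%R.
have A1 : (1 <= A)%R by rewrite le_max lexx orbT.
have A0 : (0 < A)%R by exact: lt_le_trans A1.
pose C := Num.max (2 * 2 `^ t)%R (4 * A * Cd)%R.
have Cd0 : (0 < Cd)%R by exact: lt_le_trans Cd1.
exists C.
  rewrite le_max; apply/orP; right.
  have : (1 <= A * Cd)%R by rewrite -[leLHS]mul1r ler_pM.
  lra.
move=> d T mu rho w ht Aw Kw w_gt0 h mh h0.
have [w0 mw _] := Aw.
have {}w0 x : (0 <= w x)%R by exact: w0.
have e0 : (0 < (P - 1)^-1)%R by rewrite invr_gt0 subr_gt0.
have wBoo x r : (0 < r)%R -> \int[mu]_(y in qball setT rho x r) (w y)%:E < +oo.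
  by move=> r0; apply: (Ap_ball_fin ht P1 Aw Kw).
have wB x z r s : (0 < r)%R -> (0 < s)%R -> (rho z x <= M * r)%R -> (s <= M * r)%R ->
    \int[mu]_(y in qball setT rho x s) (w y)%:E <=
    Cd%:E * \int[mu]_(y in qball setT rho z r) (w y)%:E.
  move=> r0 s0 zx sM.
  have LMr : (0 < L * (2 * M) * r)%R by rewrite !mulr_gt0.
  apply: (@le_trans _ _ (\int[mu]_(y in qball setT rho z (L * (2 * M) * r)) (w y)%:E)).
    apply: ge0_subset_integral => //.
    - exact: (measurable_qball ht).
    - exact: (measurable_qball ht).
    - by apply: (@measurable_funS _ _ _ _ setT) => //; exact/measurable_EFinP.
    - by move=> y _; rewrite lee_fin.
    - by apply: (qball_engulf ht).
  apply: (hCd _ _ _ _ _ _ _ _ ht Aw Kw) => //.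
  - exact: (measurable_qball ht).
  - by apply: qball_mono; rewrite ler_peMl// ltW.
  apply: (hC0 _ _ _ _ _ ht) => //.
  by rewrite (rho_xx ht)// ltW.
have [base [base0 base_ball]] := countable_ball_base ht.
pose Mx := maxfun mu rho w base.
have mMx g : measurable_fun setT (Mx g) by exact: (measurable_maxfun ht).
have Mx0 g x : (forall x, 0 <= g x) -> 0 <= Mx g x by exact: (maxfun_ge0 ht).
have strong g : measurable_fun setT g -> (forall x, 0 <= g x) ->
    \int[mu]_x (Mx g x `^ t * (w x)%:E) <= A%:E * \int[mu]_x (g x `^ t * (w x)%:E).
  move=> mg g0; apply: (@le_trans _ _ (St%:E * \int[mu]_x (g x `^ t * (w x)%:E))).
    apply: (strong_type w0 mw Cd1 mMx Mx0) => //.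
    - exact: (weak_type ht).
    - exact: (maxfun_truncate ht).
  apply: lee_wpmul2r; last by rewrite lee_fin le_max lexx.
  by apply: integral_ge0 => x _; apply: mule_ge0; rewrite ?poweR_ge0 ?lee_fin.
exists (rdf Mx A h); split.
- exact: measurable_rdf.
- by move=> x; exact: rdf_ge.
- apply: (le_trans (integral_rdf w0 mw t1 A1 mMx Mx0 strong mh h0)).
  apply: lee_wpmul2r; last by rewrite lee_fin le_max lexx.
  by apply: integral_ge0 => x _; apply: mule_ge0; rewrite ?poweR_ge0 ?lee_fin.
move=> x r y r0 xy.
have mB : measurable (qball setT rho x r) by exact: (measurable_qball ht).
have W0 : 0 <= \int[mu]_(z in qball setT rho x r) (w z)%:E.
  by apply: integral_ge0 => z _; rewrite lee_fin.
have CW0 : 0 <= Cd%:E * \int[mu]_(z in qball setT rho x r) (w z)%:E.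
  by apply: mule_ge0 => //; rewrite lee_fin ltW.
have loc g : measurable_fun setT g -> (forall x, 0 <= g x) ->
    \int[mu]_(x in qball setT rho x r) (g x * (w x)%:E) <=
    Cd%:E * \int[mu]_(z in qball setT rho x r) (w z)%:E * Mx g y.
  by move=> mg g0; apply: (integral_le_maxfun ht w0 mw w_gt0 wBoo wB base0 base_ball).
apply: (le_trans (integral_rdf_le w0 mw A1 mMx Mx0 mh h0 mB CW0 loc)).
rewrite muleA -EFinM; apply: lee_wpmul2r; first exact: rdf_ge0.
by apply: lee_wpmul2r => //; rewrite lee_fin le_max lexx orbT.
Qed.

Section ApCriterion.
Context (R : realType) (d : measure_display) (T : measurableType d).
Variable mu : {measure set T -> \bar R}.
Context (rho : T -> T -> R) (K1 K2 : R).
Hypothesis ht : homogeneous_type mu setT rho K1 K2.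
Local Notation B := (qball setT rho).

Lemma Ap_const_le (P L : R) (v : T -> R) : (1 < P)%R -> (0 <= L)%R ->
  (forall x, (0 <= v x)%R) -> measurable_fun setT v ->
  (forall x r, (0 < r)%R -> \int[mu]_(y in B x r) (v y)%:E = 0 \/
    exists a b : R, [/\ (0 <= a)%R, (0 <= b)%R, (a * b `^ (P - 1) <= L)%R,
      \int[mu]_(y in B x r) (v y)%:E <= a%:E * mu (B x r) &
      \int[mu]_(y in B x r) dual_weight v (P - 1)^-1 y <= b%:E * mu (B x r)]) ->
  Ap_weight mu setT rho P v /\ Ap_const mu setT rho P v <= L%:E.
Proof.
move=> P1 L0 v0 mv h.
have P10 : (0 < P - 1)%R by rewrite subr_gt0.
suff le : Ap_const mu setT rho P v <= L%:E.
  split => //; split => //; apply: (le_lt_trans le); exact: ltry.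
apply: ge_ereal_sup => _ [[x r] [_ /= r0] <-] /=.
have Boo : mu (B x r) < +oo by apply: (qball_finite ht).
have B0 : 0 < mu (B x r) by apply: (qball_gt0 ht).
have [m Em] : exists m, mu (B x r) = m%:E by exists (fine (mu (B x r))); rewrite fineK// ge0_fin_numE.
have m0 : (0 < m)%R by rewrite -lte_fin -Em.
have im : (mu (B x r))^-1 = (m^-1)%:E by rewrite Em inver gt_eqF.
rewrite /avg im; have [->|[a [b [a0 b0 ab ha hb]]]] := h x r r0.
  by rewrite mule0 mul0e lee_fin.
have le1 : (m^-1)%:E * \int[mu]_(y in B x r) (v y)%:E <= a%:E.
  by rewrite lee_pdivrMl// muleC -Em.
have le2 : (m^-1)%:E * \int[mu]_(y in B x r) dual_weight v (P - 1)^-1 y <= b%:E.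
  by rewrite lee_pdivrMl// muleC -Em.
apply: (@le_trans _ _ (a%:E * b%:E `^ (P - 1))); last by rewrite -EFinM lee_fin.
apply: lee_pmul => //.
- apply: mule_ge0; first by rewrite lee_fin invr_ge0 ltW.
  by apply: integral_ge0 => y _; rewrite lee_fin.
- exact: poweR_ge0.
apply: le_poweR => //; first exact: ltW.
apply: mule_ge0; first by rewrite lee_fin invr_ge0 ltW.
by apply: integral_ge0 => y _; exact: dual_weight_ge0.
Qed.

Context (P K : R) (w : T -> R).
Hypotheses (P1 : (1 < P)%R) (K1' : (1 <= K)%R) (Aw : Ap_weight mu setT rho P w)
  (AK : Ap_const mu setT rho P w <= K%:E).
Let e := (P - 1)^-1%R.
Let w0 x : (0 <= w x)%R. Proof. by have [h _ _] := Aw; exact: h. Qed.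
Let mw : measurable_fun setT w. Proof. by have [] := Aw. Qed.
Let mwE : measurable_fun setT (EFin \o w). Proof. exact/measurable_EFinP. Qed.
Let e0 : (0 < e)%R. Proof. by rewrite invr_gt0 subr_gt0. Qed.
Let K0 : (0 < K)%R. Proof. exact: lt_le_trans K1'. Qed.

Lemma Ap_mono (P' : R) : (P <= P')%R ->
  Ap_weight mu setT rho P' w /\
  Ap_const mu setT rho P' w <= ((1 + K `^ e) `^ (P' - 1))%:E.
Proof.
move=> PP; have P1' : (1 < P')%R by exact: lt_le_trans PP.
have P'0 : (0 < P' - 1)%R by rewrite subr_gt0.
have Ke0 : (0 <= K `^ e)%R by exact: powR_ge0.
apply: Ap_const_le => //; first exact: powR_ge0.
move=> x r r0; have [a [a0 Ea hb]] := Ap_ball ht P1 Aw AK (Logic.I : setT x) r0.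
have mB : measurable (B x r) by exact: (measurable_qball ht).
move: a0; rewrite le_eqVlt => /predU1P[a0|a0]; first by left; rewrite Ea -a0 mul0e.
right; have {hb} := hb a0; rewrite -/e => hb.
pose e' := (P' - 1)^-1%R; have e'0 : (0 < e')%R by rewrite invr_gt0.
have ee : (e' <= e)%R by rewrite lef_pV2 ?posrE ?subr_gt0// lerD2r.
exists a, (a `^ (- e') * (1 + K `^ e))%R; split.
- exact: ltW.
- by rewrite mulr_ge0 ?powR_ge0// addr_ge0.
- rewrite powRM ?powR_ge0 ?addr_ge0// -powRrM mulNr /e' mulVf ?gt_eqF// powR_inv1 ?(ltW a0)//.
  by rewrite mulrA divff ?mul1r// gt_eqF.
- by rewrite Ea.
apply: (@le_trans _ _ (\int[mu]_(y in B x r) ((a `^ (- e'))%:E * (1 + (a `^ e)%:E * dual_weight w e y)))).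
  have mdw u : measurable_fun (B x r) (dual_weight w u).
    by apply: measurable_dual_weight => //; exact: measurable_funS mw.
  apply: ge0_le_integral => //.
  - by move=> y _; exact: dual_weight_ge0.
  - by apply: measurable_funeM; apply: emeasurable_funD => //; apply: measurable_funeM.
  move=> y _; rewrite /dual_weight !poweR_EFin !inver !powR_eq0 (gt_eqF e0) (gt_eqF e'0) /= !andbT.
  have [wy|wy] := eqVneq (w y) 0%R.
    by rewrite gt0_muley ?lte_fin ?powR_gt0// addey// gt0_muley ?lte_fin ?powR_gt0// leey.
  have wy0 : (0 < w y)%R by rewrite lt_neqAle eq_sym wy w0.
  have -> : 1 + (a `^ e)%:E * ((w y `^ e)^-1)%:E = (1 + a `^ e * (w y `^ e)^-1)%:E by [].
  rewrite -EFinM lee_fin -!powRN.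
  have -> : (w y `^ (- e') = a `^ (- e') * (a / w y) `^ e')%R.
    rewrite powRM ?invr_ge0 ?(ltW a0) ?(ltW wy0)// mulrA (powRN a) mulVf ?gt_eqF ?powR_gt0// mul1r.
    by rewrite -powR_inv1 ?(ltW wy0)// -powRrM mulN1r.
  apply: ler_wpM2l; first exact: powR_ge0.
  have -> : (a `^ e * w y `^ (- e) = (a / w y) `^ e)%R.
    rewrite powRM ?invr_ge0 ?(ltW a0) ?(ltW wy0)//.
    by rewrite -(powR_inv1 (ltW wy0)) -powRrM mulN1r.
  have u0 : (0 <= a / w y)%R by rewrite divr_ge0// ltW.
  have [u1|u1] := leP (a / w y)%R 1%R.
    apply: (@le_trans _ _ 1%R); last by rewrite lerDl powR_ge0.
    by rewrite -[leRHS](congr1 (@^~ e') (powR1 R)); apply: le_powR => //; exact: ltW.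
  by apply: (@le_trans _ _ ((a / w y) `^ e)%R); [exact: ler_powR (ltW u1) _ _ ee|rewrite lerDr].
have mdw : measurable_fun (B x r) (dual_weight w e).
  by apply: measurable_dual_weight => //; exact: measurable_funS mw.
rewrite ge0_integralZl_EFin//; last 3 first.
- by move=> y _; rewrite adde_ge0// mule_ge0 ?dual_weight_ge0// lee_fin powR_ge0.
- by apply: emeasurable_funD => //; exact: measurable_funeM.
- exact: powR_ge0.
rewrite EFinM -muleA; apply: lee_wpmul2l; first by rewrite lee_fin powR_ge0.
rewrite ge0_integralD//; last 2 first.
- by move=> y _; rewrite mule_ge0 ?dual_weight_ge0// lee_fin powR_ge0.
- exact: measurable_funeM.
rewrite EFinD ge0_muleDl ?lee_fin// integral_cst// mul1e; apply: leeD => //.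
rewrite ge0_integralZl_EFin//; last 2 first.
- by move=> y _; exact: dual_weight_ge0.
- exact: powR_ge0.
apply: (le_trans (lee_wpmul2l _ hb)); first by rewrite lee_fin powR_ge0.
rewrite muleA -EFinM powRM ?invr_ge0 ?(ltW a0) ?(ltW K0)//.
rewrite (_ : (a `^ e * (K `^ e * a^-1 `^ e) = K `^ e)%R)//.
rewrite mulrCA -powRM ?invr_ge0 ?(ltW a0)// divff ?gt_eqF// powR1 mulr1//.
Qed.

Lemma Ap_ae_gt0 : (forall x r, (0 < r)%R -> 0 < \int[mu]_(y in B x r) (w y)%:E) ->
  mu.-negligible [set x | w x = 0%R].
Proof.
move=> w_gt0; have [x _] : exists x : T, True by exists point.
apply: (@negligibleS _ _ _ _ (\bigcup_(k : nat) (B x k.+1%:R `&` [set y | w y = 0%R]))).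
  move=> y wy; exists (Num.trunc (rho x y)) => //; split => //; split => //.
  exact: truncnS_gt.
apply: negligible_bigcup => k.
have r0 : (0 < k.+1%:R :> R)%R by [].
have mB : measurable (B x k.+1%:R) by exact: (measurable_qball ht).
have Boo : mu (B x k.+1%:R) < +oo by apply: (qball_finite ht).
have [a [a0 Ea hb]] := Ap_ball ht P1 Aw AK (Logic.I : setT x) r0.
have {}a0 : (0 < a)%R.
  rewrite lt_neqAle a0 andbT; apply/eqP => a_eq0.
  by have := w_gt0 x _ r0; rewrite Ea -a_eq0 mul0e ltxx.
have mdw : measurable_fun (B x k.+1%:R) (dual_weight w e).
  by apply: measurable_dual_weight => //; exact: measurable_funS mw.
have : mu.-integrable (B x k.+1%:R) (dual_weight w e).
  apply/integrableP; split => //.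
  rewrite (_ : \int[mu]_(y in _) _ = \int[mu]_(y in B x k.+1%:R) dual_weight w e y).
    by apply: (le_lt_trans (hb a0)); rewrite (mu_fine Boo) -EFinM ltry.
  by apply: eq_integral => y _; rewrite gee0_abs// dual_weight_ge0.
move/(integrable_ae mB); apply: negligibleS => y [By /= wy] /(_ By).
by rewrite /dual_weight wy poweR_EFin powR0 ?gt_eqF// inver eqxx.
Qed.

End ApCriterion.

Lemma real_majorant (R : realType) (K1 K2 P K t : R) : (1 < P)%R -> (1 < t)%R ->
  exists2 C : R, (1 <= C)%R &
  forall (d : measure_display) (T : measurableType d) (mu : {measure set T -> \bar R})
    (rho : T -> T -> R) (w : T -> R),
  homogeneous_type mu setT rho K1 K2 -> Ap_weight mu setT rho P w ->
  Ap_const mu setT rho P w <= K%:E ->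
  (forall x r, (0 < r)%R -> 0 < \int[mu]_(y in qball setT rho x r) (w y)%:E) ->
  forall h : T -> \bar R, measurable_fun setT h -> (forall x, 0 <= h x) ->
  0 < \int[mu]_x (h x `^ t * (w x)%:E) -> \int[mu]_x (h x `^ t * (w x)%:E) < +oo ->
  exists (H : T -> R) (N : set T), [/\ measurable_fun setT H /\ (forall x, (0 < H x)%R),
    measurable N /\ mu N = 0, forall x, ~ N x -> h x <= (H x)%:E,
    \int[mu]_x ((H x)%:E `^ t * (w x)%:E) <= C%:E * \int[mu]_x (h x `^ t * (w x)%:E) &
    forall x r, (0 < r)%R -> exists m : R, [/\ (0 < m)%R,
      \int[mu]_(y in qball setT rho x r) (H y * w y)%:E <=
        (C * m)%:E * \int[mu]_(y in qball setT rho x r) (w y)%:E &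
      forall y, qball setT rho x r y -> ~ N y -> (m <= H y)%R]].
Proof.
move=> P1 t1; have [C C1 hC] := A1_majorant K1 K2 K P1 t1.
have C0 : (0 < C)%R by exact: lt_le_trans C1.
exists C => // d T mu rho w ht Aw Kw w_gt0 h mh h0 hpos hfin.
have t0 : (0 < t)%R by exact: lt_trans t1.
have [w0' mw _] := Aw.
have w0 x : (0 <= w x)%R by exact: w0'.
have wE0 x : 0 <= (w x)%:E by rewrite lee_fin.
have mwE : measurable_fun setT (EFin \o w) by exact/measurable_EFinP.
have [G [mG hG intG locG]] := hC _ _ _ _ _ ht Aw Kw w_gt0 h mh h0.
have G0 x : 0 <= G x by exact: le_trans (hG x).
have mGw : measurable_fun setT (fun x => G x * (w x)%:E) by exact: emeasurable_funM.
have Gw0 x : 0 <= G x * (w x)%:E by exact: mule_ge0.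
have Gpos x : 0 < G x.
  rewrite lt_neqAle G0 andbT; apply/eqP => Gx0.
  have : \int[mu]_y (G y * (w y)%:E) = 0.
    apply: (integral_qball_eq0 ht (x := x)) => // r r0; apply/eqP.
    rewrite eq_le integral_ge0// andbT.
    by apply: le_trans (locG x r x r0 (qball_self ht _ r0)) _; rewrite -?Gx0 ?mule0.
  move=> Gw_eq0; move: hpos; suff -> : \int[mu]_x (h x `^ t * (w x)%:E) = 0 by rewrite ltxx.
  have : \int[mu]_y `|G y * (w y)%:E| = 0.
    by rewrite -[RHS]Gw_eq0; apply: eq_integral => y _; rewrite gee0_abs.
  move/(ae_eq_integral_abs _ measurableT mGw) => ae0.
  have mhw : measurable_fun setT (fun x => h x `^ t * (w x)%:E).
    by apply: emeasurable_funM => //; exact: (measurableT_comp (measurable_poweR t)).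
  rewrite (@ae_eq_integral _ _ _ mu setT (cst 0) (fun x => h x `^ t * (w x)%:E))//.
    by rewrite integral0_eq.
  apply: filterS ae0 => y /(_ Logic.I) /eqP; rewrite mule_eq0 => /orP[] /eqP y0 _.
    have -> : h y = 0 by apply: le_anti; rewrite h0 -y0 hG.
    by rewrite poweR0r ?gt_eqF// mul0e.
  by rewrite y0 mule0.
pose N := [set x | G x = +oo].
have mN : measurable N.
  by rewrite -[N]setTI; exact: (mG measurableT _ (emeasurable_set1 +oo)).
have mGtw : measurable_fun setT (fun x => G x `^ t * (w x)%:E).
  by apply: emeasurable_funM => //; exact: (measurableT_comp (measurable_poweR t)).
have N0 : mu N = 0.
  have Gfin : \int[mu]_x (G x `^ t * (w x)%:E) < +oo.
    apply: (le_lt_trans intG); move: hfin.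
    have I0 : 0 <= \int[mu]_x (h x `^ t * (w x)%:E) by exact: ltW.
    by case: (\int[mu]_x _) I0 => //= a _ _; rewrite -EFinM ltry.
  have : mu.-integrable setT (fun x => G x `^ t * (w x)%:E).
    apply/integrableP; split => //.
    rewrite (_ : \int[mu]_x `|_| = \int[mu]_x (G x `^ t * (w x)%:E))//.
    by apply: eq_integral => y _; rewrite gee0_abs// mule_ge0// poweR_ge0.
  move/(integrable_ae measurableT) => aefin.
  have wnull := Ap_ae_gt0 ht P1 Aw Kw w_gt0.
  apply: (measure_negligible mN); apply: negligibleS (negligibleU aefin wnull) => x /= Nx.
  have [wx|/eqP wx] := pselect (w x = 0%R); first by right.
  left => /(_ Logic.I); rewrite Nx poweRyr ?gt_eqF// gt0_mulye//.
  by rewrite lte_fin lt_neqAle eq_sym wx w0.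
pose H x := (fine (G x) + \1_N x)%R.
have HG x : ~ N x -> (H x)%:E = G x.
  move=> Nx; rewrite /H indicE memNset// addr0 fineK// ge0_fin_numE// ltey.
  exact/eqP.
have mH : measurable_fun setT H.
  by apply: measurable_funD => //; exact: (measurableT_comp (@fine_measurable R setT measurableT)).
have Hpos x : (0 < H x)%R.
  have [Nx|Nx] := pselect (N x).
    by rewrite /H indicE mem_set// ltr_wpDl// fine_ge0.
  by rewrite -lte_fin HG.
have mHE : measurable_fun setT (EFin \o H) by exact/measurable_EFinP.
have aeE (f g : T -> \bar R) D : (forall x, ~ N x -> f x = g x) -> ae_eq mu D f g.
  by move=> fg; exists N; split => // x /= nfg; apply: contrapT => /fg e; exact: nfg.
have HGloc D : measurable D ->
    \int[mu]_(y in D) (H y * w y)%:E = \int[mu]_(y in D) (G y * (w y)%:E).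
  move=> mD; apply: ge0_ae_eq_integral => //.
  - apply: (@measurable_funS _ _ _ _ setT) => //.
    by apply/measurable_EFinP; exact: measurable_funM.
  - exact: measurable_funS mGw.
  - by move=> y _; rewrite lee_fin mulr_ge0// ltW.
  by apply: aeE => y Ny; rewrite EFinM HG.
exists H, N; split => //.
- by move=> x Nx; rewrite HG.
- apply: le_trans intG.
  rewrite (@ge0_ae_eq_integral _ _ _ mu setT _ (fun x => G x `^ t * (w x)%:E))//.
  - by apply: emeasurable_funM => //; exact: (measurableT_comp (measurable_poweR t)).
  - by move=> x _; rewrite mule_ge0// poweR_ge0.
  - by move=> x _; rewrite mule_ge0// poweR_ge0.
  by apply: aeE => x Nx; rewrite HG.
move=> x r r0; set B := qball setT rho x r.
have mB : measurable B by exact: (measurable_qball ht).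
have Boo : mu B < +oo by apply: (qball_finite ht).
have B0 : 0 < mu B by apply: (qball_gt0 ht).
have W0 : 0 < \int[mu]_(y in B) (w y)%:E by exact: w_gt0.
have Woo : \int[mu]_(y in B) (w y)%:E < +oo by apply: (Ap_ball_fin ht P1 Aw Kw).
have [y By Ny] : exists2 y, B y & ~ N y.
  apply: contrapT => /forall2NP hN.
  have : mu B <= mu N.
    by apply: le_measure; rewrite ?inE// => z Bz; have [//|/contrapT] := hN z.
  by rewrite N0 leNgt B0.
have HB0 : 0 <= \int[mu]_(y in B) (H y * w y)%:E.
  by apply: integral_ge0 => z _; rewrite lee_fin mulr_ge0// ltW.
have [a Wa] : exists a, \int[mu]_(y in B) (w y)%:E = a%:E.
  by exists (fine (\int[mu]_(y in B) (w y)%:E)); rewrite fineK// ge0_fin_numE// ltW.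
have a0 : (0 < a)%R by rewrite -lte_fin -Wa.
have HW z : B z -> ~ N z -> \int[mu]_(y in B) (H y * w y)%:E <= (C * a * H z)%:E.
  move=> Bz Nz; rewrite HGloc//; apply: (le_trans (locG x r z r0 Bz)).
  by rewrite Wa -HG// !EFinM.
have [b Hb] : exists b, \int[mu]_(y in B) (H y * w y)%:E = b%:E.
  exists (fine (\int[mu]_(y in B) (H y * w y)%:E)); rewrite fineK// ge0_fin_numE//.
  exact: le_lt_trans (HW y By Ny) (ltry _).
have mHw : measurable_fun B (fun y => (H y * w y)%:E).
  apply: (@measurable_funS _ _ _ _ setT) => //.
  by apply/measurable_EFinP; exact: measurable_funM.
have b0 : (0 < b)%R.
  rewrite lt_neqAle -lee_fin -Hb HB0 andbT; apply/eqP => b_eq0.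
  have mHV : measurable_fun B (fun y => (H y)^-1%:E).
    apply: (@measurable_funS _ _ _ _ setT) => //; apply/measurable_EFinP.
    rewrite (_ : (fun y => _) = fun y => (H y `^ (-1))%R); last first.
      by apply/funext => z; rewrite powR_inv1// ltW.
    by apply: (measurableT_comp (@measurable_powR R (-1)%R)).
  have := @integral_eq0_mul _ _ _ mu B (fun y => (H y * w y)%:E) (fun y => (H y)^-1%:E) mB mHw mHV.
  rewrite Hb -b_eq0 => /(_ _ erefl) h'.
  have : \int[mu]_(y in B) (w y)%:E = 0.
    rewrite -[RHS]h'; last by move=> z _; rewrite lee_fin mulr_ge0// ltW.
    by apply: eq_integral => z _; rewrite -EFinM mulrA mulVf ?mul1r// gt_eqF.
  by rewrite Wa => -[a_eq0]; rewrite a_eq0 ltxx in a0.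
exists (b / (C * a))%R; split.
- by rewrite divr_gt0// mulr_gt0.
- rewrite Hb Wa -EFinM lee_fin; suff -> : (C * (b / (C * a)) * a = b)%R by [].
  by field; rewrite !gt_eqF.
move=> z Bz Nz; rewrite ler_pdivrMr ?mulr_gt0// mulrC -lee_fin -Hb; exact: HW.
Qed.

(** * Extrapolation *)

Section PowerInequalities.
Context (R : realType).
Implicit Types (a b x y m r e s k : R).

Lemma powRE x y : (0 < x)%R -> (x `^ y = expR (y * ln x))%R.
Proof. by move=> x0; rewrite /powR gt_eqF. Qed.

(* With u = x y / (m a) and z = (a / y)^e the left side is
   m^(s e1) a^(-e1) u^(s e1) z^(1 - s e1): this fixes [e1]. *)
Lemma powR_interpolation x y m a e e1 s :
  (0 < x)%R -> (0 < y)%R -> (0 < m)%R -> (0 < a)%R -> (0 < e)%R -> (0 < s)%R -> (0 < e1)%R ->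
  (e1 * (1 + s * (1 + e)) = e)%R ->
  (x `^ (s * e1) * y `^ (- e1) <=
   m `^ (s * e1) * a `^ (- e1) * ((m * a)^-1 * (x * y) + a `^ e * y `^ (- e)))%R.
Proof.
move=> x0 y0 m0 a0 e0 s0 e10 ee.
rewrite !powRE//; set X := ln x; set Y := ln y; set M := ln m; set A := ln a.
have -> : ((m * a)^-1 * (x * y) = expR (X + Y - M - A))%R.
  by rewrite !expRD !expRN !lnK ?posrE// invfM; ring.
rewrite -!expRD; pose l := (s * e1)%R.
have l0 : (0 < l)%R by exact: mulr_gt0.
have l1 : (l < 1)%R.
  by rewrite -(ltr_pM2l (_ : 0 < 1 + e)%R) ?addr_gt0//; rewrite /l; nra.
set p := (X + Y - M - A)%R; set q := (e * A + - e * Y)%R.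
have he : (l - (1 - l) * e = - e1)%R by rewrite /l; lra.
have key : (s * e1 * X + - e1 * Y = s * e1 * M + - e1 * A + (l * p + (1 - l) * q))%R.
  by rewrite -he /l /p /q; ring.
rewrite key (expRD (s * e1 * M + _)); apply: ler_wpM2l; first exact: expR_ge0.
have [pq|pq] := leP p q.
  apply: (@le_trans _ _ (expR q)); last by rewrite lerDr expR_ge0.
  by rewrite ler_expR; nra.
apply: (@le_trans _ _ (expR p)); last by rewrite lerDl expR_ge0.
by rewrite ler_expR; nra.
Qed.

End PowerInequalities.

Section MajorantWeights.
Context (R : realType) (d : measure_display) (T : measurableType d).
Variable mu : {measure set T -> \bar R}.
Context (rho : T -> T -> R) (K1 K2 : R).
Hypothesis ht : homogeneous_type mu setT rho K1 K2.
Local Notation B := (qball setT rho).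
Context (P K C : R) (w H : T -> R) (N : set T).
Hypotheses (P1 : (1 < P)%R) (K1' : (1 <= K)%R) (Aw : Ap_weight mu setT rho P w)
  (AK : Ap_const mu setT rho P w <= K%:E).
Hypothesis w_gt0 : forall x r, (0 < r)%R -> 0 < \int[mu]_(y in B x r) (w y)%:E.
Hypotheses (C1 : (1 <= C)%R) (mH : measurable_fun setT H) (H0 : forall x, (0 < H x)%R).
Hypotheses (mN : measurable N) (N0 : mu N = 0).
Hypothesis loc : forall x r, (0 < r)%R -> exists m : R, [/\ (0 < m)%R,
  \int[mu]_(y in B x r) (H y * w y)%:E <= (C * m)%:E * \int[mu]_(y in B x r) (w y)%:E &
  forall y, B x r y -> ~ N y -> (m <= H y)%R].
Let e := (P - 1)^-1%R.
Let w0 x : (0 <= w x)%R. Proof. by have [h _ _] := Aw; exact: h. Qed.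
Let mw : measurable_fun setT w. Proof. by have [] := Aw. Qed.
Let mwE : measurable_fun setT (EFin \o w). Proof. exact/measurable_EFinP. Qed.
Let e0 : (0 < e)%R. Proof. by rewrite invr_gt0 subr_gt0. Qed.
Let K0 : (0 < K)%R. Proof. exact: lt_le_trans K1'. Qed.
Let C0 : (0 < C)%R. Proof. exact: lt_le_trans C1. Qed.

Let ball x r : (0 < r)%R -> exists a m : R, [/\ (0 < a)%R, (0 < m)%R,
  \int[mu]_(y in B x r) (w y)%:E = a%:E * mu (B x r),
  \int[mu]_(y in B x r) dual_weight w e y <= ((K / a) `^ e)%:E * mu (B x r) &
  \int[mu]_(y in B x r) (H y * w y)%:E <= (C * m * a)%:E * mu (B x r) /\
  forall y, B x r y -> ~ N y -> (m <= H y)%R].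
Proof.
move=> r0; have [a [a0 Ea hb]] := Ap_ball ht P1 Aw AK (Logic.I : setT x) r0.
have {}a0 : (0 < a)%R.
  rewrite lt_neqAle a0 andbT; apply/eqP => a_eq0.
  by have := w_gt0 x r0; rewrite Ea -a_eq0 mul0e ltxx.
have [m [m0 hm Hm]] := loc x r0.
exists a, m; split => //; first exact: hb.
by split => //; apply: (le_trans hm); rewrite Ea (EFinM (C * m)) muleA.
Qed.

Let ae_le (f g : T -> \bar R) D : measurable D -> measurable_fun setT f -> measurable_fun setT g ->
  (forall x, 0 <= f x) -> (forall x, 0 <= g x) ->
  (forall x, D x -> ~ N x -> f x <= g x) ->
  \int[mu]_(x in D) f x <= \int[mu]_(x in D) g x.
Proof.
move=> mD mf mg f0 g0 fg; apply: ae_ge0_le_integral => //.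
- exact: measurable_funS mf.
- exact: measurable_funS mg.
exists N; split => // x /= nfg; apply: contrapT => Nx; apply: nfg => Dx; exact: fg.
Qed.

Lemma Ap_majorant_mul :
  Ap_weight mu setT rho P (fun y => H y * w y)%R /\
  Ap_const mu setT rho P (fun y => H y * w y)%R <= (C * K)%:E.
Proof.
apply: (Ap_const_le ht) => //.
- by rewrite mulr_ge0// ltW.
- by move=> y; rewrite mulr_ge0// ltW.
- exact: measurable_funM.
move=> x r r0; right; have [a [m [a0 m0 Ea hb [hm Hm]]]] := ball x r0.
have mB : measurable (B x r) by exact: (measurable_qball ht).
exists (C * m * a)%R, (m `^ (- e) * (K / a) `^ e)%R; split => //.
- by rewrite !mulr_ge0// ltW.
- by rewrite mulr_ge0 ?powR_ge0.
- rewrite powRM ?powR_ge0// -!powRrM mulNr /e mulVf ?gt_eqF ?subr_gt0//.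
  rewrite powR_inv1 ?(ltW m0)// powRr1 ?divr_ge0 ?(ltW a0) ?(ltW K0)//.
  suff -> : (C * m * a * (m^-1 * (K / a)) = C * K)%R by [].
  by field; rewrite !gt_eqF.
have mdw : measurable_fun setT (dual_weight w e) by exact: measurable_dual_weight.
apply: (@le_trans _ _ (\int[mu]_(y in B x r) ((m `^ (- e))%:E * dual_weight w e y))).
  apply: ae_le => //.
  - by apply: measurable_dual_weight => //; exact: measurable_funM.
  - exact: measurable_funeM.
  - by move=> y; exact: dual_weight_ge0.
  - by move=> y; rewrite mule_ge0 ?dual_weight_ge0// lee_fin powR_ge0.
  move=> y By Ny; have mHy := Hm y By Ny.
  rewrite -/e /dual_weight !poweR_EFin !inver !powR_eq0 (gt_eqF e0) mulf_eq0 (gt_eqF (H0 y)) /= !andbT.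
  have [wy|wy] := eqVneq (w y) 0%R; first by rewrite gt0_muley ?lte_fin ?powR_gt0.
  have wy0 : (0 < w y)%R by rewrite lt_neqAle eq_sym wy w0.
  rewrite -EFinM lee_fin powRN -invfM lef_pV2 ?posrE ?mulr_gt0 ?powR_gt0 ?mulr_gt0//.
  rewrite powRM ?w0 ?(ltW (H0 y))//; apply: ler_wpM2r; first exact: powR_ge0.
  by apply: le_powR => //; exact: ltW.
rewrite ge0_integralZl_EFin//; last 3 first.
- by move=> y _; exact: dual_weight_ge0.
- exact: measurable_funS mdw.
- exact: powR_ge0.
by rewrite EFinM -muleA; apply: lee_wpmul2l => //; rewrite lee_fin powR_ge0.
Qed.

Context (s e1 : R).
Hypotheses (s0 : (0 < s)%R) (e10 : (0 < e1)%R) (ee : (e1 * (1 + s * (1 + e)) = e)%R).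

Lemma Ap_majorant_div :
  Ap_weight mu setT rho (1 + e1^-1) (fun y => H y `^ (- s) * w y)%R /\
  Ap_const mu setT rho (1 + e1^-1) (fun y => H y `^ (- s) * w y)%R <= ((C + K `^ e) `^ e1^-1)%:E.
Proof.
have mHs : measurable_fun setT (fun y => H y `^ (- s))%R.
  by apply: (measurableT_comp (@measurable_powR R (- s)%R)).
have mHw : measurable_fun setT (fun y => (H y * w y)%:E).
  by apply/measurable_EFinP; exact: measurable_funM.
have Pe : (1 + e1^-1 - 1 = e1^-1)%R by rewrite addrAC subrr add0r.
have Ke0 : (0 <= K `^ e)%R by exact: powR_ge0.
apply: (Ap_const_le ht) => //.
- by rewrite ltrDl invr_gt0.
- exact: powR_ge0.
- by move=> y; rewrite mulr_ge0// powR_ge0.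
- exact: measurable_funM.
move=> x r r0; right; have [a [m [a0 m0 Ea hb [hm Hm]]]] := ball x r0.
have mB : measurable (B x r) by exact: (measurable_qball ht).
rewrite Pe invrK.
exists (m `^ (- s) * a)%R, (m `^ (s * e1) * a `^ (- e1) * (C + K `^ e))%R; split => //.
- by rewrite mulr_ge0 ?powR_ge0// ltW.
- by rewrite !mulr_ge0 ?powR_ge0// addr_ge0// ltW.
- rewrite powRM ?mulr_ge0 ?powR_ge0 ?addr_ge0 ?(ltW C0)//.
  rewrite powRM ?powR_ge0// -!powRrM mulfK ?gt_eqF// mulNr mulfV ?gt_eqF//.
  rewrite powR_inv1 ?(ltW a0)// powRN.
  suff -> : (((m `^ s)^-1 * a * (m `^ s * a^-1 * (C + K `^ e) `^ e1^-1)) =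
    (C + K `^ e) `^ e1^-1)%R by [].
  by field; rewrite !gt_eqF// powR_gt0.
- rewrite EFinM -muleA -Ea.
  have <- : \int[mu]_(y in B x r) ((m `^ (- s))%:E * (w y)%:E) =
      (m `^ (- s))%:E * \int[mu]_(y in B x r) (w y)%:E.
    apply: ge0_integralZl_EFin => //.
    - by move=> y _; rewrite lee_fin.
    - exact: measurable_funS mwE.
    - exact: powR_ge0.
  apply: ae_le => //.
  + by apply/measurable_EFinP; exact: measurable_funM.
  + exact: measurable_funeM.
  + by move=> y; rewrite lee_fin mulr_ge0// powR_ge0.
  + by move=> y; rewrite mule_ge0 ?lee_fin// powR_ge0.
  move=> y By Ny; rewrite -EFinM lee_fin; apply: ler_wpM2r => //.
  rewrite !powRN lef_pV2 ?posrE ?powR_gt0//.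
  by apply: le_powR; [exact: ltW|exact: ltW|exact: Hm].
have mdw : measurable_fun setT (dual_weight w e) by exact: measurable_dual_weight.
pose c := (m `^ (s * e1) * a `^ (- e1))%R.
have c0 : (0 < c)%R by rewrite mulr_gt0// powR_gt0.
have ma0 : (0 < (m * a)^-1)%R by rewrite invr_gt0 mulr_gt0.
have t10 y : 0 <= (m * a)^-1%:E * (H y * w y)%:E.
  by rewrite -EFinM lee_fin !mulr_ge0// ltW.
have t20 y : 0 <= (a `^ e)%:E * dual_weight w e y.
  by rewrite mule_ge0 ?dual_weight_ge0// lee_fin powR_ge0.
have mt1 : measurable_fun setT (fun y => (m * a)^-1%:E * (H y * w y)%:E) by exact: measurable_funeM.
have mt2 : measurable_fun setT (fun y => (a `^ e)%:E * dual_weight w e y) by exact: measurable_funeM.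
apply: (@le_trans _ _ (\int[mu]_(y in B x r) (c%:E *
    ((m * a)^-1%:E * (H y * w y)%:E + (a `^ e)%:E * dual_weight w e y)))).
  apply: ae_le => //.
  - by apply: measurable_dual_weight => //; exact: measurable_funM.
  - by apply: measurable_funeM; exact: emeasurable_funD.
  - by move=> y; exact: dual_weight_ge0.
  - by move=> y; rewrite mule_ge0 ?lee_fin ?(ltW c0)// adde_ge0.
  move=> y By Ny; rewrite /dual_weight !poweR_EFin !inver !powR_eq0 (gt_eqF e0) (gt_eqF e10).
  rewrite mulf_eq0 (gt_eqF (powR_gt0 _ (H0 y))) /= !andbT.
  have [wy|wy] := eqVneq (w y) 0%R.
    by rewrite (gt0_muley (x := (a `^ e)%:E)) ?lte_fin ?powR_gt0// addey// gt0_muley ?lte_fin.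
  have wy0 : (0 < w y)%R by rewrite lt_neqAle eq_sym wy w0.
  rewrite -[leRHS]/((c * ((m * a)^-1 * (H y * w y) + a `^ e * (w y `^ e)^-1))%:E).
  rewrite lee_fin -!powRN powRM ?powR_ge0// -powRrM mulrNN.
  exact: powR_interpolation.
rewrite ge0_integralZl_EFin//; last 3 first.
- by move=> y _; rewrite adde_ge0.
- by apply: (@measurable_funS _ _ _ _ setT) => //; exact: emeasurable_funD.
- exact: ltW.
rewrite -/c (EFinM c) -muleA; apply: lee_wpmul2l; first by rewrite lee_fin ltW.
rewrite ge0_integralD//; last 2 first.
- exact: measurable_funS mt1.
- exact: measurable_funS mt2.
rewrite ge0_integralZl_EFin//; last 3 first.
- by move=> y _; rewrite lee_fin mulr_ge0// ltW.
- exact: measurable_funS mHw.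
- exact: ltW.
rewrite ge0_integralZl_EFin//; last 3 first.
- by move=> y _; exact: dual_weight_ge0.
- exact: measurable_funS mdw.
- exact: powR_ge0.
rewrite EFinD ge0_muleDl ?lee_fin ?(ltW C0)//; apply: leeD.
  apply: (le_trans (lee_wpmul2l _ hm)); first by rewrite lee_fin ltW.
  rewrite muleA -EFinM (_ : ((m * a)^-1 * (C * m * a) = C)%R)//.
  by field; rewrite !gt_eqF.
apply: (le_trans (lee_wpmul2l _ hb)); first by rewrite lee_fin powR_ge0.
rewrite muleA -EFinM powRM ?invr_ge0 ?(ltW a0) ?(ltW K0)//.
by rewrite mulrCA -powRM ?invr_ge0 ?(ltW a0)// divff ?gt_eqF// powR1 mulr1.
Qed.

End MajorantWeights.

Section Pointwise.
Context (R : realType).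
Implicit Types (r k x s : R) (a b : \bar R).

Lemma le_powRN r (x y : R) : (r <= 0)%R -> (0 < x)%R -> (x <= y)%R -> (y `^ r <= x `^ r)%R.
Proof.
move=> r0 x0 xy; rewrite -[r]opprK !(powRN _ (- r)).
have y0 : (0 < y)%R by exact: lt_le_trans xy.
rewrite lef_pV2 ?posrE ?powR_gt0//.
by apply: le_powR; rewrite ?oppr_ge0// ltW.
Qed.

Lemma mul_le_poweR b r k x : 0 <= b -> (1 < r)%R -> (0 < k)%R -> (0 < x)%R ->
  b * x%:E <= (k `^ (1 - r))%:E * b `^ r + k%:E * x%:E `^ (r / (r - 1)).
Proof.
move=> b0 r1 k0 x0; have r0 : (0 < r)%R by exact: lt_trans r1.
have r10 : (0 < r - 1)%R by rewrite subr_gt0.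
have h0 : 0 <= k%:E * x%:E `^ (r / (r - 1)) by rewrite mule_ge0 ?poweR_ge0// lee_fin ltW.
case: b b0 => [b|_|//]; last first.
  rewrite poweRyr ?gt_eqF// gt0_muley ?lte_fin ?powR_gt0//.
  by rewrite addye ?leey// -ltNye; apply: lt_le_trans h0.
rewrite lee_fin => b0; rewrite !poweR_EFin -!EFinM -EFinD lee_fin.
have [h|h] := leP x ((b / k) `^ (r - 1))%R.
  apply: ler_wpDr; first by rewrite mulr_ge0 ?powR_ge0// ltW.
  apply: (le_trans (ler_wpM2l b0 h)).
  rewrite powRM ?invr_ge0 ?(ltW k0)// mulrA mulr_powRB1// mulrC.
  rewrite -powR_inv1 ?(ltW k0)// -powRrM; suff -> : (-1 * (r - 1) = 1 - r)%R by [].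
  by ring.
apply: ler_wpDl; first by rewrite mulr_ge0 ?powR_ge0.
have bk : (b <= k * x `^ (r - 1)^-1)%R.
  rewrite mulrC -ler_pdivrMr//.
  have bk0 : (0 <= b / k)%R by rewrite divr_ge0// ltW.
  have := le_powR (ltW (_ : 0 < (r - 1)^-1))%R (powR_ge0 _ _) (ltW h).
  rewrite invr_gt0 => /(_ r10); rewrite -powRrM divff ?gt_eqF// powRr1//.
apply: (le_trans (ler_wpM2r (ltW x0) bk)); rewrite -mulrA.
rewrite (_ : r / (r - 1) = (r - 1)^-1 + 1)%R; last by field; rewrite gt_eqF.
by rewrite powRD ?(powRr1 (ltW x0))// (gt_eqF x0) implybT.
Qed.

Lemma mul_powRN_le a r x : (0 < r < 1)%R -> 0 <= a -> (0 < x)%R -> a `^ (r / 2) <= x%:E ->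
  a * (x `^ (- (2 * (1 - r) / r)))%:E <= a `^ r.
Proof.
move=> /andP[r0 /ltW r1] a0 x0; have r20 : (0 < r / 2)%R by exact: divr_gt0.
case: a a0 => [a|_|//]; last by rewrite poweRyr ?gt_eqF.
rewrite !poweR_EFin !lee_fin le_eqVlt => /predU1P[<- _|a0 h].
  by rewrite mul0r powR_ge0.
rewrite -(mulr_powRB1 (ltW a0) r0); apply: ler_wpM2l; first exact: ltW.
rewrite (_ : r - 1 = r / 2 * - (2 * (1 - r) / r))%R; last by field; rewrite gt_eqF.
rewrite powRrM; apply: le_powRN => //; last exact: powR_gt0.
by rewrite oppr_le0 divr_ge0 ?mulr_ge0 ?subr_ge0// ltW.
Qed.

Lemma poweR_le_mul_powRN a r k x : (0 < r < 1)%R -> 0 <= a -> a < +oo -> (0 < k)%R -> (0 < x)%R ->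
  a `^ r <= (k `^ r)%:E * x%:E `^ 2 + (k `^ (r - 1))%:E * (a * (x `^ (- (2 * (1 - r) / r)))%:E).
Proof.
case: a => [a|//|//] /andP[r0 r1] + _ k0 x0.
rewrite !poweR_EFin -!EFinM -EFinD !lee_fin => a0.
have x2 : (0 < k * x `^ (2 / r))%R by rewrite mulr_gt0// powR_gt0.
have [h|h] := leP a (k * x `^ (2 / r))%R.
  apply: ler_wpDr; first by rewrite !mulr_ge0 ?powR_ge0.
  apply: (le_trans (le_powR (ltW r0) a0 h)).
  by rewrite powRM ?powR_ge0 ?(ltW k0)// -powRrM divfK// gt_eqF.
apply: ler_wpDl; first by rewrite mulr_ge0 ?powR_ge0.
rewrite -(mulr_powRB1 a0 r0) [leRHS]mulrCA; apply: ler_wpM2l => //.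
apply: (le_trans (le_powRN _ x2 (ltW h))); first by rewrite subr_le0 ltW.
rewrite powRM ?powR_ge0 ?(ltW k0)// -powRrM.
rewrite (_ : 2 / r * (r - 1) = - (2 * (1 - r) / r))%R//; ring.
Qed.

Lemma le_absorb (u v : \bar R) : 0 <= u -> u < +oo -> u <= v + 2^-1%:E * u -> u <= 2%:E * v.
Proof.
case: u => [u|//|//] + _; rewrite lee_fin => u0.
case: v => [v| |]; first by rewrite -!EFinM -EFinD !lee_fin; lra.
- by rewrite gt0_muley ?leey.
- by rewrite addNye leeNy_eq.
Qed.

End Pointwise.

Section Extrapolation.
Context (R : realType) (K1 K2 P K r : R).
Hypotheses (P1 : (1 < P)%R) (K1' : (1 <= K)%R) (r0 : (0 < r)%R).

(* The weight [w] stays in a fixed A_P class with constant [K]; the test weights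
   [v] are drawn from A_P0 with constant [L]. *)
Definition extrapolates (P0 L : R) := forall Nc : R, (0 < Nc)%R ->
  exists2 N : R, (0 < N)%R &
  forall (d : measure_display) (T : measurableType d) (mu : {measure set T -> \bar R})
    (rho : T -> T -> R) (w : T -> R) (A B : T -> \bar R),
  homogeneous_type mu setT rho K1 K2 -> Ap_weight mu setT rho P w ->
  Ap_const mu setT rho P w <= K%:E ->
  (forall x s, (0 < s)%R -> 0 < \int[mu]_(y in qball setT rho x s) (w y)%:E) ->
  measurable_fun setT A -> (forall x, 0 <= A x) ->
  measurable_fun setT B -> (forall x, 0 <= B x) ->
  \int[mu]_x (A x `^ r * (w x)%:E) < +oo ->
  (forall v : T -> R, Ap_weight mu setT rho P0 v -> Ap_const mu setT rho P0 v <= L%:E ->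
    \int[mu]_x (A x * (v x)%:E) < +oo ->
    \int[mu]_x (A x * (v x)%:E) <= Nc%:E * \int[mu]_x (B x * (v x)%:E)) ->
  \int[mu]_x (A x `^ r * (w x)%:E) <= N%:E * \int[mu]_x (B x `^ r * (w x)%:E).

Lemma extrapolation_eq1 : r = 1%R -> extrapolates P K.
Proof.
move=> r1 Nc Nc0; exists Nc => // d T mu rho w A B _ Aw AK _ mA A0 mB B0.
have e (f : T -> \bar R) : (forall x, 0 <= f x) ->
    \int[mu]_x (f x `^ r * (w x)%:E) = \int[mu]_x (f x * (w x)%:E).
  by move=> f0; apply: eq_integral => x _; rewrite r1 poweRe1.
by rewrite !e// => Afin; apply.
Qed.

Lemma extrapolation_gt1 : (1 < r)%R -> exists2 L : R, (1 <= L)%R & extrapolates P L.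
Proof.
move=> r1; have r10 : (0 < r - 1)%R by rewrite subr_gt0.
pose t := (r / (r - 1))%R.
have t1 : (1 < t)%R by rewrite /t ltr_pdivlMr// mul1r ltrBlDr ltrDl.
have t0 : (0 < t)%R by exact: lt_trans t1.
have [C C1 hC] := real_majorant K1 K2 K P1 t1.
have C0 : (0 < C)%R by exact: lt_le_trans C1.
exists (C * K)%R; first by rewrite -[leLHS]mul1r ler_pM.
move=> Nc Nc0; pose k := (2 * Nc * C)^-1%R.
have k0 : (0 < k)%R by rewrite invr_gt0 !mulr_gt0.
exists (2 * (Nc * k `^ (1 - r)))%R; first by rewrite !mulr_gt0// powR_gt0.
move=> d T mu rho w A B ht Aw AK w_gt0 mA A0 mB B0 Ifin ext.
have [w0' mw _] := Aw.
have w0 x : 0 <= (w x)%:E by rewrite lee_fin w0'.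
have mwE : measurable_fun setT (EFin \o w) by exact/measurable_EFinP.
have mpw (f : T -> \bar R) s : measurable_fun setT f -> measurable_fun setT (fun x => f x `^ s * (w x)%:E).
  by move=> mf; exact: measurable_poweR_w.
have pw0 (f : T -> \bar R) s x : 0 <= f x `^ s * (w x)%:E by rewrite mule_ge0// poweR_ge0.
have J0 : 0 <= \int[mu]_x (B x `^ r * (w x)%:E) by exact: integral_ge0.
have I0 : 0 <= \int[mu]_x (A x `^ r * (w x)%:E) by exact: integral_ge0.
have N'0 : (0 <= 2 * (Nc * k `^ (1 - r)))%R by rewrite !mulr_ge0 ?powR_ge0// ltW.
have [->|Ipos] := eqVneq (\int[mu]_x (A x `^ r * (w x)%:E)) 0; first by rewrite mule_ge0.
have {}Ipos : 0 < \int[mu]_x (A x `^ r * (w x)%:E) by rewrite lt_neqAle eq_sym Ipos.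
pose h x := A x `^ (r - 1).
have mh : measurable_fun setT h by exact: (measurableT_comp (measurable_poweR _)).
have h0 x : 0 <= h x by exact: poweR_ge0.
have hE : \int[mu]_x (h x `^ t * (w x)%:E) = \int[mu]_x (A x `^ r * (w x)%:E).
  by apply: eq_integral => x _; rewrite /h -poweRrM mulrC /t divfK// gt_eqF.
have [H [N [[mH H0] [mN N0] hH intH loc]]] := hC _ _ _ _ _ ht Aw AK w_gt0 h mh h0
  (eq_ind_r (fun u => 0 < u) Ipos hE) (eq_ind_r (fun u => u < +oo) Ifin hE).
rewrite hE in intH.
have [Av vK] := Ap_majorant_mul ht P1 K1' Aw AK w_gt0 C1 mH H0 mN N0 loc.
have mHE : measurable_fun setT (EFin \o H) by exact/measurable_EFinP.
have mHt : measurable_fun setT (fun x => (H x)%:E `^ t * (w x)%:E) by exact: (mpw (EFin \o H)).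
have Ht0 x : 0 <= (H x)%:E `^ t * (w x)%:E by exact: (pw0 (EFin \o H)).
have mfv (f : T -> \bar R) : measurable_fun setT f ->
    measurable_fun setT (fun x => f x * (H x * w x)%:E).
  move=> mf; apply: emeasurable_funM => //; apply/measurable_EFinP; exact: measurable_funM.
have fv0 (f : T -> \bar R) x : (forall x, 0 <= f x) -> 0 <= f x * (H x * w x)%:E.
  by move=> f0; rewrite mule_ge0// lee_fin mulr_ge0 ?w0' ?(ltW (H0 x)).
have split_le (f : T -> \bar R) c : measurable_fun setT f -> (forall x, 0 <= f x) -> (0 < c)%R ->
    \int[mu]_x (f x * (H x * w x)%:E) <= (c `^ (1 - r))%:E * \int[mu]_x (f x `^ r * (w x)%:E) +
      (c * C)%:E * \int[mu]_x (A x `^ r * (w x)%:E).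
  move=> mf f0 c0.
  apply: (@le_trans _ _ (\int[mu]_x ((c `^ (1 - r))%:E * (f x `^ r * (w x)%:E) +
      c%:E * ((H x)%:E `^ t * (w x)%:E)))).
    apply: ge0_le_integral => //.
    - by move=> x _; exact: fv0.
    - exact: mfv.
    - by apply: emeasurable_funD; apply: measurable_funeM; [exact: mpw|exact: mHt].
    move=> x _; rewrite !muleA -ge0_muleDl ?mule_ge0 ?poweR_ge0 ?lee_fin ?powR_ge0 ?(ltW c0)//.
    by rewrite EFinM muleA; apply: lee_wpmul2r => //; exact: mul_le_poweR.
  rewrite ge0_integralD//; last 4 first.
  - by move=> x _; rewrite mule_ge0// lee_fin powR_ge0.
  - by apply: measurable_funeM; exact: mpw.
  - by move=> x _; rewrite mule_ge0// lee_fin ltW.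
  - by apply: measurable_funeM; exact: mHt.
  rewrite ge0_integralZl_EFin//; [|exact: mpw|exact: powR_ge0].
  rewrite ge0_integralZl_EFin//; last exact: ltW.
  by rewrite (EFinM c) -muleA; apply: leeD => //; apply: lee_wpmul2l; rewrite ?lee_fin ?(ltW c0).
have Avfin : \int[mu]_x (A x * (H x * w x)%:E) < +oo.
  apply: (le_lt_trans (split_le A 1%R mA A0 ltr01)); rewrite powR1 mul1e mul1r.
  have : \int[mu]_x (A x `^ r * (w x)%:E) \is a fin_num by rewrite ge0_fin_numE.
  by move=> /fineK <-; rewrite -EFinM -EFinD ltry.
rewrite EFinM -muleA; apply: le_absorb => //.
apply: (@le_trans _ _ (\int[mu]_x (A x * (H x * w x)%:E))).
  apply: ae_ge0_le_integral => //.
  - exact: mpw.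
  - by move=> x _; exact: fv0.
  - exact: mfv.
  exists N; split => // x /= nle; apply: contrapT => Nx; apply: nle => _.
  rewrite EFinM muleA; apply: lee_wpmul2r => //.
  by rewrite -poweRB1M// muleC; apply: lee_wpmul2l => //; exact: hH.
apply: (le_trans (ext _ Av vK Avfin)).
apply: (le_trans (lee_wpmul2l _ (split_le B k mB B0 k0))); first by rewrite lee_fin ltW.
rewrite ge0_muleDr ?mule_ge0 ?lee_fin ?powR_ge0 ?mulr_ge0 ?(ltW k0) ?(ltW C0)//.
rewrite !muleA -!EFinM (_ : (Nc * (k * C) = 2^-1)%R)//.
by rewrite /k; field; rewrite !gt_eqF.
Qed.

Lemma extrapolation_lt1 : (r < 1)%R ->
  exists P0 L : R, [/\ (1 < P0)%R, (1 <= L)%R & extrapolates P0 L].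
Proof.
move=> r1; have r01 : (0 < r < 1)%R by rewrite r0.
have two1 : (1 < 2 :> R)%R by rewrite ltr1n.
have [C C1 hC] := real_majorant K1 K2 K P1 two1.
have C0 : (0 < C)%R by exact: lt_le_trans C1.
pose e := (P - 1)^-1%R.
have e0 : (0 < e)%R by rewrite invr_gt0 subr_gt0.
pose s := (2 * (1 - r) / r)%R.
have s0 : (0 < s)%R by rewrite divr_gt0// mulr_gt0// subr_gt0.
pose e1 := (e / (1 + s * (1 + e)))%R.
have den0 : (0 < 1 + s * (1 + e))%R by rewrite addr_gt0// mulr_gt0// addr_gt0.
have e10 : (0 < e1)%R by exact: divr_gt0.
have ee : (e1 * (1 + s * (1 + e)) = e)%R by rewrite /e1 divfK// gt_eqF.
exists (1 + e1^-1)%R, ((C + K `^ e) `^ e1^-1)%R; split.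
- by rewrite ltrDl invr_gt0.
- rewrite -[leLHS](congr1 (@^~ e1^-1%R) (powR1 R)); apply: le_powR => //.
    by rewrite invr_ge0 ltW.
  by apply: (le_trans C1); rewrite lerDl powR_ge0.
move=> Nc Nc0; pose k := ((4 * C)^-1 `^ r^-1)%R.
have C40 : (0 < (4 * C)^-1)%R by rewrite invr_gt0 mulr_gt0.
have k0 : (0 < k)%R by exact: powR_gt0.
have kr : (k `^ r = (4 * C)^-1)%R by rewrite /k -powRrM mulVf ?gt_eqF// powRr1// ltW.
exists (2 * (2^-1 + k `^ (r - 1) * Nc))%R.
  by rewrite mulr_gt0// addr_gt0 ?invr_gt0// mulr_gt0// powR_gt0.
move=> d T mu rho w A B ht Aw AK w_gt0 mA A0 mB B0 Ifin ext.
have [w0' mw _] := Aw.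
have w0 x : 0 <= (w x)%:E by rewrite lee_fin w0'.
have mwE : measurable_fun setT (EFin \o w) by exact/measurable_EFinP.
have mpw (f : T -> \bar R) q : measurable_fun setT f -> measurable_fun setT (fun x => f x `^ q * (w x)%:E).
  by move=> mf; exact: measurable_poweR_w.
have pw0 (f : T -> \bar R) q x : 0 <= f x `^ q * (w x)%:E by rewrite mule_ge0// poweR_ge0.
set I := \int[mu]_x (A x `^ r * (w x)%:E) in Ifin *.
set J := \int[mu]_x (B x `^ r * (w x)%:E).
have J0 : 0 <= J by exact: integral_ge0.
have I0 : 0 <= I by exact: integral_ge0.
have N'0 : (0 < 2 * (2^-1 + k `^ (r - 1) * Nc))%R.
  by rewrite mulr_gt0// addr_gt0 ?invr_gt0// mulr_gt0// powR_gt0.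
have [Joo|Jfin] := eqVneq J +oo; first by rewrite Joo gt0_muley ?leey// lte_fin.
have {}Jfin : J < +oo by rewrite ltey.
pose h x := (A x + B x) `^ (r / 2).
have AB0 x : 0 <= A x + B x by exact: adde_ge0.
have mAB : measurable_fun setT (fun x => A x + B x) by exact: emeasurable_funD.
have mh : measurable_fun setT h by exact: (measurableT_comp (measurable_poweR _)).
have h0 x : 0 <= h x by exact: poweR_ge0.
have hx x : h x `^ 2 = (A x + B x) `^ r by rewrite /h -poweRrM divfK.
pose G := \int[mu]_x (h x `^ 2 * (w x)%:E).
have IG : I <= G.
  apply: ge0_le_integral => //; [exact: mpw|exact: mpw|move=> x _].
  by rewrite hx; apply: lee_wpmul2r => //; apply: le_poweR; rewrite ?(ltW r0)// leeDl.
have GIJ : G <= 2%:E * (I + J).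
  rewrite /I /J -ge0_integralD//; [|exact: mpw|exact: mpw].
  rewrite -ge0_integralZl_EFin//; last 2 first.
  - by move=> x _; exact: adde_ge0.
  - by apply: emeasurable_funD; exact: mpw.
  apply: ge0_le_integral => //.
  - exact: mpw.
  - by apply: measurable_funeM; apply: emeasurable_funD; exact: mpw.
  move=> x _; rewrite hx -ge0_muleDl ?poweR_ge0// muleA; apply: lee_wpmul2r => //.
  have two (u v : \bar R) : 0 <= u -> u <= v -> (u + v) `^ r <= 2%:E * v `^ r.
    move=> u0 uv; apply: (@le_trans _ _ ((2%:E * v) `^ r)).
      apply: le_poweR; [exact: ltW|by rewrite adde_ge0// (le_trans u0)|].
      by rewrite (_ : 2%R = (1 + 1)%R :> R)// EFinD ge0_muleDl ?lee_fin// !mul1e leeD2r.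
    rewrite poweRM ?lee_fin ?(le_trans u0 uv)//; apply: lee_wpmul2r; first exact: poweR_ge0.
    by rewrite poweR_EFin lee_fin ler1_powR// ?ltW.
  have [AB|/ltW BA] := leP (A x) (B x).
    apply: (le_trans (two _ _ (A0 x) AB)); apply: lee_wpmul2l => //.
    by rewrite leeDr// poweR_ge0.
  rewrite addeC; apply: (le_trans (two _ _ (B0 x) BA)); apply: lee_wpmul2l => //.
  by rewrite leeDl// poweR_ge0.
have [G_eq0|Gpos] := eqVneq G 0.
  rewrite (_ : I = 0) ?mule_ge0 ?lee_fin ?(ltW N'0)//.
  by apply: le_anti; rewrite I0 andbT -G_eq0.
have {}Gpos : 0 < G by rewrite lt_neqAle eq_sym Gpos integral_ge0.
have Gfin : G < +oo.
  apply: (le_lt_trans GIJ).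
  by rewrite -(fineK (_ : I \is a fin_num)) ?ge0_fin_numE// -(fineK (_ : J \is a fin_num)) ?ge0_fin_numE// -EFinD -EFinM ltry.
have [H [N [[mH H0] [mN N0] hH intH loc]]] := hC _ _ _ _ _ ht Aw AK w_gt0 h mh h0 Gpos Gfin.
have [Av vK] := Ap_majorant_div ht P1 K1' Aw AK w_gt0 C1 mH H0 mN N0 loc s0 e10 ee.
have mHE : measurable_fun setT (EFin \o H) by exact/measurable_EFinP.
have mHt : measurable_fun setT (fun x => (H x)%:E `^ 2 * (w x)%:E) by exact: (mpw (EFin \o H)).
have Ht0 x : 0 <= (H x)%:E `^ 2 * (w x)%:E by exact: (pw0 (EFin \o H)).
pose v x := (H x `^ (- s) * w x)%R.
have mv : measurable_fun setT (fun x => (v x)%:E).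
  apply/measurable_EFinP; apply: measurable_funM => //.
  by apply: (measurableT_comp (@measurable_powR R (- s)%R)).
have v0 x : 0 <= (v x)%:E by rewrite lee_fin mulr_ge0 ?powR_ge0 ?w0'.
have mfv (f : T -> \bar R) : measurable_fun setT f -> measurable_fun setT (fun x => f x * (v x)%:E).
  by move=> mf; exact: emeasurable_funM.
have le_r (f : T -> \bar R) : measurable_fun setT f -> (forall x, 0 <= f x) ->
    (forall x, f x <= A x + B x) ->
    \int[mu]_x (f x * (v x)%:E) <= \int[mu]_x (f x `^ r * (w x)%:E).
  move=> mf f0 fAB; apply: ae_ge0_le_integral => //.
  - by move=> x _; exact: mule_ge0.
  - exact: mfv.
  - exact: mpw.
  exists N; split => // x /= nle; apply: contrapT => Nx; apply: nle => _.
  rewrite /v EFinM muleA; apply: lee_wpmul2r => //; apply: mul_powRN_le => //.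
  apply: le_trans (hH x Nx); apply: le_poweR => //.
  by rewrite divr_ge0// ltW.
have Avfin : \int[mu]_x (A x * (v x)%:E) < +oo.
  by apply: le_lt_trans Ifin; apply: le_r => // x; rewrite leeDl.
have BvJ : \int[mu]_x (B x * (v x)%:E) <= J by apply: le_r => // x; rewrite leeDr.
rewrite EFinM -muleA; apply: le_absorb => //.
apply: (@le_trans _ _ (\int[mu]_x ((k `^ r)%:E * ((H x)%:E `^ 2 * (w x)%:E) +
   (k `^ (r - 1))%:E * (A x * (v x)%:E)))).
  apply: ae_ge0_le_integral => //.
  - exact: mpw.
  - by move=> x _; apply: adde_ge0; apply: mule_ge0; [rewrite lee_fin powR_ge0|exact: Ht0|rewrite lee_fin powR_ge0|exact: mule_ge0].
  - apply: emeasurable_funD; apply: measurable_funeM; [|exact: mfv].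
    exact: mHt.
  exists N; split => // x /= nle; apply: contrapT => Nx; apply: nle => _.
  rewrite /v EFinM !muleA -ge0_muleDl ?mule_ge0 ?poweR_ge0 ?lee_fin ?powR_ge0//.
  apply: lee_wpmul2r => //; rewrite -muleA; apply: poweR_le_mul_powRN => //.
  rewrite ltey; apply/eqP => Aoo; have := hH x Nx.
  by rewrite /h Aoo addye -?ltNye ?(lt_le_trans _ (B0 x))// poweRyr// gt_eqF// divr_gt0.
rewrite ge0_integralD//; last 4 first.
- by move=> x _; rewrite mule_ge0// lee_fin powR_ge0.
- by apply: measurable_funeM; exact: mHt.
- by move=> x _; apply: mule_ge0; [rewrite lee_fin powR_ge0|exact: mule_ge0].
- by apply: measurable_funeM; exact: mfv.
rewrite ge0_integralZl_EFin//; last exact: powR_ge0.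
rewrite ge0_integralZl_EFin//; [|by move=> x _; exact: mule_ge0|exact: mfv|exact: powR_ge0].
have step1 : (k `^ r)%:E * \int[mu]_x ((H x)%:E `^ 2 * (w x)%:E) <= 2^-1%:E * (I + J).
  apply: (@le_trans _ _ ((k `^ r)%:E * (C%:E * (2%:E * (I + J))))).
    apply: lee_wpmul2l; first by rewrite lee_fin powR_ge0.
    by apply: (le_trans intH); apply: lee_wpmul2l; rewrite ?lee_fin ?(ltW C0).
  rewrite !muleA -!EFinM kr (_ : ((4 * C)^-1 * C * 2 = 2^-1)%R)//.
  by field; rewrite gt_eqF.
have step2 : (k `^ (r - 1))%:E * \int[mu]_x (A x * (v x)%:E) <= (k `^ (r - 1) * Nc)%:E * J.
  rewrite EFinM -muleA; apply: lee_wpmul2l; first by rewrite lee_fin powR_ge0.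
  apply: (le_trans (ext _ Av vK Avfin)).
  by apply: lee_wpmul2l => //; rewrite lee_fin ltW.
apply: (le_trans (leeD step1 step2)).
rewrite ge0_muleDr// -addeA addeC EFinD ge0_muleDl ?lee_fin ?invr_ge0 ?mulr_ge0 ?powR_ge0 ?(ltW Nc0)//.
Qed.

Lemma extrapolation : exists P0 L : R, [/\ (1 < P0)%R, (1 <= L)%R & extrapolates P0 L].
Proof.
have [r1|r1|r1] := ltgtP r 1%R.
- exact: extrapolation_lt1.
- by have [L L1 h] := extrapolation_gt1 r1; exists P, L.
- by exists P, K; split => //; exact: extrapolation_eq1.
Qed.

End Extrapolation.

(** * Mixed norms *)

Lemma dyadic_sharp_measurable (R : realType) (K1 K2 delta eps0 N0 : R)
    (d : measure_display) (T : measurableType d) (mu : {measure set T -> \bar R})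
    (X : set T) (rho : T -> T -> R) (I : int -> Type) (Q : forall n : int, I n -> set T)
    (f : T -> R) : (0 < delta < 1)%R -> (0 < eps0)%R ->
  homogeneous_type mu X rho K1 K2 -> dyadic_filtration mu X rho delta eps0 N0 Q ->
  L1loc mu X rho f ->
  measurable_fun X (dyadic_sharp mu Q f) /\ forall x, 0 <= dyadic_sharp mu Q f x.
Proof.
move=> hdelta heps0 ht df [_ floc].
have [M [D [M0 D1 hD]]] := dyadic_constant K1 K2 N0 hdelta heps0.
have [dc cubB] := hD _ _ _ _ _ _ _ ht df.
have fint n x : cub Q n x x -> mu.-integrable (cub Q n x) (EFin \o f).
  move=> xx; have [mA AX _ _] := cub_cube dc xx; have [cB _] := cubB _ _ xx.
  have Xx := AX _ xx.
  have r0 : (0 < M * delta ^ n)%R by rewrite mulr_gt0// exprz_gt0//; case/andP: hdelta.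
  by apply: integrableS (floc x _ Xx r0) => //; exact: (measurable_qball ht).
rewrite (dyadic_sharpE dc fint); split.
  apply: measurable_patch; [exact: dc_meas dc|exact: measurable_cubs dc|].
  by apply: (measurable_dsup dc) => [A|]; [exact: os_ge0|exact: os_set0].
move=> x; rewrite /patch; case: ifPn => // _; apply: dsup_ge0; exact: os_ge0.
Qed.

Section MixedTonelli.
Context (R : realType) (d1 d2 : measure_display)
  (T1 : measurableType d1) (T2 : measurableType d2).
Variables (mu1 : {sigma_finite_measure set T1 -> \bar R})
          (mu2 : {sigma_finite_measure set T2 -> \bar R}).
Hypothesis cmu1 : forall A, mu1.-negligible A -> measurable A.
Hypothesis cmu2 : forall A, mu2.-negligible A -> measurable A.
Local Notation mu := (completed_product mu1 mu2).
Local Notation cT := (caratheodory_type ((mu1 \x mu2 : {measure set (T1 * T2) -> \bar R})^*)%mu).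

Lemma mixed_tonelli (X : set cT) (p : R) (w1 : T1 -> R) (g : cT -> \bar R) :
  measurable X -> measurable_fun X g -> (forall x, (0 <= w1 x)%R) -> measurable_fun setT w1 ->
  let A x2 := \int[mu1]_x1 (`|g (x1, x2)| `^ p * (\1_X (x1, x2))%:E * (w1 x1)%:E) in
  [/\ measurable_fun setT A, forall x2, 0 <= A x2 &
  forall v : T2 -> R, measurable_fun setT v -> (forall x, (0 <= v x)%R) ->
    \int[mu]_(x in X) (`|g x| `^ p * (prod_weight w1 v x)%:E) = \int[mu2]_x2 (A x2 * (v x2)%:E)].
Proof.
move=> mX mg w10 mw1 A.
pose phi (x : cT) : \bar R := `|g x| `^ p * (\1_X x)%:E * (w1 x.1)%:E.
have phi0 x : 0 <= phi x by rewrite !mule_ge0 ?poweR_ge0 ?lee_fin.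
have mphi : measurable_fun setT phi.
  apply: emeasurable_funM.
    rewrite (_ : (fun x : cT => `|g x| `^ p * (\1_X x)%:E) = (fun x : cT => `|g x| `^ p) \_ X).
      apply/(measurable_restrictT _ mX).
      apply: (measurableT_comp (measurable_poweR p)).
      exact: (measurableT_comp (@abse_measurable R setT) mg).
    apply/funext => x; rewrite /patch indicE; case: ifPn => _; by rewrite ?mule1 ?mule0.
  apply: (@measurable_fun_completed _ _ _ _ (fun x : T1 * T2 => (w1 x.1)%:E)).
  apply/measurable_EFinP; exact: (measurableT_comp mw1).
have A0 x2 : 0 <= A x2 by apply: integral_ge0 => x1 _; exact: phi0.
split => //.
  have m0 : measurable_fun setT (cst 0 : T2 -> \bar R) by exact: measurable_cst.
  by have [] := tonelli_completed cmu1 cmu2 mphi phi0 m0 (fun=> lexx 0).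
move=> v mv v0.
have mvE : measurable_fun setT (EFin \o v) by exact/measurable_EFinP.
have vE0 x : 0 <= (EFin \o v) x by rewrite lee_fin.
have [mA <-] := tonelli_completed cmu1 cmu2 mphi phi0 mvE vE0.
rewrite integral_mkcond; apply: eq_integral => x _; rewrite /phi /patch indicE.
case: ifPn => _; last by rewrite mule0 !mul0e.
by rewrite mule1 /prod_weight EFinM muleA.
Qed.

End MixedTonelli.

Theorem corollary2p7 (R : realType) (K1 K2 : R) (delta eps0 N0 : R)
    (Phi : R -> R -> R) (p q p' q' K0 : R)
    (hdelta : (0 < delta < 1)%R) (heps0 : (0 < eps0)%R)
    (hp : (1 < p)%R) (hq : (1 < q)%R) (hp' : (1 < p')%R) (hq' : (1 < q')%R)
    (hK0 : (1 <= K0)%R) :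
  exists eps N : R, (0 < eps)%R /\ (0 < N)%R /\
  forall (d1 d2 : measure_display)
    (T1 : measurableType d1) (T2 : measurableType d2)
    (mu1 : {sigma_finite_measure set T1 -> \bar R})
    (mu2 : {sigma_finite_measure set T2 -> \bar R})
    (rho1 : T1 -> T1 -> R) (rho2 : T2 -> T2 -> R) (X : set (T1 * T2))
    (I : int -> Type) (Q : forall n : int, I n -> set (T1 * T2)),
  homogeneous_type mu1 setT rho1 K1 K2 ->
  homogeneous_type mu2 setT rho2 K1 K2 ->
  let mu := completed_product mu1 mu2 in
  let rho := sum_metric rho1 rho2 in
  homogeneous_type mu X rho K1 K2 ->
  product_weights_Ap mu1 mu2 X rho1 rho2 Phi ->
  dyadic_filtration mu X rho delta eps0 N0 Q ->
  forall (w1 : T1 -> R) (w2 : T2 -> R),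
  Ap_weight mu1 setT rho1 p' w1 -> Ap_const mu1 setT rho1 p' w1 <= K0%:E ->
  Ap_weight mu2 setT rho2 q' w2 -> Ap_const mu2 setT rho2 q' w2 <= K0%:E ->
  forall f : T1 * T2 -> R,
  L1loc mu X rho f ->
  mixed_norm mu1 mu2 X p q w1 w2 (EFin \o f) < +oo ->
  (mu X = +oo \/
   exists (x0 : T1 * T2) (r0 : R),
     [/\ X x0, (0 < r0)%R,
         X `&` [set x | f x != 0%R] `<=` qball X rho x0 r0 &
         mu (qball X rho x0 r0) <= eps%:E * mu X]) ->
  mixed_norm mu1 mu2 X p q w1 w2 (EFin \o f) <=
    N%:E * mixed_norm mu1 mu2 X p q w1 w2 (dyadic_sharp mu Q f).
Proof.
have p0 : (0 < p)%R by exact: lt_trans hp.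
have q0 : (0 < q)%R by exact: lt_trans hq.
have qV0 : (0 < q^-1)%R by rewrite invr_gt0.
have qp0 : (0 < q / p)%R by exact: divr_gt0.
have [eps eps_gt0 hWFS] := weighted_fefferman_stein K1 K2 N0 hdelta heps0.
have [P0 [L [P01 L1 hext]]] := extrapolation K1 K2 hq' hK0 qp0.
pose P := Num.max P0 p'.
have P1 : (1 < P)%R by rewrite lt_max P01.
pose Ka : R := ((1 + K0 `^ (p' - 1)^-1) `^ (P - 1))%R.
pose Kb : R := ((1 + L `^ (P0 - 1)^-1) `^ (P - 1))%R.
pose K := Num.max Ka Kb.
have [KaK KbK] : (Ka <= K)%R /\ (Kb <= K)%R.
  by rewrite /K; clear K; move: Ka Kb => a b; rewrite !le_max !lexx orbT.
have [N1 N10 hN1] := hWFS P (Phi P K) p P1 p0.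
have [N2 N20 hN2] := hext N1 N10.
exists eps, (N2 `^ q^-1)%R; split => //; split; first exact: powR_gt0.
move=> d1 d2 T1 T2 mu1 mu2 rho1 rho2 X I Q ht1 ht2 mu rho ht prodA df w1 w2 Aw1 K1w Aw2 K2w.
move=> f floc norm_fin alt.
have cmu1 A : mu1.-negligible A -> measurable A by exact: (ht_complete ht1).
have cmu2 A : mu2.-negligible A -> measurable A by exact: (ht_complete ht2).
have mX := ht_measurable ht.
have [w10' mw1 _] := Aw1; have w10 x : (0 <= w1 x)%R by exact: w10'.
have [w20' mw2 _] := Aw2; have w20 x : (0 <= w2 x)%R by exact: w20'.
have [/measurable_EFinP mf _] := floc.
have [msh sh0] := dyadic_sharp_measurable hdelta heps0 ht df floc.
have [mA A0 intA] := mixed_tonelli cmu1 cmu2 p mX mf w10 mw1.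
have [mB B0 intB] := mixed_tonelli cmu1 cmu2 p mX msh w10 mw1.
rewrite /mixed_norm in norm_fin *.
set A := (fun x2 => integral mu1 setT _) in mA A0 intA norm_fin *.
set B := (fun x2 => integral mu1 setT _) in mB B0 intB *.
rewrite -poweR_EFin -poweRM ?lee_fin ?(ltW N20)//; last first.
  by apply: integral_ge0 => x _; rewrite mule_ge0 ?poweR_ge0 ?lee_fin.
apply: le_poweR; first exact: ltW.
  by apply: integral_ge0 => x _; rewrite mule_ge0 ?poweR_ge0 ?lee_fin.
have [w2_gt0|] := pselect (forall x s, (0 < s)%R ->
    0 < \int[mu2]_(y in qball setT rho2 x s) (w2 y)%:E); last first.
  move=> /existsNP[x /existsNP[s /not_implyP[s0 /negP]]]; rewrite -leNgt => le0.
  have w2_eq0 := Ap_degenerate ht2 hq' Aw2 K2w (Logic.I : setT x) s0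
    (measurable_qball ht2 Logic.I s0) (@subset_refl _ _) (qball_gt0 ht2 Logic.I s0) le0.
  rewrite (integral_eq0_mul measurableT _ _ _ w2_eq0).
  - apply: mule_ge0; first by rewrite lee_fin ltW.
    by apply: integral_ge0 => y _; rewrite mule_ge0 ?poweR_ge0 ?lee_fin.
  - exact/measurable_EFinP.
  - exact: (measurableT_comp (measurable_poweR _) mA).
  - by move=> y _; rewrite lee_fin.
apply: (hN2 _ _ _ _ _ _ _ ht2 Aw2 K2w w2_gt0 mA A0 mB B0).
  by apply: lty_poweRy norm_fin; rewrite gt_eqF.
move=> v Av Kv Avfin.
have [v0' mv _] := Av; have v0 x : (0 <= v x)%R by exact: v0'.
have [AvP KvP] : Ap_weight mu2 setT rho2 P v /\ Ap_const mu2 setT rho2 P v <= Kb%:E.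
  by apply: (Ap_mono ht2 P01 L1 Av Kv); rewrite le_max lexx.
have [Aw1P Kw1P] : Ap_weight mu1 setT rho1 P w1 /\ Ap_const mu1 setT rho1 P w1 <= Ka%:E.
  by apply: (Ap_mono ht1 hp' hK0 Aw1 K1w); rewrite le_max lexx orbT.
have [AW KW] : Ap_weight mu X rho P (prod_weight w1 v) /\
    Ap_const mu X rho P (prod_weight w1 v) <= (Phi P K)%:E.
  apply: prodA => //.
  - by apply: (le_trans Kw1P); rewrite lee_fin; exact: KaK.
  - by apply: (le_trans KvP); rewrite lee_fin; exact: KbK.
have EA : \int[mu]_(x in X) (`|(f x)%:E| `^ p * (prod_weight w1 v x)%:E) =
  \int[mu2]_x2 (A x2 * (v x2)%:E) by exact: intA.
have EB : \int[mu]_(x in X) (dyadic_sharp mu Q f x `^ p * (prod_weight w1 v x)%:E) =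
    \int[mu2]_x2 (B x2 * (v x2)%:E).
  by rewrite -intB//; apply: eq_integral => x _; rewrite gee0_abs.
rewrite -EA -EB; apply: (hN1 _ _ _ _ _ _ _ _ _ ht df AW KW floc) => //.
by rewrite EA.
Qed.
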